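(* Let $\vec r\in(0,\infty)^m$ and $s\in(1,\infty]$. Let $K\in\mathbb{N}$ and let $\vec t^{\,1},\dots,\vec t^{\,K}\in(0,\infty]^m$ with $\vec t^{\,k}>\vec r$ (coordinatewise) and $1\le t^k<s$ for all $k\in\{1,\dots,K\}$, where $\frac1{t^k}:=\sum_{j=1}^m\frac1{t^k_j}$. Let $(\Omega_k,\mu_k)$, $k\in\{1,\dots,K\}$, be $\sigma$-finite measure spaces and for $j\in\{1,\dots,m\}$ set $$X_j:=L^{t^1_j}(\Omega_1;\cdots;L^{t^K_j}(\Omega_K))$$ (the iterated mixed-norm Lebesgue space over $\Omega_1\times\cdots\times\Omega_K$). Then $\vec X=(X_1,\dots,X_m)\in\mathrm{UMD}_{\vec r,s}$.
   Context: Function spaces. Measure spaces $(\Omega,\mu)$ are $\sigma$-finite. A quasi-Banach function space over $\Omega$ is an order ideal $X\subseteq L^0(\Omega)$ with a quasi-norm such that: $|\xi|\le|\eta|$ implies $\|\xi\|_X\le\|\eta\|_X$; there is $\xi\in X$ with $\xi>0$ a.e.; and (Fatou) if $0\le\xi_n\uparrow\xi$, $\xi_n\in X$, $\sup_n\|\xi_n\|_X<\infty$, then $\xi\in X$ and $\|\xi\|_X=\sup_n\|\xi_n\|_X$. It is a Banach function space if $\|\cdot\|_X$ is a norm. It is order-continuous if $0\le\xi_n\uparrow\xi\in X$ implies $\|\xi_n-\xi\|_X\to0$. If $X$ is an order-continuous Banach function space, its dual $X^*$ is again a Banach function space over $\Omega$ (via the pairing $\int_\Omega\xi\eta\,\mathrm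 d\mu$). $X$ is $p$-convex, $p\in(0,\infty)$, if $\|(\sum_k|\xi_k|^p)^{1/p}\|_X\le(\sum_k\|\xi_k\|_X^p)^{1/p}$ for all finite families (a space satisfying this with a constant is equivalently renormed so that the constant is $1$). The product $\prod_jX_j$ is the space of $\xi$ with $|\xi|\le\prod_j\xi_j$ for some $0\le\xi_j\in X_j$, with $\|\xi\|:=\inf\prod_j\|\xi_j\|_{X_j}$ over such $\xi_j$. An $m$-tuple of quasi-Banach function spaces consists of such spaces over the same measure space whose product is a quasi-Banach function space. For quasi-Banach function spaces $X,Y$ over $\Omega_1,\Omega_2$, the mixed-norm space $X(Y)$ consists of the measurable $f:\Omega_1\times\Omega_2\to\mathbb{C}$ with $\big\|\omega_1\mapsto\|f(\omega_1,\cdot)\|_Y\big\|_X<\infty$; iterated Lebesgue spaces are understood in this sense. Hardy–Littlewood property. Let $\vec X$ be an $n$-tuple of quasi-Banach function spaces with product $X$ and $\vec r\in(0,\infty)^n$, with each $X_j$ being $r_j$-convex. For a finite collection $\mathcal{D}$ of cubes put $\widetilde M^{\mathcal{D}}_{\vec r}(\vec f)(x):=\sup_{Q\in\mathcal{D}}\prod_{j=1}^n\langle f_j\rangle_{r_j,Q}\mathbf 1_Q(x)$ (lattice supremum; $\langle f_j\rangle_{r_j,Q}$ is the function $\omega\mapsto(\frac1{|Q|}\int_Q|f_j(x,\omega)|^{r_j}\mathrm dx)^{1/r_j}$). $\vec X\in\mathrm{HL}_{\vec r}$ means that each $X_j$ is $r_j$-convex and for some $\vec p$ with $\vec r<\vec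 p\le\infty$ (coordinatewise), with $\frac1p:=\sum_j\frac1{p_j}$, one has $\sup_{\mathcal{D}}\|\widetilde M^{\mathcal{D}}_{\vec r}\|_{L^{p_1}(\mathbb{R};X_1)\times\cdots\times L^{p_n}(\mathbb{R};X_n)\to L^p(\mathbb{R};X)}<\infty$, the supremum being over all finite collections of cubes (intervals) in $\mathbb{R}$. (The property does not depend on the choice of $\vec p$, and one may equivalently use $\mathbb{R}^d$ in place of $\mathbb{R}$.) $\mathrm{UMD}_{\vec r,s}$. For $\vec r\in(0,\infty)^m$, $\frac1r:=\sum_j\frac1{r_j}$, and $s\in(r,\infty]$, $\vec X\in\mathrm{UMD}_{\vec r,s}$ means that $X=\prod_jX_j$ is an order-continuous Banach function space and $(X_1,\dots,X_m,X^* )\in\mathrm{HL}_{(r_1,\dots,r_m,s')}$, where $\frac1s+\frac1{s'}=1$. *)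

(* Defs.v *)
From HB Require Import structures.
From mathcomp Require Import all_boot all_order all_algebra.
From mathcomp Require Import all_classical all_reals all_analysis.
From mathcomp.real_closed Require Import complex.

Set Implicit Arguments.
Unset Strict Implicit.
Unset Printing Implicit Defensive.

Import Order.TTheory GRing.Theory Num.Theory.
Import numFieldNormedType.Exports.

Local Open Scope classical_set_scope.
Local Open Scope ring_scope.

(* Bundled sigma-finite measure spaces: the nested products below are defined
   by recursion, so that displays, carriers and measures must travel together. *)
Record sfspace (R : realType) := SFSpace {
  sf_disp : measure_display;
  sf_type :> measurableType sf_disp;
  sf_mu : {sigma_finite_measure set sf_type -> \bar R} }.

Definition line (R : realType) : sfspace R :=
  @SFSpace R _ (measurableTypeR R)
    (@lebesgue_measure R
      : {sigma_finite_measure set (measurableTypeR R) -> \bar R}).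

(* The library's sigma-finite structure on m1 \x m2 is shadowed by the one it
   declares for products of subprobabilities, hence the alias. *)
Definition prod_mu d1 d2 (T1 : measurableType d1) (T2 : measurableType d2)
    (R : realType) (m1 : {sigma_finite_measure set T1 -> \bar R})
    (m2 : {sigma_finite_measure set T2 -> \bar R}) :
  set (T1 * T2)%type -> \bar R := (m1 \x m2)%E.

Section prod_mu_sigma_finite.
Context d1 d2 (T1 : measurableType d1) (T2 : measurableType d2) (R : realType).
Variables (m1 : {sigma_finite_measure set T1 -> \bar R})
          (m2 : {sigma_finite_measure set T2 -> \bar R}).

HB.instance Definition _ := Measure.copy (prod_mu m1 m2)
  ((m1 \x m2)%E : {measure set (T1 * T2)%type -> \bar R}).

Let prod_mu_sigma_finite : sigma_finite setT (prod_mu m1 m2).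
Proof.
have /sigma_finiteP[F [TF ndF Foo]] := sigma_finiteT m1.
have /sigma_finiteP[G [TG ndG Goo]] := sigma_finiteT m2.
exists (fun n => F n `*` G n).
  rewrite -setXTT TF TG predeqE => -[x y]; split.
    move=> [/= [n _ Fnx] [k _ Gky]]; exists (maxn n k) => //; split.
    - by move: x Fnx; exact/subsetPset/ndF/leq_maxl.
    - by move: y Gky; exact/subsetPset/ndG/leq_maxr.
  by move=> [n _ []/= ? ?]; split; exists n.
move=> k; have [? ?] := Foo k; have [? ?] := Goo k.
split; first exact: measurableX.
by rewrite /prod_mu product_measure1E// lte_mul_pinfty// ge0_fin_numE.
Qed.

HB.instance Definition _ := Measure_isSigmaFinite.Build _ _ _ (prod_mu m1 m2)
  prod_mu_sigma_finite.
End prod_mu_sigma_finite.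

Definition prod_sf (R : realType) (S1 S2 : sfspace R) : sfspace R :=
  @SFSpace R _ (S1 * S2)%type
    (prod_mu (sf_mu S1) (sf_mu S2)
      : {sigma_finite_measure set (S1 * S2)%type -> \bar R}).

Section function_spaces.
Context {R : realType}.

(* A function space X over S is encoded by the extended functional
   xi |-> ||xi||_X, with value +oo off X; elements are measurable complex-valued
   functions, and identification modulo null sets is a consequence of the ideal
   property in [is_qbfs]. The values on non-measurable functions are junk. *)
Definition fspace (S : sfspace R) := (S -> R[i]) -> \bar R.

Definition absc (z : R[i]) : R := Normc.normc z.

Definition cmeasurable (S : sfspace R) (xi : S -> R[i]) :=
  measurable_fun setT (fun w => complex.Re (xi w)) /\
  measurable_fun setT (fun w => complex.Im (xi w)).

Definition cfun (S : sfspace R) (g : S -> R) : S -> R[i] := fun w => (g w)%:C%C.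

Definition in_fs (S : sfspace R) (X : fspace S) (xi : S -> R[i]) :=
  cmeasurable xi /\ (X xi < +oo)%E.

(* 0 <= xi_n increases to xi, mu-a.e.; all functions are real valued *)
Definition increases_to (S : sfspace R) (xin : nat -> S -> R) (xi : S -> R) :=
  [/\ forall n, measurable_fun setT (xin n),
      measurable_fun setT xi &
      \forall w \ae sf_mu S, [/\ forall n, 0 <= xin n w,
        forall n, xin n w <= xin n.+1 w &
        (fun n => xin n w) @ \oo --> xi w]].

Record is_qbfs (S : sfspace R) (X : fspace S) : Prop := {
  qbfs_ge0 : forall xi, cmeasurable xi -> (0 <= X xi)%E ;
  qbfs_eq0 : forall xi, cmeasurable xi ->
    (X xi = 0%E <-> \forall w \ae sf_mu S, xi w = 0) ;
  qbfs_homog : forall (a : R[i]) xi, in_fs X xi ->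
    X (fun w => a * xi w) = ((absc a)%:E * X xi)%E ;
  qbfs_triangle : exists K : R, forall xi eta, in_fs X xi -> in_fs X eta ->
    (X (fun w => xi w + eta w)%R <= K%:E * (X xi + X eta))%E ;
  qbfs_ideal : forall xi eta, cmeasurable xi -> in_fs X eta ->
    (\forall w \ae sf_mu S, absc (xi w) <= absc (eta w)) -> (X xi <= X eta)%E ;
  qbfs_unit : exists g : S -> R,
    (\forall w \ae sf_mu S, 0 < g w) /\ in_fs X (cfun g) ;
  qbfs_fatou : forall (xin : nat -> S -> R) (xi : S -> R),
    increases_to xin xi -> (forall n, in_fs X (cfun (xin n))) ->
    (ereal_sup (range (fun n => X (cfun (xin n)))) < +oo)%E ->
    X (cfun xi) = ereal_sup (range (fun n => X (cfun (xin n)))) }.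

Definition is_bfs (S : sfspace R) (X : fspace S) :=
  is_qbfs X /\
  forall xi eta, in_fs X xi -> in_fs X eta ->
    (X (fun w => xi w + eta w)%R <= X xi + X eta)%E.

Definition order_continuous (S : sfspace R) (X : fspace S) :=
  forall (xin : nat -> S -> R) (xi : S -> R),
    increases_to xin xi -> in_fs X (cfun xi) ->
    X (cfun (fun w => xin n w - xi w)) @[n --> \oo] --> 0%E.

Definition pconvex (S : sfspace R) (p : R) (X : fspace S) :=
  forall (n : nat) (xi : 'I_n -> S -> R[i]), (forall k, in_fs X (xi k)) ->
    (X (cfun (fun w => (\sum_(k < n) absc (xi k w) `^ p) `^ p^-1)%R)
     <= (\sum_(k < n) X (xi k) `^ p) `^ p^-1)%E.

(* The infimum over the empty set is +oo, so this is +oo off the product. *)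
Definition prod_fs (S : sfspace R) (m : nat) (X : 'I_m -> fspace S)
    : fspace S := fun xi =>
  ereal_inf [set z | exists eta : 'I_m -> S -> R,
    [/\ forall j, in_fs (X j) (cfun (eta j)),
        forall j w, 0 <= eta j w,
        \forall w \ae sf_mu S, absc (xi w) <= \prod_(j < m) eta j w &
        z = (\prod_(j < m) X j (cfun (eta j)))%E]].

Definition cintegrable (S : sfspace R) (f : S -> R[i]) :=
  (sf_mu S).-integrable setT (fun w => (complex.Re (f w))%:E) /\
  (sf_mu S).-integrable setT (fun w => (complex.Im (f w))%:E).

Definition cintegral (S : sfspace R) (f : S -> R[i]) : R[i] :=
  Complex (Rintegral (sf_mu S) setT (fun w => complex.Re (f w)))
          (Rintegral (sf_mu S) setT (fun w => complex.Im (f w))).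

(* eta is identified with the functional xi |-> \int xi eta on X, and its norm
   is the operator norm of that functional. *)
Definition dual_fs (S : sfspace R) (X : fspace S) : fspace S := fun eta =>
  if `[< forall xi, in_fs X xi -> cintegrable (fun w => xi w * eta w) >]
  then ereal_sup [set z | exists xi, [/\ in_fs X xi, (X xi <= 1)%E &
         z = (absc (cintegral (fun w => xi w * eta w)))%:E]]
  else +oo%E.

Definition Lebesgue (S : sfspace R) (p : \bar R) : fspace S := fun xi =>
  Lnorm (sf_mu S) p (fun w => (absc (xi w))%:E).

(* The X-norm of the class of a [0,+oo]-valued function h: it is +oo when h is
   not a.e. equal to a finite measurable function. When X satisfies [is_qbfs]
   all the representatives g have the same norm. *)
Definition fs_ext (S : sfspace R) (X : fspace S) (h : S -> \bar R) : \bar R :=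
  ereal_inf [set z | exists g : S -> R,
    [/\ measurable_fun setT g, \forall w \ae sf_mu S, (g w)%:E = h w &
        z = X (cfun g)]].

Definition mixed (S1 S2 : sfspace R) (X : fspace S1) (Y : fspace S2)
    : fspace (prod_sf S1 S2) := fun f =>
  fs_ext X (fun w1 => Y (fun w2 => f (w1, w2))).

Fixpoint iter_sf (K : nat) : ('I_K.+1 -> sfspace R) -> sfspace R :=
  match K with
  | 0 => fun Om => Om ord0
  | K'.+1 => fun Om => prod_sf (Om ord0) (iter_sf (fun k => Om (lift ord0 k)))
  end.

(* L^{t_0}(Om_0; L^{t_1}(Om_1; ...; L^{t_K}(Om_K))), outermost space first *)
Fixpoint iter_Lebesgue (K : nat) :
    forall (Om : 'I_K.+1 -> sfspace R), ('I_K.+1 -> \bar R) ->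
      fspace (iter_sf Om) :=
  match K with
  | 0 => fun Om t => Lebesgue (t ord0)
  | K'.+1 => fun Om t =>
      mixed (@Lebesgue (Om ord0) (t ord0))
            (iter_Lebesgue (Om := fun k => Om (lift ord0 k))
                           (fun k => t (lift ord0 k)))
  end.

(* 1 / p = \sum_j 1 / p_j, with +oo^-1 = 0 and 0^-1 = +oo *)
Definition harm (n : nat) (p : 'I_n -> \bar R) : \bar R :=
  ((\sum_(j < n) (p j)^-1)^-1)%E.

(* An interval Q is given by its endpoints; whether these belong to Q does not
   affect the a.e. class of the maximal function. *)
Definition cube (Q : R * R) : set R := [set` `[Q.1, Q.2[].

Definition average (S : sfspace R) (r : R) (f : prod_sf (line R) S -> R[i])
    (Q : R * R) (w : S) : \bar R :=
  (((Q.2 - Q.1)^-1%:E *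
    \int[@lebesgue_measure R]_(x in cube Q) ((absc (f (x, w)) `^ r)%R)%:E)
   `^ r^-1)%E.

Definition lattice_max (S : sfspace R) (n : nat) (D : seq (R * R))
    (r : 'I_n -> R) (f : 'I_n -> prod_sf (line R) S -> R[i])
    (z : prod_sf (line R) S) : \bar R :=
  (\big[maxe/0]_(Q <- D)
    ((\prod_(j < n) average (r j) (f j) Q z.2) * (\1_(cube Q) z.1)%:E))%E.

Definition HL (S : sfspace R) (n : nat) (r : 'I_n -> R) (X : 'I_n -> fspace S)
    : Prop :=
  [/\ forall j, is_qbfs (X j),
      is_qbfs (prod_fs X),
      forall j, 0 < r j /\ pconvex (r j) (X j) &
      exists p : 'I_n -> \bar R, (forall j, ((r j)%:E < p j)%E) /\
      exists C : R, forall D : seq (R * R), all (fun Q => Q.1 < Q.2) D ->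
        forall f : 'I_n -> prod_sf (line R) S -> R[i],
        (forall j, in_fs (mixed (@Lebesgue (line R) (p j)) (X j)) (f j)) ->
        (fs_ext (mixed (@Lebesgue (line R) (harm p)) (prod_fs X))
                (lattice_max D r f)
         <= C%:E * \prod_(j < n) mixed (@Lebesgue (line R) (p j)) (X j) (f j))%E
  ].

Definition fam_rcons (A : Type) (m : nat) (a : 'I_m -> A) (x : A)
    (i : 'I_m.+1) : A :=
  if unlift ord_max i is Some j then a j else x.

Definition UMD (S : sfspace R) (m : nat) (r : 'I_m -> R) (s : \bar R)
    (X : 'I_m -> fspace S) : Prop :=
  [/\ (forall j, 0 < r j) /\ (harm (fun j => (r j)%:E) < s)%E,
      is_bfs (prod_fs X),
      order_continuous (prod_fs X) &
      exists s' : R, [/\ 0 < s', (s^-1 + (s'^-1)%:E)%E = 1%E &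
        HL (fam_rcons r s') (fam_rcons X (dual_fs (prod_fs X)))]].

End function_spaces.

(* Main.v *)
(* Write 1/t for exponents, so that the norm of an iterated Lebesgue space with
   exponents a_k = 1/t_k is a composition of the norms L^(1/a_k). Hoelder's
   inequality and its extremisers show that the product of the X_j and the dual
   of the product are iterated Lebesgue spaces again, with exponents
   sum_j a_(j,k) and 1 - sum_j a_(j,k); hence the exponents of the tuple
   (X_1, ..., X_m, X^* ) sum to 1 at each level.

   For the Hardy-Littlewood property, take for the exponents p_j on the line
   those of the outermost space, so that the target is L^1. After replacing |f_j|^r_j
   by averages over small intervals and using the one-third trick, it suffices
   to bound the multisublinear maximal function on a finite dyadic tree, with
   constants independent of its depth. In the scalar case this is Doob's
   inequality, proved with a Bellman function, and Hoelder's inequality. A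
   stopping-time argument shows that such a bound does not depend on the
   exponents b_j on the tree, as long as sum_j b_j / r_j = 1. Choosing b_j to
   match the next space to be added, Fubini's theorem adds one
   Lebesgue space to the iterated norm, whence an induction on their number. *)
Require Import Defs.
From HB Require Import structures.
From mathcomp Require Import all_boot all_order all_algebra.
From mathcomp Require Import all_classical all_reals all_analysis.
From mathcomp Require Import measurable_realfun ess_sup_inf.
From mathcomp.real_closed Require Import complex.
From mathcomp Require Import ring lra.

Set Implicit Arguments.
Unset Strict Implicit.
Unset Printing Implicit Defensive.

Import Order.TTheory GRing.Theory Num.Theory.
Import numFieldNormedType.Exports.

Local Open Scope classical_set_scope.
Local Open Scope ring_scope.


(** * Measurable nonnegative functions *)

(** Raising to the powers [r j] turns the reciprocal exponents a_(j,k) into u_(j,k) = a_(j,k) r_j <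
    1. In that range Minkowski's and Doob's inequalities hold, although the spaces X_j themselves
    may only be quasi-normed.

    The obstacle is that nested norms can be interchanged freely only for equal exponents. An outer
    space can be attached by Fubini only when the tree carries the same exponents, and these change
    from level to level. It is overcome by [qmax], a scalar quantity in which no exponent b_j
    occurs: the sum over the leaves of the product of powers of the dyadic maximal functions of the
    norms of the leaf values. A bound for one choice of exponents implies a bound by [qmax], and
    Doob and Hoelder bound [qmax] for every other choice. The first implication is an induction on
    the depth in which the constant must not grow: stopped and unstopped leaves are charged to
    disjoint parts of [qmax] with the same constant, which is possible because at most half of the
    leaves are stopped.

    Duality passes through nested norms because the norming functions form sequences that depend
    measurably on the outer variables. *)

Section ereal_facts.
Context {R : realType}.
Local Open Scope ereal_scope.
Implicit Types (x y c : \bar R) (r : R).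

Lemma le_poweR r x y : (0 <= r)%R -> 0 <= x -> x <= y -> x `^ r <= y `^ r.
Proof.
move=> r0 x0 xy; apply: gt0_ler_poweR => //; rewrite in_itv/= leey andbT//.
exact: le_trans xy.
Qed.

Lemma poweRK r x : (r != 0)%R -> 0 <= x -> (x `^ r) `^ r^-1 = x.
Proof. by move=> r0 x0; rewrite -poweRrM mulfV// poweRe1. Qed.

Lemma poweRVK r x : (r != 0)%R -> 0 <= x -> (x `^ r^-1) `^ r = x.
Proof. by move=> r0 x0; rewrite -poweRrM mulVf// poweRe1. Qed.

Lemma poweR_le r x c : (0 < r)%R -> 0 <= x -> 0 <= c ->
  (x `^ r <= c) = (x <= c `^ r^-1).
Proof.
move=> r0 x0 c0; have rN0 := lt0r_neq0 r0; apply/idP/idP => h.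
  by rewrite -(poweRK rN0 x0); apply: le_poweR => //;
     rewrite ?invr_ge0 ?(ltW r0)// poweR_ge0.
by rewrite -(poweRVK rN0 c0); apply: le_poweR => //; rewrite ltW.
Qed.

Definition esupn (u : nat -> \bar R) := ereal_sup (range u).

Lemma esupn_ub u n : u n <= esupn u.
Proof. by apply: ereal_sup_ubound; exists n. Qed.

Lemma esupn_le u c : (forall n, u n <= c) -> esupn u <= c.
Proof. by move=> uc; apply: ge_ereal_sup => _ [n _ <-]. Qed.

Lemma eq_esupn u v : u =1 v -> esupn u = esupn v.
Proof. by move=> /funext ->. Qed.

Lemma esupn_ge0 u : (forall n, 0 <= u n) -> 0 <= esupn u.
Proof. by move=> u0; exact: le_trans (u0 0%N) (esupn_ub u 0). Qed.

Lemma esupn_poweR u r : (0 < r)%R -> (forall n, 0 <= u n) ->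
  (esupn u) `^ r = esupn (fun n => u n `^ r).
Proof.
move=> r0 u0; apply/eqP; rewrite eq_le; apply/andP; split.
  rewrite poweR_le ?esupn_ge0//; last by move=> n; rewrite poweR_ge0.
  apply: esupn_le => n; rewrite -poweR_le//.
    exact: (@esupn_ub (fun n => u n `^ r)).
  by apply: esupn_ge0 => k; rewrite poweR_ge0.
apply: esupn_le => n; apply: le_poweR; rewrite ?(ltW r0)//; exact: esupn_ub.
Qed.

End ereal_facts.

Section mnn.
Context {R : realType} d (T : measurableType d).
Local Open Scope ereal_scope.

Definition mnn (h : T -> \bar R) :=
  measurable_fun [set: T] h /\ forall x, 0 <= h x.

Lemma mnn_poweR h r : mnn h -> mnn (fun x => h x `^ r).
Proof.
move=> [mh h0]; split=> [|x]; last exact: poweR_ge0.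
exact: (@measurableT_comp _ _ _ _ _ _ (fun x => x `^ r) _ h (measurable_poweR r)).
Qed.

Lemma mnnM g h : mnn g -> mnn h -> mnn (fun x => g x * h x).
Proof.
move=> [mg g0] [mh h0]; split=> [|x]; last exact: mule_ge0.
exact: emeasurable_funM.
Qed.

Lemma mnnD g h : mnn g -> mnn h -> mnn (fun x => g x + h x).
Proof.
move=> [mg g0] [mh h0]; split=> [|x]; last exact: adde_ge0.
exact: emeasurable_funD.
Qed.

Lemma mnn_cst (c : \bar R) : 0 <= c -> mnn (fun=> c).
Proof. by move=> c0; split. Qed.

Lemma mnn_esupn (h : nat -> T -> \bar R) : (forall n, mnn (h n)) ->
  mnn (fun x => esupn (h ^~ x)).
Proof.
move=> mh; split=> [|x]; last by apply: esupn_ge0 => n; apply: (mh n).2.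
have -> : (fun x => esupn (h ^~ x)) = (fun x => esups (h ^~ x) 0%N).
  apply/funext => x; rewrite /esups /sdrop /esupn; congr ereal_sup.
  by apply/seteqP; split=> [_ [n _ <-]|_ [n _ <-]]; exists n.
by apply: measurable_fun_esups => n; apply: (mh n).1.
Qed.

Lemma mnn_fine (h : T -> \bar R) : mnn h -> mnn (fun x => (fine (h x))%:E).
Proof.
move=> [mh h0]; split => [|x]; last by rewrite lee_fin fine_ge0.
by apply/measurable_EFinP; apply: measurableT_comp.
Qed.

End mnn.

Lemma mnn_comp {R : realType} d d' (T : measurableType d)
  (T' : measurableType d') (u : T' -> T) (h : T -> \bar R) :
  mnn h -> measurable_fun setT u -> mnn (fun x => h (u x)).
Proof. by move=> [mh h0] mu; split => // ; exact: measurableT_comp. Qed.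

Lemma mnn_pair2 {R : realType} d d' (T : measurableType d)
  (T' : measurableType d') (h : T * T' -> \bar R) t :
  mnn h -> mnn (fun w => h (t, w)).
Proof. by move=> mh; apply: mnn_comp mh _; exact: measurable_pair1. Qed.

Lemma mnn_pair1 {R : realType} d d' (T : measurableType d)
  (T' : measurableType d') (h : T * T' -> \bar R) w :
  mnn h -> mnn (fun t => h (t, w)).
Proof. by move=> mh; apply: mnn_comp mh _; exact: measurable_pair2. Qed.

Section integral_facts.
Context {R : realType} (S : sfspace R).
Local Open Scope ereal_scope.
Notation mu := (sf_mu S).

Lemma le_int (f g : S -> \bar R) : mnn f -> mnn g ->
  (\forall x \ae mu, f x <= g x) -> \int[mu]_x f x <= \int[mu]_x g x.
Proof.
move=> [mf f0] [mg g0] fg; apply: ae_ge0_le_integral => //.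
by apply: filterS fg.
Qed.

Lemma eq_int_ae (f g : S -> \bar R) : mnn f -> mnn g ->
  (\forall x \ae mu, f x = g x) -> \int[mu]_x f x = \int[mu]_x g x.
Proof.
by move=> mf mg fg; apply/eqP; rewrite eq_le !le_int//; apply: filterS fg => x ->.
Qed.

Lemma int_eq0 (f : S -> \bar R) : mnn f -> \int[mu]_x f x = 0 ->
  \forall x \ae mu, f x = 0.
Proof.
move=> [mf f0] int0; have : \int[mu]_x `|f x| = 0.
  by rewrite -int0; apply: eq_integral => x _; rewrite gee0_abs.
by move/(ae_eq_integral_abs mu measurableT mf); apply: filterS => x /(_ I).
Qed.

Lemma int_fin (f : S -> \bar R) : mnn f -> \int[mu]_x f x < +oo ->
  \forall x \ae mu, f x < +oo.
Proof.
move=> [mf f0] intf; have : mu.-integrable setT f.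
  apply/integrableP; split => //; rewrite (eq_integral f)// => x _.
  by rewrite gee0_abs.
move/integrable_ae => /(_ measurableT); apply: filterS => x /(_ I).
by rewrite fin_numE ltey => /andP[].
Qed.

Lemma int_esupn (f : nat -> S -> \bar R) : (forall n, mnn (f n)) ->
  (forall n x, f n x <= f n.+1 x) ->
  \int[mu]_x esupn (f ^~ x) = esupn (fun n => \int[mu]_x f n x).
Proof.
move=> mf fS.
have ndf x : nondecreasing_seq (f ^~ x) by apply/nondecreasing_seqP => n.
transitivity (\int[mu]_x limn (f ^~ x)).
  apply: eq_integral => x _; apply/esym/cvg_lim => //.
  exact: ereal_nondecreasing_cvgn.
rewrite monotone_convergence//; last 2 first.
- by move=> n; apply: (mf n).1.
- by move=> n x _; apply: (mf n).2.
apply: cvg_lim => //; apply: ereal_nondecreasing_cvgn.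
apply/nondecreasing_seqP => n; apply: le_int => //.
by apply: nearW => x; exact: fS.
Qed.

End integral_facts.

Section ae_prod.
Context {R : realType} (S1 S2 : sfspace R).
Local Open Scope ereal_scope.

Lemma ae_prod_sections (P : S1 * S2 -> Prop) :
  (\forall w \ae sf_mu (prod_sf S1 S2), P w) ->
  \forall w1 \ae sf_mu S1, \forall w2 \ae sf_mu S2, P (w1, w2).
Proof.
move=> [N [mN N0 PN]].
have mF : mnn (fun w1 => sf_mu S2 (xsection N w1)).
  by split => //; exact: (measurable_fun_xsection (sf_mu S2) mN).
have := int_eq0 mF N0; apply: filterS => w1 Nw1.
exists (xsection N w1); split => //; first exact: measurable_xsection.
by move=> w2 /= Pw; rewrite /xsection/= inE; exact: PN.
Qed.

Lemma ae_sections_prod (P : S1 * S2 -> Prop) : measurable (~` [set w | P w]) ->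
  (\forall w1 \ae sf_mu S1, \forall w2 \ae sf_mu S2, P (w1, w2)) ->
  \forall w \ae sf_mu (prod_sf S1 S2), P w.
Proof.
move=> mP aeP; exists (~` [set w | P w]); split => //=.
rewrite /prod_mu /product_measure1 /=.
rewrite -[RHS](@integral0 _ _ _ (sf_mu S1) setT); apply: eq_int_ae.
- by split => //; exact: (measurable_fun_xsection (sf_mu S2) mP).
- exact: mnn_cst.
apply: filterS aeP => w1 [N [mN N0 PN]].
apply: (@subset_measure0 _ _ _ _ _ N) => //; first exact: measurable_xsection.
by move=> w2; rewrite /xsection/= inE => nP; exact: PN.
Qed.

Lemma int_prod (h : prod_sf S1 S2 -> \bar R) : mnn h ->
  \int[sf_mu (prod_sf S1 S2)]_w h w =
  \int[sf_mu S1]_w1 \int[sf_mu S2]_w2 h (w1, w2).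
Proof. by move=> [mh h0]; rewrite -(fubini_tonelli1 h). Qed.

Lemma int_swap (h : S1 * S2 -> \bar R) : mnn h ->
  \int[sf_mu S1]_w1 \int[sf_mu S2]_w2 h (w1, w2) =
  \int[sf_mu S2]_w2 \int[sf_mu S1]_w1 h (w1, w2).
Proof. by move=> [mh h0]; exact: fubini_tonelli. Qed.

End ae_prod.

Lemma mnn_int {R : realType} d (T : measurableType d) (S : sfspace R)
  (h : T * S -> \bar R) : mnn h -> mnn (fun t => \int[sf_mu S]_w h (t, w))%E.
Proof.
move=> [mh h0]; split=> [|t]; last by apply: integral_ge0 => w _.
exact: (measurable_fun_fubini_tonelli_F h).
Qed.

(** * Mixed norms with exponents written as reciprocals *)

Section nm.
Context {R : realType} (S : sfspace R).
Local Open Scope ereal_scope.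
Notation mu := (sf_mu S).

(* The L^(1/a)-norm of a [0, +oo]-valued function, with 1/0 = +oo. *)
Definition nm (a : R) (h : S -> \bar R) : \bar R :=
  if a == 0%R then maxe 0 (ess_sup mu h)
  else (\int[mu]_x (h x `^ a^-1)) `^ a.

Lemma nm0_leP h c : 0 <= c -> nm 0 h <= c <-> \forall x \ae mu, h x <= c.
Proof.
move=> c0; rewrite /nm eqxx ge_max c0/=; split; first by move/ess_supP.
by move=> ?; apply/ess_supP.
Qed.

Lemma nm_ge0 a h : 0 <= nm a h.
Proof. by rewrite /nm; case: ifPn => _; [rewrite le_max lexx|exact: poweR_ge0]. Qed.

Lemma nm0_ub h : \forall x \ae mu, h x <= nm 0 h.
Proof. by apply/nm0_leP => //; exact: nm_ge0. Qed.

Lemma nm_leP a h c : (0 < a)%R -> mnn h -> 0 <= c ->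
  (nm a h <= c) = (\int[mu]_x (h x `^ a^-1) <= c `^ a^-1).
Proof.
move=> a0 mh c0; rewrite /nm gt_eqF// poweR_le//.
by apply: integral_ge0 => x _; exact: poweR_ge0.
Qed.

Lemma nm1 h : mnn h -> nm 1 h = \int[mu]_x h x.
Proof.
move=> [mh h0]; rewrite /nm oner_eq0 invr1 poweRe1; last first.
  by apply: integral_ge0 => x _; exact: poweR_ge0.
by apply: eq_integral => x _; rewrite poweRe1.
Qed.

Lemma le_nm a g h : (0 <= a)%R -> mnn g -> mnn h ->
  (\forall x \ae mu, g x <= h x) -> nm a g <= nm a h.
Proof.
move=> a0 mg mh gh; move: a0; rewrite le_eqVlt => /predU1P[<-|a0].
  apply/nm0_leP; first exact: nm_ge0.
  by apply: filterS2 gh (nm0_ub h) => x; exact: le_trans.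
rewrite /nm gt_eqF//; apply: le_poweR; first exact: ltW.
  by apply: integral_ge0 => x _; exact: poweR_ge0.
apply: le_int; try exact: mnn_poweR.
apply: filterS gh => x; apply: le_poweR; last exact: mg.2.
by rewrite invr_ge0 ltW.
Qed.

Lemma nmZ a (c : R) h : (0 <= a)%R -> (0 <= c)%R -> mnn h ->
  nm a (fun x => c%:E * h x) = c%:E * nm a h.
Proof.
move=> a0 c0 mh; move: a0; rewrite le_eqVlt => /predU1P[<-|a0]; last first.
  rewrite /nm gt_eqF//.
  under eq_integral do rewrite poweRM ?lee_fin// ?mh.2//.
  rewrite ge0_integralZl ?poweR_ge0//; last 2 first.
  - exact: (mnn_poweR _ mh).1.
  - by move=> x _; exact: poweR_ge0.
  rewrite poweRM ?poweR_ge0//; last first.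
    by apply: integral_ge0 => x _; exact: poweR_ge0.
  by rewrite poweRVK// gt_eqF.
have leZ (b : R) g : (0 <= b)%R -> nm 0 (fun x => b%:E * g x) <= b%:E * nm 0 g.
  move=> b0; apply/nm0_leP; first by rewrite mule_ge0// nm_ge0.
  by apply: filterS (nm0_ub g) => x gx; rewrite lee_wpmul2l.
apply/eqP; rewrite eq_le leZ//=; have [->|cN0] := eqVneq c 0%R.
  by rewrite mul0e nm_ge0.
have c_gt0 : (0 < c)%R by rewrite lt0r cN0.
rewrite muleC -lee_pdivlMr// muleC -[X in nm 0 X <= _](_ : (fun x =>
  (c^-1)%:E * (c%:E * h x)) = _); first by rewrite leZ// invr_ge0.
by apply/funext => x; rewrite muleA -EFinM mulVf// mul1e.
Qed.

Lemma nm_eq0 a h : (0 <= a)%R -> mnn h -> nm a h = 0 ->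
  \forall x \ae mu, h x = 0.
Proof.
move=> a0 mh; move: a0; rewrite le_eqVlt => /predU1P[<-|a0] n0.
  have := nm0_ub h; rewrite n0; apply: filterS => x hx.
  by apply/eqP; rewrite eq_le hx mh.2.
move: n0; rewrite /nm gt_eqF// => /poweR_eq0_eq0 n0.
have /int_eq0 := n0 (integral_ge0 _ (fun x _ => poweR_ge0 _ _)).
move=> /(_ (mnn_poweR _ mh)); apply: filterS => x /poweR_eq0_eq0; apply.
exact: mh.2.
Qed.

Lemma nm_fin a h : (0 <= a)%R -> mnn h -> nm a h < +oo ->
  \forall x \ae mu, h x < +oo.
Proof.
move=> a0 mh; move: a0; rewrite le_eqVlt => /predU1P[<-|a0] noo.
  by apply: filterS (nm0_ub h) => x /le_lt_trans; exact.
move: noo; rewrite /nm gt_eqF// => /lty_poweRy noo.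
have /int_fin := noo (lt0r_neq0 a0).
move=> /(_ (mnn_poweR _ mh)); apply: filterS => x /lty_poweRy; apply.
by rewrite invr_eq0 gt_eqF.
Qed.

Lemma nm_esupn a (h : nat -> S -> \bar R) : (0 <= a)%R ->
  (forall n, mnn (h n)) -> (forall n x, h n x <= h n.+1 x) ->
  nm a (fun x => esupn (h ^~ x)) = esupn (fun n => nm a (h n)).
Proof.
move=> a0 mh hS; move: (a0); rewrite le_eqVlt => /predU1P[<-|a1].
  apply/eqP; rewrite eq_le; apply/andP; split; last first.
    apply: esupn_le => n; apply: le_nm => //; first exact: mnn_esupn.
    by apply: nearW => x; exact: (esupn_ub (h ^~ x)).
  apply/nm0_leP; first by apply: esupn_ge0 => n; exact: nm_ge0.
  have /ae_foralln : forall n, \forall x \ae mu, h n x <= nm 0 (h n).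
    by move=> n; exact: nm0_ub.
  apply: filterS => x hx; apply: esupn_le => n; apply: le_trans (hx n) _.
  exact: (esupn_ub (fun n => nm 0 (h n))).
rewrite /nm gt_eqF//.
transitivity ((\int[mu]_x esupn (fun n => h n x `^ a^-1)) `^ a).
  congr (_ `^ _); apply: eq_integral => x _; rewrite esupn_poweR ?invr_gt0//.
  by move=> n; exact: (mh n).2.
rewrite int_esupn; last 2 first.
- by move=> n; exact: mnn_poweR.
- move=> n x; apply: le_poweR; rewrite ?invr_ge0//; exact: (mh n).2.
by rewrite esupn_poweR// => n; apply: integral_ge0 => x _; exact: poweR_ge0.
Qed.

Lemma sigma_finite_unit : exists k : S -> \bar R, [/\ mnn k,
  forall x, 0 < k x & \int[mu]_x k x < +oo].
Proof.
have /sigma_finiteP[F [TF ndF Foo]] := sigma_finiteT mu.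
(* With these weights the n-th term has integral at most 2^-(n+1), so the series has integral at
   most 1. *)
pose c n : R := ((1 / (2 ^ n.+1)%:R) / (1 + fine (mu (F n))))%R.
have c0 n : (0 < c n)%R.
  by rewrite !divr_gt0// ltr_pwDl// fine_ge0.
have mc n : mnn (fun x => (c n)%:E * (\1_(F n) x)%:E).
  split=> [|x]; last by rewrite mule_ge0// lee_fin// ltW.
  apply: emeasurable_funM => //; apply/measurable_EFinP/measurable_indic.
  by case: (Foo n).
exists (fun x => \sum_(n <oo) ((c n)%:E * (\1_(F n) x)%:E)); split.
- split=> [|x]; last by apply: nneseries_ge0 => n _ _; exact: (mc n).2.
  by apply: ge0_emeasurable_sum => [n x _ _|n _]; [exact: (mc n).2|exact: (mc n).1].
- move=> x; have [n _ Fx] : (\bigcup_i F i) x by rewrite -TF.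
  apply: (@lt_le_trans _ _ ((c n)%:E * (\1_(F n) x)%:E)).
    by rewrite indicE mem_set// mule1 lte_fin.
  apply: le_trans (nneseries_lim_ge n.+1 (fun k _ _ => (mc k).2 x)).
  by rewrite big_nat_recr//= leeDr// sume_ge0// => k _; exact: (mc k).2.
rewrite integral_nneseries//; last 2 first.
- by move=> n; exact: (mc n).1.
- by move=> n x _; exact: (mc n).2.
apply: (@le_lt_trans _ _ 1); last exact: ltry.
apply: le_trans (epsilon_trick0 (fun=> true) (ler01 : 0 <= 1 :> R)%R).
apply: lee_nneseries => [n _ _|n _].
  by apply: integral_ge0 => x _; exact: (mc n).2.
have [mF Fn] := Foo n.
rewrite ge0_integralZl_EFin//; last 2 first.
- exact/measurable_EFinP/measurable_indic.
- exact: ltW.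
rewrite integral_indic// setIT -[X in _ * X]fineK ?ge0_fin_numE//.
rewrite -EFinM lee_fin /c -(mulrA (1 / _)%R) ler_piMr ?divr_ge0//.
have m0 : (0 <= fine (mu (F n)))%R by rewrite fine_ge0.
by rewrite mulrC ler_pdivrMr ?ltr_pwDl// mul1r lerDr.
Qed.

Lemma nm_unit a : (0 <= a)%R -> exists k : S -> \bar R, [/\ mnn k,
  forall x, 0 < k x & nm a k < +oo].
Proof.
rewrite le_eqVlt => /predU1P[<-|a0].
  exists (cst 1); split => //.
  apply: (@le_lt_trans _ _ 1); last exact: ltry.
  by apply/nm0_leP => //; exact: nearW.
have [k [mk k0 ik]] := sigma_finite_unit.
exists (fun x => k x `^ a); split => //; first exact: mnn_poweR.
  by move=> x; exact: poweR_gt0.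
rewrite /nm gt_eqF// poweR_lty//.
under eq_integral do rewrite poweRK ?lt0r_neq0// ?mk.2//.
by [].
Qed.

End nm.

(** For a = 0, the norm of a section exceeds c >= 0 exactly when the section of {h > c} has positive
    measure, and that measure is a measurable function of t. *)
Lemma nm_meas {R : realType} (S : sfspace R) a d (T : measurableType d)
    (h : T * S -> \bar R) : mnn h ->
  mnn (fun t => nm a (fun w => h (t, w))).
Proof.
move=> mh; split=> [|t]; last exact: nm_ge0.
have [->|a0] := eqVneq a 0%R; last first.
  rewrite (_ : (fun _ => _) = (fun t =>
    (\int[sf_mu S]_w (h (t, w) `^ a^-1)) `^ a)%E); last first.
    by apply/funext => t; rewrite /nm (negbTE a0).
  exact: (mnn_poweR a (mnn_int (S := S) (mnn_poweR a^-1 mh))).1.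
apply: (measurability _ (ErealGenOInfty.measurableE R)) => // _ [_ [c ->] <-].
rewrite setTI; have [c0|c0] := ltP c 0%R.
  rewrite [X in measurable X](_ : _ = setT)//; apply/seteqP; split => // t _ /=.
  by rewrite in_itv/= andbT (lt_le_trans _ (nm_ge0 _ _))// lte_fin.
have mA : measurable [set z | (c%:E < h z)%E].
  by rewrite -[X in measurable X]setTI; apply: emeasurable_fun_o_infty => //;
    exact: mh.1.
pose A := [set z | (c%:E < h z)%E].
have m1A : mnn (fun z => (\1_A z : R)%:E).
  split=> [|z]; last by rewrite lee_fin.
  exact/measurable_EFinP/measurable_indic.
have [mI _] := mnn_int (S := S) m1A.
have -> : (fun t => nm 0 (fun w => h (t, w))) @^-1` `]c%:E, +oo[ =
  setT `&` [set t | (\int[sf_mu S]_w (\1_A (t, w) : R)%:E)%E != 0%E].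
  rewrite setTI; apply/seteqP; split => t /=; rewrite in_itv/= andbT.
    rewrite ltNge => /negP; apply: contra_not_neq => /int_eq0 i0.
    apply/nm0_leP => //.
    have := i0 (mnn_pair2 t m1A); apply: filterS => w.
    rewrite indicE leNgt => -[/eqP]; rewrite pnatr_eq0 eqb0 => /negP nA.
    by apply/negP => cht; apply: nA; rewrite inE.
  rewrite ltNge => i0; apply/negP => /nm0_leP hc; move/eqP: i0; apply.
  have {}hc := hc c0.
  rewrite -[RHS](@integral0 _ _ _ (sf_mu S) setT); apply: eq_int_ae.
  - exact: (mnn_pair2 t m1A).
  - exact: mnn_cst.
  apply: filterS hc => w hw; rewrite indicE memNset//=.
  by apply/negP; rewrite -leNgt.
exact: emeasurable_neq.
Qed.

(** The properties of [nm a], for every a >= 0, that are inherited by nested norms. There is no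
    triangle inequality among them, since a > 1 gives only a quasi-norm. [fn_meas] has a parameter
    space so that an outer norm can be applied to the inner one. *)
Record fnorm {R : realType} (S : sfspace R) (N : (S -> \bar R) -> \bar R) :
    Prop := {
  fn_meas : forall d (T : measurableType d) (h : T * S -> \bar R), mnn h ->
    mnn (fun t => N (fun w => h (t, w))) ;
  fn_ge0 : forall h, (0 <= N h)%E ;
  fn_le : forall g h, mnn g -> mnn h ->
    (\forall w \ae sf_mu S, (g w <= h w)%E) -> (N g <= N h)%E ;
  fn_Z : forall (c : R) h, (0 <= c)%R -> mnn h ->
    N (fun w => c%:E * h w)%E = (c%:E * N h)%E ;
  fn_eq0 : forall h, mnn h -> N h = 0%E -> \forall w \ae sf_mu S, h w = 0%E ;
  fn_fin : forall h, mnn h -> (N h < +oo)%E ->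
    \forall w \ae sf_mu S, (h w < +oo)%E ;
  fn_esupn : forall h : nat -> S -> \bar R, (forall n, mnn (h n)) ->
    (forall n w, (h n w <= h n.+1 w)%E) ->
    N (fun w => esupn (h ^~ w)) = esupn (fun n => N (h n)) ;
  fn_unit : exists k : S -> \bar R,
    [/\ mnn k, forall w, (0 < k w)%E & (N k < +oo)%E] }.

Definition mixn {R : realType} (S1 S2 : sfspace R) (a : R)
    (N : (S2 -> \bar R) -> \bar R) (h : prod_sf S1 S2 -> \bar R) : \bar R :=
  nm (S := S1) a (fun w1 => N (fun w2 => h (w1, w2))).

Lemma fnorm_nm {R : realType} (S : sfspace R) a : (0 <= a)%R ->
  fnorm (S := S) (nm a).
Proof.
move=> a0; split.
- by move=> d T h mh; exact: nm_meas.
- by move=> h; exact: nm_ge0.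
- by move=> g h; exact: le_nm.
- by move=> c h; exact: nmZ.
- by move=> h; exact: nm_eq0.
- by move=> h; exact: nm_fin.
- by move=> h; exact: nm_esupn.
- exact: nm_unit.
Qed.

Section fnorm_theory.
Context {R : realType} (S : sfspace R) (N : (S -> \bar R) -> \bar R).
Hypothesis FN : fnorm N.
Local Open Scope ereal_scope.

Lemma fn_eq g h : mnn g -> mnn h ->
  (\forall w \ae sf_mu S, g w = h w) -> N g = N h.
Proof.
move=> mg mh gh; apply/eqP; rewrite eq_le; apply/andP; split;
  by apply: (fn_le FN) => //; apply: filterS gh => w ->.
Qed.

Lemma fn_0 : N (fun=> 0) = 0.
Proof.
have := fn_Z FN (lexx 0%R) (mnn_cst S (lexx 0)); rewrite [RHS]mul0e => {2}<-.
by congr N; apply/funext => w; rewrite mul0e.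
Qed.

Lemma fn_eq0P h : mnn h -> N h = 0 <-> \forall w \ae sf_mu S, h w = 0.
Proof.
move=> mh; split; first exact: (fn_eq0 FN).
by move=> h0; rewrite -fn_0; apply: fn_eq => //; exact: mnn_cst.
Qed.

End fnorm_theory.

Section mixn.
Context {R : realType} (S1 S2 : sfspace R) (a : R)
  (N : (S2 -> \bar R) -> \bar R).
Hypotheses (a0 : (0 <= a)%R) (FN : fnorm N).
Local Open Scope ereal_scope.
Local Notation M := (mixn (S1 := S1) a N).

Lemma measurable_assoc d (T : measurableType d) :
  measurable_fun [set: T * S1 * S2] (fun z => (z.1.1, (z.1.2, z.2))).
Proof.
by apply/measurable_fun_pair; [exact: measurableT_comp|
  apply/measurable_fun_pair => //; exact: measurableT_comp].
Qed.

Lemma fnorm_mix : fnorm (S := prod_sf S1 S2) M.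
Proof.
split.
- move=> d T h mh.
  have mh' : mnn (fun z : T * S1 * S2 => h (z.1.1, (z.1.2, z.2))).
    by apply: (mnn_comp mh); exact: measurable_assoc.
  exact: (nm_meas (S := S1) a (fn_meas FN mh')).
- by move=> h; exact: nm_ge0.
- move=> g h mg mh /ae_prod_sections gh; apply: le_nm => //.
  + exact: (fn_meas FN mg).
  + exact: (fn_meas FN mh).
  + apply: filterS gh => w1 gh; apply: (fn_le FN) => //.
    * exact: (mnn_pair2 (T := S1) (T' := S2) _ mg).
    * exact: (mnn_pair2 (T := S1) (T' := S2) _ mh).
- move=> c h c0 mh; rewrite /mixn -nmZ//; last exact: (fn_meas FN mh).
  congr nm; apply/funext => w1; rewrite (fn_Z FN)//.
  exact: (mnn_pair2 (T := S1) (T' := S2) _ mh).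
- move=> h mh /nm_eq0 => /(_ a0 (fn_meas FN mh)) h0.
  apply: ae_sections_prod.
    rewrite -[X in measurable X]setTI.
    have -> : ~` [set w | h w = 0] = [set w | h w != 0].
      by apply/seteqP; split => w /= /eqP.
    by apply: emeasurable_neq => //; exact: mh.1.
  apply: filterS h0 => w1; apply: (fn_eq0 FN).
  exact: (mnn_pair2 (T := S1) (T' := S2) _ mh).
- move=> h mh /nm_fin => /(_ a0 (fn_meas FN mh)) hoo.
  apply: ae_sections_prod.
    rewrite -[X in measurable X]setTI.
    have -> : ~` [set w | h w < +oo] = [set w | +oo <= h w].
      by apply/seteqP; split => w /=; rewrite leNgt => /negP.
    by apply: emeasurable_fun_c_infty => //; exact: mh.1.
  apply: filterS hoo => w1; apply: (fn_fin FN).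
  exact: (mnn_pair2 (T := S1) (T' := S2) _ mh).
- move=> h mh hS; rewrite /mixn -nm_esupn//.
  + congr nm; apply/funext => w1; rewrite -(fn_esupn FN)// => n.
    exact: (mnn_pair2 (T := S1) (T' := S2) _ (mh n)).
  + by move=> n; exact: (fn_meas FN (mh n)).
  + move=> n w1; apply: (fn_le FN).
    * exact: (mnn_pair2 (T := S1) (T' := S2) _ (mh n)).
    * exact: (mnn_pair2 (T := S1) (T' := S2) _ (mh n.+1)).
    * exact: nearW.
- have [k1 [mk1 k10 k1oo]] := nm_unit S1 a0.
  have [k2 [mk2 k20 k2oo]] := fn_unit FN.
  have k2fin : N k2 \is a fin_num by rewrite ge0_fin_numE// (fn_ge0 FN).
  (* [k1] and [k2] may be infinite on a null set *)
  pose k1' w := (fine (mine (k1 w) 1%:E))%:E; have mk1' : mnn k1'.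
    apply: mnn_fine; split=> [|w]; last by rewrite le_min lee_fin ler01 andbT mk1.2.
    by apply: measurable_mine => //; exact: mk1.1.
  have k1'E w : k1' w = mine (k1 w) 1%:E.
    rewrite /k1' fineK// ge0_fin_numE; last by rewrite le_min lee_fin ler01 andbT mk1.2.
    by rewrite gt_min ltry orbT.
  exists (fun w => k1' w.1 * k2 w.2); split.
  + apply: mnnM; first exact: (mnn_comp mk1').
    exact: (mnn_comp mk2).
  + move=> w; rewrite mule_gt0// k1'E lt_min k10 lte_fin ltr01//.
  + rewrite /mixn/=.
    have -> : (fun w1 => N (fun w2 => k1' w1 * k2 w2)) =
        (fun w1 => (fine (N k2))%:E * k1' w1).
      apply/funext => w1; rewrite fineK// muleC (fn_Z FN)//.
      by have := mk1'.2 w1; rewrite lee_fin.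
    rewrite nmZ ?fine_ge0 ?(fn_ge0 FN)//.
    apply: lte_mul_pinfty; rewrite ?lee_fin ?fine_ge0 ?(fn_ge0 FN)//.
    apply: le_lt_trans k1oo; apply: le_nm => //; apply: nearW => w.
    by rewrite k1'E ge_min lexx.
Qed.

End mixn.

Section nm_power.
Context {R : realType} (S : sfspace R).
Local Open Scope ereal_scope.

Lemma nm_poweR a (rho : R) (h : S -> \bar R) : (0 <= a)%R -> (0 < rho)%R ->
  mnn h -> nm (a * rho) (fun w => h w `^ rho) = (nm a h) `^ rho.
Proof.
move=> a0 r0 mh; move: a0; rewrite le_eqVlt => /predU1P[<-|a0]; last first.
  rewrite /nm mulf_eq0 !gt_eqF//= -poweRrM; congr (_ `^ _).
  by apply: eq_integral => x _; rewrite -poweRrM invfM mulrCA mulfV ?gt_eqF// mulr1.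
rewrite mul0r; apply/eqP; rewrite eq_le; apply/andP; split.
  apply/nm0_leP; first exact: poweR_ge0.
  apply: filterS (nm0_ub h) => w; apply: le_poweR; first exact: ltW.
  exact: mh.2.
rewrite poweR_le ?nm_ge0//; apply/nm0_leP; first exact: poweR_ge0.
apply: filterS (nm0_ub (fun w => h w `^ rho)) => w.
by rewrite poweR_le ?nm_ge0// mh.2.
Qed.

(** For a, b > 0 this is Hoelder's inequality with the conjugate exponents (a + b) / a and (a + b) /
    b, applied to f and g raised to the power 1 / (a + b). The cases a = 0 or b = 0 and the norms 0
    and +oo are separate. *)
Lemma nm_hoelder a b (f g : S -> \bar R) : (0 <= a)%R -> (0 <= b)%R ->
  mnn f -> mnn g -> nm (a + b) (fun w => f w * g w) <= nm a f * nm b g.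
Proof.
(* A factor of norm 0 vanishes almost everywhere, and so does the product; this agrees with the
   convention 0 * +oo = 0 on the right-hand side. *)
have nm_cross c d (u v : S -> \bar R) : (0 <= c)%R -> (0 <= d)%R ->
    mnn u -> mnn v -> nm c u = 0 -> nm d (fun w => u w * v w) = 0.
  move=> c0 d0 mu mv /nm_eq0 => /(_ c0 mu) u0.
  apply/(fn_eq0P (fnorm_nm S d0) (mnnM mu mv)).
  by apply: filterS u0 => w ->; rewrite mul0e.
have inf_case b' f' g' : (0 <= b')%R -> mnn f' -> mnn g' ->
    nm b' (fun w => f' w * g' w) <= nm (S := S) 0 f' * nm b' g'.
  move=> b0 mf mg; have [foo|foo] := eqVneq (nm 0 f') +oo.
    have [g0|gN0] := eqVneq (nm b' g') 0.
      rewrite (_ : (fun w => _) = (fun w => g' w * f' w)) ?(nm_cross b')//.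
        by rewrite mule_ge0// nm_ge0.
      by apply/funext => w; rewrite muleC.
    by rewrite foo gt0_mulye ?leey// lt0e gN0 nm_ge0.
  have ffin : nm 0 f' \is a fin_num by rewrite ge0_fin_numE ?nm_ge0// ltey.
  rewrite -[X in X * _]fineK// -nmZ// ?fine_ge0 ?nm_ge0//.
  apply: le_nm => //; first exact: mnnM.
    by apply: mnnM => //; apply: mnn_cst; rewrite lee_fin fine_ge0// nm_ge0.
  apply: filterS (nm0_ub f') => w fw; rewrite fineK//.
  by rewrite lee_wpmul2r// mg.2.
move=> a0 b0 mf mg.
move: (a0); rewrite le_eqVlt => /predU1P[<-|a1]; first by rewrite add0r inf_case.
move: (b0); rewrite le_eqVlt => /predU1P[<-|b1].
  rewrite addr0 muleC (_ : (fun w => _) = (fun w => g w * f w)) ?inf_case//.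
  by apply/funext => w; rewrite muleC.
have ab : (0 < a + b)%R by rewrite addr_gt0.
have [f0|fN0] := eqVneq (nm a f) 0.
  by rewrite f0 mul0e (nm_cross a)// ltW.
have [g0|gN0] := eqVneq (nm b g) 0.
  rewrite g0 mule0 (_ : (fun w => _) = (fun w => g w * f w)) ?(nm_cross b)// ?ltW//.
  by apply/funext => w; rewrite muleC.
have [foo|foo] := eqVneq (nm a f) +oo.
  by rewrite foo gt0_mulye ?leey// lt0e gN0 nm_ge0.
have [goo|goo] := eqVneq (nm b g) +oo.
  by rewrite goo gt0_muley ?leey// lt0e fN0 nm_ge0.
have aef := nm_fin a0 mf; have aeg := nm_fin b0 mg.
rewrite ltey in aef; rewrite ltey in aeg.
(* Both norms are finite here, so f and g are finite almost everywhere and [fine] changes the powers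
   only on a null set. *)
pose F w := fine (f w `^ (a + b)^-1); pose G w := fine (g w `^ (a + b)^-1).
have mF : mnn (fun w => (F w)%:E) by apply: mnn_fine; exact: mnn_poweR.
have mG : mnn (fun w => (G w)%:E) by apply: mnn_fine; exact: mnn_poweR.
have mF' : measurable_fun setT F by apply/measurable_EFinP; exact: mF.1.
have mG' : measurable_fun setT G by apply/measurable_EFinP; exact: mG.1.
have F0 w : (0 <= F w)%R by have := mF.2 w; rewrite lee_fin.
have G0 w : (0 <= G w)%R by have := mG.2 w; rewrite lee_fin.
have powE (h : S -> \bar R) c : mnn h -> (0 < c)%R -> nm c h < +oo ->
    (\int[sf_mu S]_w (`|(fine (h w `^ (a + b)^-1))%:E| `^ ((a + b) / c)))
      `^ ((a + b) / c)^-1 = (nm c h) `^ (a + b)^-1.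
  move=> mh c0 hoo; rewrite /nm gt_eqF// -poweRrM invf_div.
  congr (_ `^ _); apply: eq_int_ae.
  - split=> [|w]; last exact: poweR_ge0.
    apply: (mnn_poweR ((a + b) / c) (h := fun w =>
      `|(fine (h w `^ (a + b)^-1))%:E|) _).1; split=> [|w]; last exact: abse_ge0.
    by apply: measurableT_comp => //; apply: (mnn_fine (mnn_poweR _ mh)).1.
  - exact: mnn_poweR.
  apply: filterS (nm_fin (ltW c0) mh hoo) => w hw.
  rewrite gee0_abs ?lee_fin ?fine_ge0 ?poweR_ge0// fineK ?fin_num_poweR//.
    by rewrite -poweRrM mulrA mulVf ?gt_eqF// mul1r.
  by rewrite ge0_fin_numE// mh.2.
have p0 : (0 < (a + b) / a)%R by rewrite divr_gt0.
have q0 : (0 < (a + b) / b)%R by rewrite divr_gt0.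
have pq : (((a + b) / a)^-1 + ((a + b) / b)^-1 = 1)%R.
  by rewrite !invf_div -mulrDl divff// gt_eqF.
have := hoelder (sf_mu S) mF' mG' p0 q0 pq.
rewrite Lnorm1 unlock /= !powE ?ltey// -poweRM ?nm_ge0// => hh.
rewrite nm_leP//; last 2 first.
- exact: mnnM.
- by rewrite mule_ge0// nm_ge0.
apply: le_trans hh; rewrite le_eqVlt; apply/orP; left; apply/eqP; apply: eq_int_ae.
- by apply: mnn_poweR; exact: mnnM.
- split=> [|w]; last by rewrite lee_fin.
  by apply/measurable_EFinP; apply: measurableT_comp => //; exact: measurable_funM.
apply: filterS2 (aef foo) (aeg goo) => w fw gw.
rewrite poweRM ?mf.2 ?mg.2// ger0_norm ?mulr_ge0// EFinM /F /G !fineK//;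
  by rewrite fin_num_poweR// ge0_fin_numE ?mf.2 ?mg.2.
Qed.

Lemma nm_cst1_0 : nm (S := S) 0 (fun=> 1) <= 1.
Proof. by apply/nm0_leP => //; exact: nearW. Qed.

End nm_power.

(** For a > 0 this is Tonelli's theorem for h to the power 1 / a. For a = 0 both sides are the
    essential supremum over the product, because transposition preserves null sets. The common
    exponent [a] is what makes the interchange an equality. *)
Lemma nm_swap {R : realType} (S1 S2 : sfspace R) (a : R)
    (h : S1 * S2 -> \bar R) : (0 <= a)%R -> mnn h ->
  nm (S := S1) a (fun x => nm (S := S2) a (fun y => h (x, y))) =
  nm (S := S2) a (fun y => nm (S := S1) a (fun x => h (x, y))).
Proof.
rewrite le_eqVlt => /predU1P[<-|a0] mh; last first.
  have E (S S' : sfspace R) (g : S -> S' -> \bar R) :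
      nm (S := S) a (fun x => nm (S := S') a (g x)) =
      ((\int[sf_mu S]_x \int[sf_mu S']_y (g x y `^ a^-1)) `^ a)%E.
    rewrite [LHS]/nm gt_eqF//; congr (_ `^ _)%E; apply: eq_integral => x _.
    rewrite /nm gt_eqF// poweRK ?gt_eqF//.
    by apply: integral_ge0 => y _; exact: poweR_ge0.
  by rewrite !E (int_swap (h := fun z => h z `^ a^-1)%E)//; exact: mnn_poweR.
have half (S S' : sfspace R) (g : S * S' -> \bar R) : mnn g ->
    (nm (S := S) 0 (fun x => nm (S := S') 0 (fun y => g (x, y))) <=
     nm (S := S') 0 (fun y => nm (S := S) 0 (fun x => g (x, y))))%E.
  move=> mg; set c := (X in (_ <= X)%E); have c0 : (0 <= c)%E by exact: nm_ge0.
  have mgs : mnn (fun z : S' * S => g (z.2, z.1)) by apply: (mnn_comp mg); exact: measurable_swap.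
  have : \forall z \ae sf_mu (prod_sf S' S), (g (z.2, z.1) <= c)%E.
    apply: ae_sections_prod.
      rewrite -[X in measurable X]setTI.
      have -> : ~` [set z | (g (z.2, z.1) <= c)%E] = [set z | (c < g (z.2, z.1))%E].
        by apply/seteqP; split => z /=; rewrite ltNge => /negP.
      by apply: emeasurable_fun_o_infty => //; exact: mgs.1.
    have := nm0_ub (S := S') (fun y => nm (S := S) 0 (fun x => g (x, y))).
    apply: filterS => y gy /=.
    by apply: filterS (nm0_ub (S := S) (fun x => g (x, y))) => x /le_trans; exact.
  move=> [A [mA A0 Ac]].
  have : \forall z \ae sf_mu (prod_sf S S'), (g z <= c)%E.
    pose A' := [set z : S * S' | A (z.2, z.1)].
    have mA' : measurable A'.
      rewrite -[X in measurable X]setTI.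
      by apply: (measurable_swap (T1 := S) (T2 := S')).
    exists A'; split => //.
    - rewrite /= /prod_mu /product_measure1.
      have mA1 : mnn (fun z : S' * S => (\1_A z : R)%:E).
        split=> [|z]; last by rewrite lee_fin.
        exact/measurable_EFinP/measurable_indic.
      have : (\int[sf_mu (prod_sf S' S)]_z (\1_A z : R)%:E = 0)%E.
        by rewrite integral_indic// setIT.
      rewrite (int_prod mA1) (int_swap mA1) => <-; apply: eq_integral => x _ /=.
      transitivity (\int[sf_mu S']_y (\1_(xsection A' x) y : R)%:E)%E.
        by rewrite integral_indic ?setIT//; exact: measurable_xsection.
      apply: eq_integral => y _; rewrite !indicE; congr (_%:R%:E); congr nat_of_bool.
      by rewrite mem_xsection; apply/idP/idP; rewrite !inE.
    - by move=> z /= gz; apply: Ac => /=; rewrite -surjective_pairing.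
  move/ae_prod_sections => gc; apply/nm0_leP => //.
  by apply: filterS gc => x gx; apply/nm0_leP.
apply/eqP; rewrite eq_le half//=.
have mhs : mnn (fun z : S2 * S1 => h (z.2, z.1)).
  by apply: (mnn_comp mh); exact: measurable_swap.
exact: (half S2 S1 (fun z => h (z.2, z.1))).
Qed.

(** * Norming functions and duality of iterated norms *)

Section countable_sup.
Context {R : realType} (I : countType).
Local Open Scope ereal_scope.

(** Turns approximation from below by a countable family into a supremum over a sequence; codes of
    no index contribute the harmless value 0. *)
Lemma esupn_unpickle (u : I -> \bar R) (c : \bar R) : (forall i, 0 <= u i) ->
  (forall i, u i <= c) -> (forall b, 0 <= b < c -> exists i, b <= u i) ->
  0 <= c -> c = esupn (fun n => oapp u 0 (unpickle n)).
Proof.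
move=> u0 uc cu c0; apply/eqP; rewrite eq_le; apply/andP; split; last first.
  by apply: esupn_le => n; case: unpickle => //=.
rewrite leNgt; apply/negP => lt_c.
set s := esupn _ in lt_c.
have s0 : 0 <= s by apply: esupn_ge0 => n; case: unpickle => /=.
have [b sb bc] : exists2 b, s < b & b < c.
  have sfin : s \is a fin_num by rewrite ge0_fin_numE// (lt_le_trans lt_c)// leey.
  move: c {uc} cu c0 lt_c => [c| |]// cu c0; rewrite -(fineK sfin) ?lte_fin => sc.
    exists ((fine s + c) / 2)%:E; rewrite lte_fin; lra.
  by exists (fine s + 1)%:E; rewrite ?ltry// lte_fin; lra.
have [|i bi] := cu b; first by rewrite bc andbT (le_trans s0)// ltW.
have := esupn_ub (fun n => oapp u 0 (unpickle n)) (pickle i).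
by rewrite pickleK /= => us; have := lt_le_trans sb (le_trans bi us); rewrite ltxx.
Qed.

End countable_sup.

Section norming.
Context {R : realType}.
Local Open Scope ereal_scope.

(* The parameter space [T] makes the norming functions depend measurably on
   the outer variables of an iterated norm. *)
Definition norming (S : sfspace R) (N N' : (S -> \bar R) -> \bar R) : Prop :=
  forall d (T : measurableType d) (h : T * S -> \bar R), mnn h ->
  exists xi : nat -> T * S -> R,
    [/\ forall n, mnn (EFin \o xi n),
        forall n t, N' (fun w => (xi n (t, w))%:E) <= 1 &
        forall t, N (fun w => h (t, w)) =
          esupn (fun n => \int[sf_mu S]_w ((xi n (t, w))%:E * h (t, w)))].

Definition hoelder_pair (S : sfspace R) (N N' : (S -> \bar R) -> \bar R) : Prop :=
  forall f g, mnn f -> mnn g -> \int[sf_mu S]_w (f w * g w) <= N f * N' g.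

Lemma nm_hoelder_pair (S : sfspace R) a : (0 <= a <= 1)%R ->
  hoelder_pair (S := S) (nm a) (nm (1 - a)).
Proof.
move=> /andP[a0 a1] f g mf mg; rewrite -nm1; last exact: mnnM.
rewrite -{1}(subrKC a 1%R); apply: nm_hoelder => //; lra.
Qed.

Let norming_le (S : sfspace R) a (f : S -> \bar R) (x : S -> R) :
  (0 <= a <= 1)%R -> mnn f -> mnn (EFin \o x) ->
  nm (1 - a) (EFin \o x) <= 1 ->
  \int[sf_mu S]_w ((x w)%:E * f w) <= nm a f.
Proof.
move=> a01 mf mx x1; apply: (@le_trans _ _ (nm a f * nm (1 - a) (EFin \o x))).
  apply: le_trans (nm_hoelder_pair a01 mf mx); rewrite le_eqVlt; apply/orP; left.
  by apply/eqP; apply: eq_integral => w _; rewrite muleC.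
by rewrite -[leRHS]mule1; apply: lee_wpmul2l; first exact: nm_ge0.
Qed.

Lemma mnn_indic d (T : measurableType d) (A : set T) : measurable A ->
  mnn (fun z => (\1_A z : R)%:E).
Proof.
move=> mA; split=> [|z]; last by rewrite lee_fin.
exact/measurable_EFinP/measurable_indic.
Qed.

Lemma int_indic (S : sfspace R) (A : set S) : measurable A ->
  \int[sf_mu S]_w (\1_A w : R)%:E = sf_mu S A.
Proof. by move=> mA; rewrite integral_indic// setIT. Qed.

(** The norming functions are normalised indicators of the sections of {h > q} restricted to [F k],
    with q rational and [F k] of finite measure. Whenever q lies below the essential supremum, some
    such section is not null, and h has average at least q on it. *)
Lemma norming_nm0 (S : sfspace R) : norming (S := S) (nm 0) (nm 1).
Proof.
move=> d T h mh; have /sigma_finiteP[F [TF ndF Foo]] := sigma_finiteT (sf_mu S).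
pose A (i : rat * nat) : set (T * S) := [set z | (ratr i.1)%:E < h z /\ F i.2 z.2].
have mA i : measurable (A i).
  rewrite (_ : A i = [set z | (ratr i.1)%:E < h z] `&` (setT `&` snd @^-1` F i.2)).
    apply: measurableI.
      rewrite -[X in measurable X]setTI.
      by apply: emeasurable_fun_o_infty => //; exact: mh.1.
    exact: (@measurable_snd _ _ T S measurableT _ (Foo i.2).1).
  by rewrite setTI.
have m1A i := mnn_indic (mA i).
pose m i t := \int[sf_mu S]_w (\1_(A i) (t, w) : R)%:E.
have mm i : mnn (m i) := mnn_int (S := S) (m1A i).
have mfin i t : m i t \is a fin_num.
  rewrite ge0_fin_numE ?(mm i).2//.
  apply: (@le_lt_trans _ _ (\int[sf_mu S]_w (\1_(F i.2) w : R)%:E)); last first.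
    by rewrite (int_indic (Foo i.2).1); exact: (Foo i.2).2.
  apply: le_int; first exact: (mnn_pair2 t (m1A i)).
    by apply: mnn_indic; case: (Foo i.2).
  apply: nearW => w; rewrite lee_fin !indicE.
  case: (boolP (_ \in _)) => // /[!inE] -[_ /= Fw].
  by rewrite mem_set.
(* On a null section the normalising factor is the inverse of 0, which is 0, so the bound by 1
   persists. *)
pose x i z := if (0 <= ratr i.1 :> R)%R then
  (fine (m i z.1) `^ (-1) * \1_(A i) z)%R else 0%R.
have x0 i z : (0 <= x i z)%R.
  by rewrite /x; case: ifP => // _; rewrite mulr_ge0// powR_ge0.
have mx i : mnn (EFin \o x i).
  have [q0|/negbTE q0] := boolP (0 <= ratr i.1 :> R)%R; rewrite /x q0; last exact: mnn_cst.
  apply: (@mnnM _ _ _ (fun z => (fine (m i z.1))%:E `^ (-1))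
    (fun z => (\1_(A i) z)%:E)); last exact: m1A.
  apply: mnn_poweR.
  exact: (mnn_comp (mnn_fine (mm i)) measurable_fst).
have ix i t : nm 1 (fun w => (x i (t, w))%:E) <= 1.
  rewrite nm1; last exact: (mnn_pair2 t (mx i)).
  have [q0|/negbTE q0] := boolP (0 <= ratr i.1 :> R)%R; rewrite /x q0; last by rewrite integral0.
  under eq_integral do rewrite EFinM/=.
  rewrite ge0_integralZl_EFin ?powR_ge0//; last exact: (mnn_pair2 t (m1A i)).1.
  rewrite -/(m i t) -[X in _ * X]fineK// -EFinM lee_fin.
  rewrite powR_inv1 ?fine_ge0 ?(mm i).2//.
  by have [->|?] := eqVneq (fine (m i t)) 0%R; rewrite ?mulr0// mulVf.
have ub i t : \int[sf_mu S]_w ((x i (t, w))%:E * h (t, w)) <= nm 0 (fun w => h (t, w)).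
  apply: (@norming_le S 0%R (fun w => h (t, w)) (fun w => x i (t, w))).
  - by rewrite lexx ler01.
  - exact: (mnn_pair2 t mh).
  - exact: (mnn_pair2 t (mx i)).
  - by rewrite subr0; exact: ix.
exists (fun n z => oapp (fun i => x i z) 0%R (unpickle n)); split.
- by move=> n; case: unpickle => [i|] /=; [exact: mx|exact: mnn_cst].
- move=> n t; case: unpickle => [i|] /=; first exact: ix.
  by rewrite (fn_0 (fnorm_nm S ler01)).
move=> t.
transitivity (esupn (fun n => oapp (fun i =>
    \int[sf_mu S]_w ((x i (t, w))%:E * h (t, w))) 0 (unpickle n : option (rat * nat)%type)));
  last first.
  apply: eq_esupn => n; case: unpickle => [i|] //=.
  by rewrite integral0_eq// => w _; rewrite mul0e.
apply: esupn_unpickle => [i|i|b /andP[b0 bh]|]; [|exact: ub| |exact: nm_ge0].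
  by apply: integral_ge0 => w _; rewrite mule_ge0 ?lee_fin// mh.2.
have [q [bq qh]] : exists q : rat, b <= (ratr q)%:E /\ (ratr q)%:E < nm 0 (fun w => h (t, w)).
  case: b b0 bh => [b| |]//; last first.
    by move=> _; rewrite ltNge leey.
  move=> b0; case: (nm 0 _) => [M| |]// bM.
    have [q] := rat_in_itvoo bM; rewrite in_itv/= => /andP[bq qM].
    by exists q; split; rewrite ?lee_fin ?lte_fin// ltW.
  have [q] := @rat_in_itvoo _ b (b + 1) (ltr_pwDr ltr01 (lexx b)).
  by rewrite in_itv/= => /andP[bq _]; exists q; split; rewrite ?ltry// lee_fin ltW.
have [k mk] : exists k, m (q, k) t != 0.
  apply/not_existsP => m0; move: qh; apply/negP; rewrite -leNgt.
  apply/nm0_leP; first exact: le_trans bq.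
  have /ae_foralln : forall k, \forall w \ae sf_mu S, (\1_(A (q, k)) (t, w) : R)%:E = 0.
    move=> k; apply: int_eq0; first exact: (mnn_pair2 t (m1A _)).
    by have /negP/negPn/eqP := m0 k.
  apply: filterS => w hw; rewrite leNgt; apply/negP => qh.
  have [k _ Fkw] : (\bigcup_i F i) w by rewrite -TF.
  have := hw k; rewrite indicE mem_set//= => -[/eqP]; by rewrite oner_eq0.
exists (q, k); apply: (le_trans bq).
have q0 : (0 <= ratr q :> R)%R by move: (le_trans b0 bq); rewrite lee_fin.
apply: (@le_trans _ _ (\int[sf_mu S]_w ((ratr q)%:E * (x (q, k) (t, w))%:E))).
  rewrite ge0_integralZl_EFin//; last 2 first.
  - by move=> w _; rewrite lee_fin.
  - exact: (mnn_pair2 t (mx (q, k))).1.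
  rewrite /x/= q0; under eq_integral do rewrite EFinM/=.
  rewrite ge0_integralZl_EFin ?powR_ge0//; last exact: (mnn_pair2 t (m1A _)).1.
  rewrite -/(m (q, k) t) -[X in _ * (_ * X)]fineK// -!EFinM lee_fin.
  rewrite powR_inv1 ?fine_ge0 ?(mm _).2// mulVf ?mulr1//.
  by rewrite -eqe fineK.
apply: le_int.
- by apply: mnnM; [exact: mnn_cst|exact: (mnn_pair2 t (mx _))].
- by apply: mnnM; [exact: (mnn_pair2 t (mx _))|exact: (mnn_pair2 t mh)].
apply: nearW => w; rewrite muleC; rewrite /x/= q0 indicE.
case: (boolP (_ \in _)) => [|_]; last by rewrite mulr0 !mul0e.
rewrite inE => -[/= qh' _]; apply: lee_wpmul2l; last exact: ltW.
by rewrite lee_fin mulr1 powR_ge0.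
Qed.

(** For a > 0 the truncations [g n] of h are bounded with support of finite measure, so the
    extremiser [x n] of Hoelder's inequality for [g n] exists and its integral against [g n] is the
    norm of [g n]. These norms increase to that of h by monotone convergence. *)
Lemma norming_nm (S : sfspace R) a : (0 <= a <= 1)%R ->
  norming (S := S) (nm a) (nm (1 - a)).
Proof.
move=> /[dup] a01 /andP[a0 a1].
move: (a0); rewrite le_eqVlt => /predU1P[<-|a_gt0].
  by rewrite subr0; exact: norming_nm0.
move=> d T h mh; have /sigma_finiteP[F [TF ndF Foo]] := sigma_finiteT (sf_mu S).
pose g n z := (fine (mine (h z) n%:R%:E) * \1_(F n) z.2)%R.
have mnfin n z : mine (h z) n%:R%:E \is a fin_num.
  by rewrite ge0_fin_numE ?le_min ?mh.2 ?lee_fin//= gt_min ltry orbT.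
have mg n : mnn (EFin \o g n).
  rewrite (_ : EFin \o g n = fun z =>
      (fine (mine (h z) n%:R%:E))%:E * (\1_(F n) z.2)%:E)//.
  apply: mnnM; first apply: mnn_fine.
    split=> [|z]; last by rewrite le_min mh.2 lee_fin/=.
    by apply: measurable_mine => //; exact: mh.1.
  have [mF _] := Foo n.
  exact: (mnn_comp (mnn_indic mF) measurable_snd).
have g0 n z : (0 <= g n z)%R by have := (mg n).2 z; rewrite /= lee_fin.
have gS n z : (EFin \o g n) z <= (EFin \o g n.+1) z.
  rewrite /= lee_fin ler_pM ?fine_ge0//.
  - by rewrite le_min mh.2 lee_fin/=.
  - rewrite fine_le//; rewrite le_min ge_min lexx/= ge_min orbC.
    by rewrite lee_fin ler_nat leqnSn.
  - rewrite !indicE; case: (boolP (_ \in F n)) => // /[!inE] Fz.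
    by rewrite mem_set//; move: z.2 Fz; apply/subsetPset/ndF.
have gh n z : (EFin \o g n) z <= h z.
  rewrite /= /g; apply: (@le_trans _ _ (fine (mine (h z) n%:R%:E))%:E).
    rewrite lee_fin; apply: ler_piMr.
      by rewrite fine_ge0// le_min mh.2 lee_fin/=.
    by rewrite indicE; case: (_ \in _).
  by rewrite fineK// ge_min lexx.
have gsup z : h z = esupn (fun n => (EFin \o g n) z).
  apply/eqP; rewrite eq_le; apply/andP; split; last by apply: esupn_le => n.
  have [k _ Fkz] : (\bigcup_i F i) z.2 by rewrite -TF.
  have main n : (k <= n)%N -> mine (h z) n%:R%:E <= esupn (fun n => (EFin \o g n) z).
    move=> kn; apply: le_trans (esupn_ub _ n).
    rewrite /= /g indicE mem_set ?mulr1 ?fineK//.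
    by move: z.2 Fkz; apply/subsetPset/ndF.
  have [hoo|hoo] := eqVneq (h z) +oo; last first.
    have hfin : h z \is a fin_num by rewrite ge0_fin_numE ?mh.2// ltey.
    pose n := maxn k (Num.truncn (fine (h z))).+1.
    apply: le_trans (main n (leq_maxl _ _)).
    rewrite le_min lexx/= -(fineK hfin) lee_fin; apply: ltW.
    apply: lt_le_trans (truncnS_gt _) _.
    by rewrite ler_nat leq_maxr.
  rewrite hoo; have := main; set s := esupn _; case: s => [s| |]// sn.
    pose n := maxn k (Num.truncn s).+1.
    have := sn n (leq_maxl _ _); rewrite hoo minye lee_fin leNgt => /negP; case.
    by apply: lt_le_trans (truncnS_gt _) _; rewrite ler_nat leq_maxr.
  by have := sn k (leqnn k); rewrite hoo minye.
pose c n t := \int[sf_mu S]_w ((EFin \o g n) (t, w) `^ a^-1).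
have mc n : mnn (c n) by apply: (mnn_int (S := S) (mnn_poweR a^-1 (mg n))).
have cfin n t : c n t \is a fin_num.
  rewrite ge0_fin_numE ?(mc n).2//.
  have [mF Fn] := Foo n.
  apply: (@le_lt_trans _ _ (\int[sf_mu S]_w ((n%:R `^ a^-1)%:E * (\1_(F n) w)%:E))).
    apply: le_int; first exact: (mnn_poweR a^-1 (mnn_pair2 t (mg n))).
      by apply: mnnM; [apply: mnn_cst; rewrite lee_fin powR_ge0|exact: mnn_indic].
    apply: nearW => w; rewrite /= lee_fin /g indicE.
    case: (_ \in _); last by rewrite !mulr0 powR0// invr_eq0 gt_eqF.
    rewrite !mulr1; apply: ge0_ler_powR; rewrite ?invr_ge0 ?nnegrE ?fine_ge0//.
      by rewrite le_min mh.2 lee_fin/=.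
    by rewrite -lee_fin fineK// ge_min lexx orbT.
  rewrite ge0_integralZl_EFin ?powR_ge0//; last exact: (mnn_indic mF).1.
  by rewrite int_indic// lte_mul_pinfty// lee_fin powR_ge0.
(* For a < 1 the first factor has norm c^(1 - a) for the exponent 1 - a, which the second factor
   cancels; for a = 1 both factors are 1. *)
pose x n z := (g n z `^ (a^-1 - 1) * fine (c n z.1) `^ (a - 1))%R.
have x0 n z : (0 <= x n z)%R by rewrite mulr_ge0// powR_ge0.
have mx n : mnn (EFin \o x n).
  apply: (@mnnM _ _ _ (fun z => (g n z)%:E `^ (a^-1 - 1))
    (fun z => (fine (c n z.1))%:E `^ (a - 1))); apply: mnn_poweR; first exact: mg.
  exact: (mnn_comp (mnn_fine (mc n)) measurable_fst).
have xg n t w : ((x n (t, w))%:E * (g n (t, w))%:E =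
    (fine (c n t) `^ (a - 1))%:E * ((g n (t, w))%:E `^ a^-1)).
  rewrite -!EFinM /x/= mulrAC mulrC; congr (_ * _)%:E.
  by rewrite mulrC mulr_powRB1// invr_gt0.
have ixg n t : \int[sf_mu S]_w ((x n (t, w))%:E * (g n (t, w))%:E) =
    (nm a (fun w => (g n (t, w))%:E)).
  under eq_integral do rewrite xg.
  rewrite ge0_integralZl_EFin ?powR_ge0//; last 2 first.
  - by move=> w _; exact: poweR_ge0.
  - exact: (mnn_poweR a^-1 (mnn_pair2 t (mg n))).1.
  rewrite -/(c n t) /nm gt_eqF//.
  rewrite -[in RHS](_ : c n t = \int[sf_mu S]_w ((g n (t, w))%:E `^ a^-1))//.
  have c0 : (0 <= fine (c n t))%R by rewrite fine_ge0// (mc n).2.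
  rewrite -[c n t](fineK (cfin n t))/= -EFinM; congr EFin.
  by rewrite mulrC mulr_powRB1.
have ix n t : nm (1 - a) (fun w => (x n (t, w))%:E) <= 1.
  move: a1; rewrite le_eqVlt => /predU1P[a1|a1].
    rewrite a1 subrr; apply/nm0_leP => //; apply: nearW => w.
    by rewrite /x a1 invr1 subrr !powRr0 mulr1.
  have a1' : (0 < 1 - a)%R by lra.
  rewrite nm_leP//; last exact: (mnn_pair2 t (mx n)).
  rewrite poweR1r.
  have aN0 := lt0r_neq0 a_gt0; have a1N0 := lt0r_neq0 a1'.
  have e1 : ((a^-1 - 1) * (1 - a)^-1 = a^-1)%R by field; rewrite aN0 a1N0.
  have e2 : ((a - 1) * (1 - a)^-1 = -1)%R by field.
  have -> : \int[sf_mu S]_w ((x n (t, w))%:E `^ (1 - a)^-1) =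
      \int[sf_mu S]_w ((fine (c n t) `^ (-1))%:E * ((g n (t, w))%:E `^ a^-1)).
    apply: eq_integral => w _; rewrite !poweR_EFin -EFinM /x/=; congr EFin.
    by rewrite powRM ?powR_ge0// -!powRrM e1 e2 mulrC.
  rewrite ge0_integralZl_EFin ?powR_ge0//; last 2 first.
  - by move=> w _; exact: poweR_ge0.
  - exact: (mnn_poweR a^-1 (mnn_pair2 t (mg n))).1.
  rewrite -/(c n t) -[X in _ * X](fineK (cfin n t)) -EFinM lee_fin.
  rewrite powR_inv1 ?fine_ge0 ?(mc n).2//.
  by have [->|?] := eqVneq (fine (c n t)) 0%R; rewrite ?mulr0// mulVf.
exists x; split => // t.
apply/eqP; rewrite eq_le; apply/andP; split; last first.
  apply: esupn_le => n; apply: (norming_le (f := fun w => h (t, w)) (x := fun w => x n (t, w))) => //.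
  - exact: (mnn_pair2 t mh).
  - exact: (mnn_pair2 t (mx n)).
  - exact: ix.
under [X in nm a X]eq_fun do rewrite gsup.
rewrite nm_esupn//; last by move=> n; exact: (mnn_pair2 t (mg n)).
apply: esupn_le => n; apply: le_trans (esupn_ub _ n).
rewrite -ixg; apply: le_int.
- by apply: mnnM; [exact: (mnn_pair2 t (mx n))|exact: (mnn_pair2 t (mg n))].
- by apply: mnnM; [exact: (mnn_pair2 t (mx n))|exact: (mnn_pair2 t mh)].
by apply: nearW => w; rewrite lee_wpmul2l ?lee_fin//; exact: gh.
Qed.

Lemma hoelder_pair_mix (S1 S2 : sfspace R) a N N' : (0 <= a <= 1)%R ->
  fnorm N -> fnorm N' -> hoelder_pair N N' ->
  hoelder_pair (mixn (S1 := S1) (S2 := S2) a N) (mixn (1 - a) N').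
Proof.
move=> a01 FN FN' hN f g mf mg; rewrite (int_prod (mnnM mf mg)).
have mf' := fn_meas FN mf; have mg' := fn_meas FN' mg.
apply: le_trans (nm_hoelder_pair a01 mf' mg'); apply: le_int.
- exact: (mnn_int (mnnM mf mg)).
- exact: mnnM.
apply: nearW => w; apply: hN; first exact: (mnn_pair2 w mf).
exact: (mnn_pair2 w mg).
Qed.

(** In a nested norm the integrals against the inner norming functions are passed to the outer norm,
    where monotone convergence needs an increasing sequence. Hence [z] keeps, for each t separately,
    the best of the first functions. For fixed t it is one of them, so its dual norm stays at most
    1. *)
Lemma norming_mono (S : sfspace R) (N N' : (S -> \bar R) -> \bar R) :
  norming N N' -> forall d (T : measurableType d) (h : T * S -> \bar R), mnn h ->
  exists xi : nat -> T * S -> R,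
    [/\ forall n, mnn (EFin \o xi n),
        forall n t, N' (fun w => (xi n (t, w))%:E) <= 1,
        forall n t, \int[sf_mu S]_w ((xi n (t, w))%:E * h (t, w)) <=
                    \int[sf_mu S]_w ((xi n.+1 (t, w))%:E * h (t, w)) &
        forall t, N (fun w => h (t, w)) =
          esupn (fun n => \int[sf_mu S]_w ((xi n (t, w))%:E * h (t, w)))].
Proof.
move=> NN d T h mh; have [xi [mxi xi1 xiN]] := NN _ _ _ mh.
pose I (x : T * S -> R) t := \int[sf_mu S]_w ((x (t, w))%:E * h (t, w)).
pose z := fix z n : T * S -> R := if n is k.+1 then
  fun u => if I (z k) u.1 < I (xi n) u.1 then xi n u else z k u else xi 0%N.
have zE k t w : z k.+1 (t, w) = if I (z k) t < I (xi k.+1) t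
  then xi k.+1 (t, w) else z k (t, w) by [].
have IzE k t : I (z k.+1) t = maxe (I (z k) t) (I (xi k.+1) t).
  rewrite /I; under eq_integral do rewrite zE.
  by rewrite maxElt; case: ifP.
have mz n : mnn (EFin \o z n).
  elim: n => [|n ihn]; first exact: mxi.
  have mI (x : T * S -> R) : mnn (EFin \o x) -> mnn (fun u : T * S => I x u.1).
    by move=> mx; exact: (mnn_comp (mnn_int (S := S) (mnnM mx mh)) measurable_fst).
  split=> [|u]; last by rewrite /=; case: ifP => _; [exact: (mxi _).2|exact: ihn.2].
  apply/measurable_EFinP; apply: measurable_fun_ifT.
  - apply: measurable_fun_lte; first exact: (mI _ ihn).1.
    exact: (mI _ (mxi _)).1.
  - by apply/measurable_EFinP; exact: (mxi _).1.
  - by apply/measurable_EFinP; exact: ihn.1.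
have Imax n t : I (xi n) t <= I (z n) t.
  by case: n => [|n]; rewrite ?IzE ?le_max ?lexx ?orbT.
exists z; split => //.
- elim=> [|n ihn] t; first exact: xi1.
  by under [X in N' X]eq_fun do rewrite zE; case: ltP => _.
- by move=> n t; rewrite -/(I (z n) t) -/(I (z n.+1) t) IzE le_max lexx.
move=> t; rewrite xiN; apply/eqP; rewrite eq_le; apply/andP; split.
  by apply: esupn_le => n; apply: le_trans (Imax n t) (esupn_ub (fun n => I (z n) t) n).
apply: esupn_le => n; rewrite -/(I (z n) t).
suff [k ->] : exists k, I (z n) t = I (xi k) t by exact: (esupn_ub (fun n => I (xi n) t) k).
elim: n => [|n [k ihk]]; first by exists 0%N.
by rewrite IzE maxElt; case: ifP => _; [exists n.+1|exists k].
Qed.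

(** Products of inner and outer norming functions: the integrals [P n] of h against the inner
    functions increase to the inner norm, and each [P n] has its own outer norming sequence. The
    resulting double family is countable. *)
Lemma norming_mix (S1 S2 : sfspace R) a (N N' : (S2 -> \bar R) -> \bar R) :
  (0 <= a <= 1)%R -> fnorm N -> fnorm N' -> hoelder_pair N N' -> norming N N' ->
  norming (mixn (S1 := S1) a N) (mixn (1 - a) N').
Proof.
move=> a01 FN FN' hN NN d T h mh; have /andP[a0 a1] := a01.
have a1' : (0 <= 1 - a)%R by lra.
have mh' : mnn (fun z : T * S1 * S2 => h (z.1.1, (z.1.2, z.2))).
  by apply: (mnn_comp mh); exact: measurable_assoc.
have [z [mz z1 zS zN]] := norming_mono NN mh'.
pose P n u := \int[sf_mu S2]_w ((z n (u, w))%:E * h (u.1, (u.2, w))).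
have mP n : mnn (P n) := mnn_int (S := S2) (mnnM (mz n) mh').
have xex n := norming_nm (S := S1) a01 (mP n); have [x xP] := choice xex.
pose y (i : nat * nat) (u : T * (S1 * S2)) :=
  (x i.1 i.2 (u.1, u.2.1) * z i.1 (u.1, u.2.1, u.2.2))%R.
have my i : mnn (EFin \o y i).
  have [mx _ _] := xP i.1.
  apply: (@mnnM _ _ _ (fun u : T * (S1 * S2) => (x i.1 i.2 (u.1, u.2.1))%:E)
    (fun u => (z i.1 (u.1, u.2.1, u.2.2))%:E)).
    apply: (mnn_comp (mx i.2)); apply/measurable_fun_pair => //.
    exact: measurableT_comp.
  apply: (mnn_comp (mz i.1)); apply/measurable_fun_pair.
    by apply/measurable_fun_pair => //; exact: measurableT_comp.
  exact: measurableT_comp.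
have iy i t : \int[sf_mu (prod_sf S1 S2)]_w ((y i (t, w))%:E * h (t, w)) =
    \int[sf_mu S1]_w1 ((x i.1 i.2 (t, w1))%:E * P i.1 (t, w1)).
  rewrite (int_prod (mnnM (mnn_pair2 t (my i)) (mnn_pair2 t mh))).
  apply: eq_integral => w1 _; rewrite /y/=.
  under eq_integral do rewrite EFinM -muleA.
  have [mx _ _] := xP i.1.
  rewrite ge0_integralZl_EFin//.
  - by move=> w _; rewrite mule_ge0 ?mh.2//; exact: (mz i.1).2.
  - exact: (mnn_pair2 (t, w1) (mnnM (mz i.1) mh')).1.
  - by have := (mx i.2).2 (t, w1); rewrite /= lee_fin.
have y1 i t : mixn (S1 := S1) (1 - a) N' (fun w => (y i (t, w))%:E) <= 1.
  have [mx x1 _] := xP i.1; apply: le_trans (x1 i.2 t).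
  apply: le_nm => //; first exact: (fn_meas FN' (mnn_pair2 t (my i))).
    exact: (mnn_pair2 t (mx i.2)).
  apply: nearW => w1; rewrite /y/=.
  under [X in N' X]eq_fun do rewrite EFinM.
  have x0 : (0 <= x i.1 i.2 (t, w1))%R.
    by have := (mx i.2).2 (t, w1); rewrite /= lee_fin.
  rewrite (fn_Z FN')//; last exact: (mnn_pair2 (t, w1) (mz i.1)).
  by rewrite -[leRHS]mule1; apply: lee_wpmul2l; [rewrite lee_fin|exact: z1].
exists (fun n u => oapp (fun i => y i u) 0%R (unpickle n)); split.
- by move=> n; case: unpickle => [i|] /=; [exact: my|exact: mnn_cst].
- move=> n t; case: unpickle => [i|] /=; first exact: y1.
  by rewrite (fn_0 (fnorm_mix S1 a1' FN')).
move=> t.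
transitivity (esupn (fun n => oapp (fun i =>
    \int[sf_mu (prod_sf S1 S2)]_w ((y i (t, w))%:E * h (t, w))) 0
    (unpickle n : option (nat * nat)%type))); last first.
  apply: eq_esupn => n; case: unpickle => [i|] //=.
  by rewrite integral0_eq// => w _; rewrite mul0e.
have NE : mixn (S1 := S1) a N (fun w => h (t, w)) =
    esupn (fun n => nm (S := S1) a (fun w1 => P n (t, w1))).
  rewrite -nm_esupn//; last 2 first.
  - by move=> n; exact: (mnn_pair2 t (mP n)).
  - by move=> n w1; exact: (zS n (t, w1)).
  by congr nm; apply/funext => w1; exact: (zN (t, w1)).
apply: esupn_unpickle => [i|i|b /andP[b0 bh]|]; last exact: nm_ge0.
- by apply: integral_ge0 => w _; rewrite mule_ge0 ?mh.2//; exact: (my i).2.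
- have hp := hoelder_pair_mix (S1 := S1) a01 FN FN' hN.
  have := hp _ _ (mnn_pair2 t mh) (mnn_pair2 t (my i)).
  rewrite [X in X <= _](_ : _ =
      \int[sf_mu (prod_sf S1 S2)]_w ((y i (t, w))%:E * h (t, w))); last first.
    by apply: eq_integral => w _; rewrite muleC.
  move=> /le_trans; apply; rewrite -[leRHS]mule1; apply: lee_wpmul2l; last exact: y1.
  exact: nm_ge0.
move: bh; rewrite NE => /ereal_sup_gt[_ [n _ <-]].
have [_ _ ->] := xP n; move=> /ereal_sup_gt[_ [k _ <-]] bk.
by exists (n, k); rewrite iy/= ltW.
Qed.

End norming.

(** * Minkowski's inequalities by duality *)

Section minkowski.
Context {R : realType} (S : sfspace R) (N N' : (S -> \bar R) -> \bar R).
Hypotheses (FN : fnorm N) (hN : hoelder_pair N N') (nN : norming N N').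
Local Open Scope ereal_scope.

Lemma norming_at (h : S -> \bar R) : mnn h -> exists xi : nat -> S -> R,
  [/\ forall n, mnn (EFin \o xi n), forall n, N' (EFin \o xi n) <= 1 &
      N h = esupn (fun n => \int[sf_mu S]_w ((xi n w)%:E * h w))].
Proof.
move=> mh.
have [xi [mxi xi1 xiN]] := nN (mnn_comp mh (@measurable_snd _ _ nat S)).
exists (fun n w => xi n (0%N, w)); split => //.
- by move=> n; exact: (mnn_pair2 0%N (mxi n)).
- by move=> n; exact: xi1.
- exact: (xiN 0%N).
Qed.

Lemma norming_ub (h : S -> \bar R) (x : S -> R) : mnn h -> mnn (EFin \o x) ->
  N' (EFin \o x) <= 1 -> \int[sf_mu S]_w ((x w)%:E * h w) <= N h.
Proof.
move=> mh mx x1; apply: (@le_trans _ _ (N h * N' (EFin \o x))).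
  apply: le_trans (hN mh mx); rewrite le_eqVlt; apply/orP; left; apply/eqP.
  by apply: eq_integral => w _; rewrite muleC.
by rewrite -[leRHS]mule1; apply: lee_wpmul2l; first exact: (fn_ge0 FN).
Qed.

Lemma minkowskiD (f g : S -> \bar R) : mnn f -> mnn g ->
  N (fun w => f w + g w) <= N f + N g.
Proof.
move=> mf mg; have [xi [mxi xi1 ->]] := norming_at (mnnD mf mg).
apply: esupn_le => n; have mx := mxi n.
under eq_integral => w _ do rewrite ge0_muleDr ?mf.2 ?mg.2//.
rewrite ge0_integralD//.
- by apply: leeD; apply: norming_ub.
- by move=> w _; exact: (mnnM mx mf).2.
- exact: (mnnM mx mf).1.
- by move=> w _; exact: (mnnM mx mg).2.
- exact: (mnnM mx mg).1.
Qed.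

Lemma minkowski_sum (I : Type) (s : seq I) (f : I -> S -> \bar R) :
  (forall i, mnn (f i)) ->
  N (fun w => \sum_(i <- s) f i w) <= \sum_(i <- s) N (f i).
Proof.
move=> mf; elim: s => [|i s ihs].
  by under [X in N X]eq_fun do rewrite big_nil; rewrite big_nil (fn_0 FN).
have ms : mnn (fun w => \sum_(j <- s) f j w).
  split=> [|w]; last by apply: sume_ge0 => j _; exact: (mf j).2.
  by apply: emeasurable_sum => j; exact: (mf j).1.
under [X in N X]eq_fun do rewrite big_cons; rewrite big_cons.
by apply: le_trans (minkowskiD (mf i) ms) _; exact: leeD.
Qed.

(** After pairing with a norming function, Tonelli's theorem moves the pairing inside the integral
    over [S0], where Hoelder's inequality bounds it by the norm of each section. *)
Lemma minkowski_int (S0 : sfspace R) (h : S0 * S -> \bar R) : mnn h ->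
  N (fun w => \int[sf_mu S0]_x h (x, w)) <=
  \int[sf_mu S0]_x N (fun w => h (x, w)).
Proof.
move=> mh; have mh' : mnn (fun z : S * S0 => h (z.2, z.1)).
  by apply: (mnn_comp mh); exact: measurable_swap.
have [xi [mxi xi1 ->]] := norming_at (mnn_int (S := S0) mh').
apply: esupn_le => n; have mx := mxi n.
have mxh : mnn (fun z : S * S0 => (xi n z.1)%:E * h (z.2, z.1)).
  by apply: mnnM mh'; exact: (mnn_comp mx measurable_fst).
have -> : \int[sf_mu S]_w ((xi n w)%:E * \int[sf_mu S0]_x h (x, w)) =
    \int[sf_mu S0]_x \int[sf_mu S]_w ((xi n w)%:E * h (x, w)).
  rewrite -(int_swap mxh); apply: eq_integral => w _ /=.
  rewrite ge0_integralZl_EFin//.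
  - by move=> x _; exact: mh.2.
  - exact: (mnn_pair2 w mh').1.
  - by have := mx.2 w; rewrite /= lee_fin.
apply: le_int.
- apply: (mnn_int (S := S) (h := fun z : S0 * S => (xi n z.2)%:E * h z)).
  by apply: mnnM mh; exact: (mnn_comp mx measurable_snd).
- exact: (fn_meas FN mh).
apply: nearW => x; apply: norming_ub => //; exact: (mnn_pair2 x mh).
Qed.

End minkowski.

(** * Dominated convergence in nested norms *)

Section dominated.
Context {R : realType}.
Local Open Scope ereal_scope.

Lemma cvge0P (u : nat -> \bar R) : (forall n, 0 <= u n) ->
  (u @ \oo --> 0) <-> forall e : R, (0 < e)%R -> \forall n \near \oo, u n <= e%:E.
Proof.
move=> u0; split=> [/fine_cvgP[uf /cvgr0Pnorm_le u00] e e0|ue].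
  near=> n; rewrite -[u n]fineK; last by near: n.
  rewrite lee_fin; apply: le_trans (ler_norm _) _; near: n; exact: u00.
apply/fine_cvgP; split.
  apply: filterS (ue 1%R ltr01) => n un.
  by rewrite ge0_fin_numE// (le_lt_trans un)// ltry.
apply/cvgr0Pnorm_le => e e0; apply: filterS (ue e e0) => n un /=.
rewrite ger0_norm ?fine_ge0// -lee_fin fineK//.
by rewrite ge0_fin_numE// (le_lt_trans un)// ltry.
Unshelve. all: by end_near. Qed.

(** The source of order continuity. The pointwise limit is only required almost everywhere, whereas
    the domination holds everywhere and thus passes to all sections. *)
Definition dominated_cvg0 (S : sfspace R) (N : (S -> \bar R) -> \bar R) : Prop :=
  forall (h : nat -> S -> \bar R) (H : S -> \bar R), (forall n, mnn (h n)) ->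
    mnn H -> (forall n w, h n w <= H w) -> N H < +oo ->
    (\forall w \ae sf_mu S, h n w @[n --> \oo] --> 0) ->
    N (h n) @[n --> \oo] --> 0.

Lemma cvge0_poweR (u : nat -> \bar R) r : (0 < r)%R -> (forall n, 0 <= u n) ->
  u @ \oo --> 0 -> (u n) `^ r @[n --> \oo] --> 0.
Proof.
move=> r0 u0 /(cvge0P u0) uc; apply/cvge0P => [n|e e0]; first exact: poweR_ge0.
have := uc (e `^ r^-1)%R; rewrite powR_gt0// => /(_ isT).
apply: filterS => n un; rewrite poweR_le// ?lee_fin ?ltW//.
Qed.

Lemma dominated_nm (S : sfspace R) a : (0 < a)%R ->
  dominated_cvg0 (S := S) (nm a).
Proof.
move=> a0 h H mh mH hH Hoo h0; rewrite /nm gt_eqF//.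
have ai : (0 < a^-1)%R by rewrite invr_gt0.
apply: cvge0_poweR => // [n|]; first by apply: integral_ge0 => w _; exact: poweR_ge0.
have iH : (sf_mu S).-integrable setT (fun w => H w `^ a^-1).
  apply/integrableP; split; first exact: (mnn_poweR _ mH).1.
  under eq_integral do rewrite gee0_abs ?poweR_ge0//.
  by move: Hoo; rewrite /nm gt_eqF// => /lty_poweRy; apply; rewrite gt_eqF.
have := @dominated_convergence _ _ _ (sf_mu S) setT measurableT
  (fun n w => h n w `^ a^-1) (cst 0) (fun w => H w `^ a^-1)
  (fun n => (mnn_poweR a^-1 (mh n)).1) (measurable_cst _).
rewrite integral0; case => //.
- apply: filterS h0 => w hw _; apply: (cvge0_poweR ai _ hw) => n; exact: (mh n).2.
- apply: nearW => w n _; rewrite gee0_abs ?poweR_ge0//.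
  by apply: le_poweR; [exact: ltW|exact: (mh n).2|exact: hH].
Qed.

Lemma dominated_mix (S1 S2 : sfspace R) a (N : (S2 -> \bar R) -> \bar R) :
  (0 < a)%R -> fnorm N -> dominated_cvg0 N ->
  dominated_cvg0 (mixn (S1 := S1) a N).
Proof.
move=> a0 FN dN h H mh mH hH Hoo h0; have mH' := fn_meas FN mH.
apply: (dominated_nm (S := S1) a0 _ mH') => //.
- by move=> n; exact: (fn_meas FN (mh n)).
- move=> n w1; apply: (fn_le FN).
  + exact: (mnn_pair2 w1 (mh n)).
  + exact: (mnn_pair2 w1 mH).
  + by apply: nearW => w2; exact: hH.
have := nm_fin (ltW a0) mH' Hoo; apply: filterS2 (ae_prod_sections h0).
move=> w1 h0' Hoo'; apply: (dN _ (fun w2 => H (w1, w2))) => //.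
- by move=> n; exact: (mnn_pair2 w1 (mh n)).
- exact: (mnn_pair2 w1 mH).
Qed.

End dominated.

Fixpoint iN {R : realType} (K : nat) :
    forall (Om : 'I_K.+1 -> sfspace R), ('I_K.+1 -> R) ->
      (iter_sf Om -> \bar R) -> \bar R :=
  match K with
  | 0 => fun Om a => nm (S := Om ord0) (a ord0)
  | K'.+1 => fun Om a => mixn (S1 := Om ord0) (a ord0)
      (iN (Om := fun k => Om (lift ord0 k)) (fun k => a (lift ord0 k)))
  end.

Section iN.
Context {R : realType}.
Local Open Scope ereal_scope.

Lemma fnorm_iN K (Om : 'I_K.+1 -> sfspace R) a : (forall k, 0 <= a k)%R ->
  fnorm (iN (Om := Om) a).
Proof.
elim: K Om a => [|K ihK] Om a a0 /=; first exact: fnorm_nm.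
by apply: fnorm_mix => //; exact: ihK.
Qed.

Let fnorm_tl K (Om : 'I_K.+2 -> sfspace R) a : (forall k, 0 <= a k)%R ->
  fnorm (iN (Om := fun k => Om (lift ord0 k)) (fun k => a (lift ord0 k))).
Proof. by move=> a0; apply: fnorm_iN => k. Qed.

Let mnn_tl K (Om : 'I_K.+2 -> sfspace R) a (h : iter_sf Om -> \bar R) :
  (forall k, 0 <= a k)%R -> mnn h ->
  mnn (fun w1 : Om ord0 => iN (Om := fun k => Om (lift ord0 k))
    (fun k => a (lift ord0 k)) (fun w2 => h (w1, w2))).
Proof.
move=> a0 mh.
exact: (fn_meas (@fnorm_tl _ _ _ a0) mh).
Qed.

(** Multiplying all exponents by rho moves a quasi-norm into the range of exponents at most 1, where
    [iN_dual] supplies a triangle inequality. *)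
Lemma iN_poweR K (Om : 'I_K.+1 -> sfspace R) a rho h : (forall k, 0 <= a k)%R ->
  (0 < rho)%R -> mnn h ->
  iN (Om := Om) (fun k => a k * rho)%R (fun w => h w `^ rho) =
  (iN (Om := Om) a h) `^ rho.
Proof.
elim: K Om a h => [|K ihK] Om a h a0 r0 mh /=; first exact: nm_poweR.
rewrite /mixn -nm_poweR//; last first.
  exact: mnn_tl.
congr nm; apply/funext => w1; apply: ihK => //.
exact: (mnn_pair2 (T := Om ord0) w1 mh).
Qed.

Lemma iN_hoelder K (Om : 'I_K.+1 -> sfspace R) a b f g :
  (forall k, 0 <= a k)%R -> (forall k, 0 <= b k)%R -> mnn f -> mnn g ->
  iN (Om := Om) (fun k => a k + b k)%R (fun w => f w * g w) <=
  iN (Om := Om) a f * iN (Om := Om) b g.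
Proof.
elim: K Om a b f g => [|K ihK] Om a b f g a0 b0 mf mg /=; first exact: nm_hoelder.
have mf' := @mnn_tl _ _ _ _ a0 mf; have mg' := @mnn_tl _ _ _ _ b0 mg.
apply: le_trans (nm_hoelder (a0 ord0) (b0 ord0) mf' mg'); apply: le_nm.
- by rewrite addr_ge0.
- apply: (@mnn_tl _ _ (fun k => a k + b k)%R _ _ (mnnM mf mg)) => k.
  by rewrite addr_ge0.
- exact: mnnM.
apply: nearW => w1; apply: ihK => //.
- exact: (mnn_pair2 (T := Om ord0) w1 mf).
- exact: (mnn_pair2 (T := Om ord0) w1 mg).
Qed.

Lemma iN_cst1 K (Om : 'I_K.+1 -> sfspace R) a : (forall k, a k = 0%R) ->
  iN (Om := Om) a (fun=> 1) <= 1.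
Proof.
elim: K Om a => [|K ihK] Om a a0 /=; rewrite ?/mixn a0; first exact: nm_cst1_0.
by apply/nm0_leP => //; apply: nearW => w; apply: ihK.
Qed.

Lemma iN_hoelder_prod K (Om : 'I_K.+1 -> sfspace R) (I : Type) (s : seq I)
    (a : I -> 'I_K.+1 -> R) (f : I -> iter_sf Om -> \bar R) :
  (forall i k, 0 <= a i k)%R -> (forall i, mnn (f i)) ->
  iN (Om := Om) (fun k => \sum_(i <- s) a i k)%R (fun w => \prod_(i <- s) f i w)
  <= \prod_(i <- s) iN (Om := Om) (a i) (f i).
Proof.
move=> a0 mf; elim: s => [|i s ihs].
  under [X in iN _ X]eq_fun do rewrite big_nil.
  by rewrite big_nil; apply: iN_cst1 => k; rewrite big_nil.
have ms : mnn (fun w => \prod_(j <- s) f j w).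
  elim: s {ihs} => [|j s ihs].
    by under eq_fun do rewrite big_nil; apply: mnn_cst; rewrite lee_fin.
  by under eq_fun do rewrite big_cons; exact: mnnM.
have as0 k : (0 <= \sum_(j <- s) a j k)%R by apply: sumr_ge0.
have F := fnorm_iN Om (a0 i).
under [X in iN _ X]eq_fun do rewrite big_cons.
under [X in iN X _]eq_fun do rewrite big_cons.
rewrite big_cons; apply: le_trans (iN_hoelder (a0 i) as0 (mf i) ms) _.
by apply: lee_wpmul2l => //; exact: (fn_ge0 F).
Qed.

Lemma iN_dual K (Om : 'I_K.+1 -> sfspace R) a : (forall k, 0 <= a k <= 1)%R ->
  hoelder_pair (iN (Om := Om) a) (iN (Om := Om) (fun k => 1 - a k)%R) /\
  norming (iN (Om := Om) a) (iN (Om := Om) (fun k => 1 - a k)%R).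
Proof.
elim: K Om a => [|K ihK] Om a a01 /=.
  by split; [exact: nm_hoelder_pair|exact: norming_nm].
have [hi ni] := ihK (fun k => Om (lift ord0 k)) (fun k => a (lift ord0 k))
  (fun k => a01 _).
have F1 : fnorm (iN (Om := fun k => Om (lift ord0 k)) (fun k => a (lift ord0 k))).
  by apply: fnorm_iN => k; have /andP[] := a01 (lift ord0 k).
have F2 : fnorm (iN (Om := fun k => Om (lift ord0 k))
    (fun k => 1 - a (lift ord0 k))%R).
  by apply: fnorm_iN => k; have /andP[_] := a01 (lift ord0 k); rewrite subr_ge0.
by split; [exact: hoelder_pair_mix|exact: norming_mix].
Qed.

Lemma iN_dominated K (Om : 'I_K.+1 -> sfspace R) a : (forall k, 0 < a k)%R ->
  dominated_cvg0 (iN (Om := Om) a).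
Proof.
elim: K Om a => [|K ihK] Om a a0 /=; first exact: dominated_nm.
apply: dominated_mix => //; last exact: ihK.
by apply: fnorm_iN => k; exact: ltW.
Qed.

Lemma iN1 K (Om : 'I_K.+1 -> sfspace R) a h : (forall k, a k = 1%R) -> mnn h ->
  iN (Om := Om) a h = \int[sf_mu (iter_sf Om)]_w h w.
Proof.
elim: K Om a h => [|K ihK] Om a h a1 mh /=; first by rewrite a1 nm1.
rewrite /mixn a1 nm1; last first.
  by apply: mnn_tl => // k; rewrite a1.
rewrite (int_prod mh); apply: eq_integral => w1 _; apply: ihK => //.
exact: (mnn_pair2 (T := Om ord0) w1 mh).
Qed.

End iN.

Section absc.
Context {R : realType}.

Lemma abscE (z : R[i]) :
  absc z = Num.sqrt (complex.Re z ^+ 2 + complex.Im z ^+ 2).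
Proof. by case: z. Qed.

Lemma absc_ge0 (z : R[i]) : 0 <= absc z.
Proof. by rewrite abscE sqrtr_ge0. Qed.

Lemma absc_real (x : R) : absc x%:C%C = `|x|.
Proof. by rewrite abscE/= expr0n addr0 sqrtr_sqr. Qed.

Lemma absc_eq0 (z : R[i]) : absc z = 0 -> z = 0.
Proof. exact: Normc.eq0_normc. Qed.

Lemma abscM (x y : R[i]) : absc (x * y) = absc x * absc y.
Proof. exact: Normc.normcM. Qed.

Lemma le_abscD (x y : R[i]) : absc (x + y) <= absc x + absc y.
Proof. exact: le_normcD. Qed.

Lemma mnn_absc (S : sfspace R) (f : S -> R[i]) : cmeasurable f ->
  mnn (fun w => (absc (f w))%:E).
Proof.
move=> [mr mi]; split=> [|w]; last by rewrite lee_fin absc_ge0.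
apply/measurable_EFinP.
under eq_fun do rewrite abscE -powR12_sqrt ?addr_ge0 ?sqr_ge0//.
apply: (@measurableT_comp _ _ _ _ _ _ (fun x : R => x `^ 2^-1)).
  exact: measurable_powR.
by apply: measurable_funD; exact: measurable_funX.
Qed.

Lemma cmeasurable_cfun (S : sfspace R) (g : S -> R) :
  cmeasurable (cfun g) <-> measurable_fun setT g.
Proof. by split=> [[]//|mg]; split. Qed.

End absc.

(** * Iterated Lebesgue spaces in terms of nested norms *)

Section iter_Lebesgue.
Context {R : realType}.
Local Open Scope ereal_scope.

Definition einv (t : \bar R) : R := fine (t^-1).

Lemma einv_ge0 t : 0 < t -> (0 <= einv t)%R.
Proof. by move=> t0; rewrite fine_ge0// inve_ge0 ltW. Qed.

(** The delicate case is t = +oo on a space of measure zero: the essential supremum no longer sees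
    the values of f, and the norm is 0 on both sides, thanks to [maxe 0] in [nm]. *)
Lemma LebesgueE (S : sfspace R) (t : \bar R) (f : S -> R[i]) : 0 < t ->
  Lebesgue t f = nm (einv t) (fun w => (absc (f w))%:E).
Proof.
move=> t0; have E : abse \o (fun w => (absc (f w))%:E) = (fun w => (absc (f w))%:E).
  by apply/funext => w /=; rewrite ger0_norm ?absc_ge0.
rewrite /Lebesgue unlock /nm /einv; case: t t0 => [t| |]// t0.
  have tN0 : t != 0%R by rewrite gt_eqF.
  rewrite inver (negbTE tN0)/= invr_eq0 (negbTE tN0) invrK; congr (_ `^ _).
  by apply: eq_integral => w _; rewrite ger0_norm ?absc_ge0.
rewrite invey eqxx E; case: ifPn => [mu0|].
  apply/esym/max_idPr; apply: ess_sup_gee => //.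
  by apply: nearW => w; rewrite lee_fin absc_ge0.
rewrite -leNgt => mu0; apply/esym/eqP; rewrite eq_le le_max lexx andbT.
rewrite ge_max lexx/=; apply/ess_supP.
have mu00 : sf_mu S setT = 0 by apply/eqP; rewrite eq_le mu0 measure_ge0.
by exists setT; split.
Qed.

(** When the norm of h is finite, h is finite almost everywhere and [fine] provides a
    representative. When it is +oo, either there is no real representative and the infimum is over
    the empty set, or every representative has norm +oo. *)
Lemma fs_extE (S : sfspace R) (X : fspace S) (N : (S -> \bar R) -> \bar R) h :
  fnorm N ->
  (forall g : S -> R, measurable_fun setT g ->
    X (cfun g) = N (fun w => `|g w|%:E)) ->
  mnn h -> fs_ext X h = N h.
Proof.
move=> FN XN mh.
have [hoo|hoo] := eqVneq (N h) +oo; last first.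
  have ae_h : \forall w \ae sf_mu S, (fine (h w))%:E = h w.
    have := fn_fin FN mh; rewrite ltey => /(_ hoo); apply: filterS => w hw.
    by rewrite fineK// ge0_fin_numE// mh.2.
  have mf : measurable_fun setT (fun w => fine (h w)).
    by apply/measurable_EFinP; exact: (mnn_fine mh).1.
  have XE (g : S -> R) : measurable_fun setT g ->
      (\forall w \ae sf_mu S, (g w)%:E = h w) -> X (cfun g) = N h.
    move=> mg gh; rewrite XN//; apply: (fn_eq FN) => //.
      by split=> [|w]; [apply/measurable_EFinP; exact: measurableT_comp|rewrite lee_fin].
    apply: filterS gh => w gw; rewrite -gw ger0_norm//.
    by have := mh.2 w; rewrite -gw lee_fin.
  rewrite /fs_ext (_ : [set z | _] = [set N h]) ?ereal_inf1//.
  apply/seteqP; split => [z [g [mg gh ->]]|z ->] /=; first exact: XE.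
  by exists (fun w => fine (h w)); split => //; rewrite XE.
rewrite hoo; apply/ereal_inf_pinfty => z [g [mg gh ->]] /=.
rewrite XN// -hoo; apply: (fn_eq FN) => //.
  by split=> [|w]; [apply/measurable_EFinP; exact: measurableT_comp|rewrite lee_fin].
apply: filterS gh => w gw; rewrite -gw ger0_norm//.
by have := mh.2 w; rewrite -gw lee_fin.
Qed.

Lemma mixedE (S1 S2 : sfspace R) (t : \bar R) (Y : fspace S2) N
    (f : prod_sf S1 S2 -> R[i]) : 0 < t -> fnorm N ->
  (forall g : S2 -> R[i], cmeasurable g -> Y g = N (fun w => (absc (g w))%:E)) ->
  cmeasurable f ->
  mixed (@Lebesgue R S1 t) Y f =
    mixn (S1 := S1) (einv t) N (fun w => (absc (f w))%:E).
Proof.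
move=> t0 FN YN mf; rewrite /mixed.
have mf' := fn_meas FN (mnn_absc mf).
rewrite (_ : (fun w1 => Y _) = fun w1 => N (fun w2 => (absc (f (w1, w2)))%:E)).
  apply: (fs_extE (fnorm_nm S1 (einv_ge0 t0))) => // g mg.
  by rewrite LebesgueE//; congr nm; apply/funext => w; rewrite absc_real.
apply/funext => w1; apply: YN; case: mf => mr mi; split.
- exact: (measurableT_comp mr (measurable_pair1 (T1 := S1) (T2 := S2) w1)).
- exact: (measurableT_comp mi (measurable_pair1 (T1 := S1) (T2 := S2) w1)).
Qed.

Lemma iter_LebesgueE K (Om : 'I_K.+1 -> sfspace R) t (f : iter_sf Om -> R[i]) :
  (forall k, 0 < t k) -> cmeasurable f ->
  iter_Lebesgue (Om := Om) t f =
  iN (Om := Om) (fun k => einv (t k)) (fun w => (absc (f w))%:E).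
Proof.
elim: K Om t f => [|K ihK] Om t f t0 mf /=; first exact: LebesgueE.
apply: mixedE => // [|g mg]; last exact: ihK.
by apply: fnorm_iN => k; exact: einv_ge0.
Qed.

End iter_Lebesgue.

(** * Iterated Lebesgue spaces as function spaces *)

Section cmeasurable.
Context {R : realType} (S : sfspace R).
Implicit Types f g : S -> R[i].

Lemma cmeasurableM f g : cmeasurable f -> cmeasurable g ->
  cmeasurable (fun w => f w * g w).
Proof.
move=> [fr fi] [gr gi]; split.
- rewrite (_ : (fun w => _) = (fun w => complex.Re (f w) * complex.Re (g w) -
    complex.Im (f w) * complex.Im (g w))); last first.
    by apply/funext => w; case: (f w) (g w) => [a b] [c d].
  by apply: measurable_funB; exact: measurable_funM.
- rewrite (_ : (fun w => _) = (fun w => complex.Re (f w) * complex.Im (g w) +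
    complex.Im (f w) * complex.Re (g w))); last first.
    by apply/funext => w; case: (f w) (g w) => [a b] [c d].
  by apply: measurable_funD; exact: measurable_funM.
Qed.

Lemma cmeasurableD f g : cmeasurable f -> cmeasurable g ->
  cmeasurable (fun w => f w + g w).
Proof.
move=> [fr fi] [gr gi]; split.
- rewrite (_ : (fun w => _) = (fun w => complex.Re (f w) + complex.Re (g w))).
    exact: measurable_funD.
  by apply/funext => w; case: (f w) (g w) => [a b] [c d].
- rewrite (_ : (fun w => _) = (fun w => complex.Im (f w) + complex.Im (g w))).
    exact: measurable_funD.
  by apply/funext => w; case: (f w) (g w) => [a b] [c d].
Qed.

Lemma cmeasurable_cst (a : R[i]) : cmeasurable (fun _ : S => a).
Proof. by split. Qed.

End cmeasurable.

Definition normed_by {R : realType} (S : sfspace R) (X : fspace S)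
    (N : (S -> \bar R) -> \bar R) : Prop :=
  forall f, cmeasurable f -> X f = N (fun w => (absc (f w))%:E).

Section normed_by.
Context {R : realType} (K : nat) (Om : 'I_K.+1 -> sfspace R).
Local Open Scope ereal_scope.
Local Notation S := (iter_sf Om).
Variables (X : fspace S) (a : 'I_K.+1 -> R).
Hypotheses (a0 : forall k, (0 <= a k)%R) (XN : normed_by X (iN (Om := Om) a)).

Let FN := fnorm_iN Om a0.

Lemma normed_by_cfun (g : S -> R) : measurable_fun setT g -> (forall w, (0 <= g w)%R) ->
  X (cfun g) = iN (Om := Om) a (EFin \o g).
Proof.
move=> mg g0; rewrite XN; last exact/cmeasurable_cfun.
by congr iN; apply/funext => w; rewrite absc_real ger0_norm.
Qed.

Let iN_triangle rho f g : (0 < rho)%R -> (forall k, a k * rho <= 1)%R ->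
  mnn f -> mnn g ->
  (iN (Om := Om) (fun k => a k * rho)%R (fun w => f w + g w) <=
   iN (Om := Om) (fun k => a k * rho)%R f + iN (Om := Om) (fun k => a k * rho)%R g).
Proof.
move=> r0 ar mf mg.
have ar01 k : (0 <= a k * rho <= 1)%R by rewrite ar mulr_ge0// ltW.
have [hi ni] := iN_dual Om ar01.
by apply: minkowskiD hi ni _ _ mf mg; apply: fnorm_iN => k; case/andP: (ar01 k).
Qed.

(** Pointwise, |f + g|^rho <= 2^rho (|f|^rho + |g|^rho). The norm with exponents a_k rho <= 1
    satisfies the triangle inequality, and each of the two resulting terms is at most (X f + X
    g)^rho, which gives the second factor 2. *)
Lemma normed_by_triangle rho : (0 < rho)%R -> (forall k, a k * rho <= 1)%R ->
  exists C : R, forall xi eta, in_fs X xi -> in_fs X eta ->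
    X (fun w => xi w + eta w)%R <= C%:E * (X xi + X eta).
Proof.
move=> r0 ar; exists ((2 `^ rho * 2) `^ rho^-1)%R => f g [mf foo] [mg goo].
have mfg := cmeasurableD mf mg.
move: foo goo; rewrite !XN// => foo goo.
set F := (fun w => (absc (f w))%:E) in foo *.
set G := (fun w => (absc (g w))%:E) in goo *.
have mF : mnn F by exact: mnn_absc.
have mG : mnn G by exact: mnn_absc.
have mFr := mnn_poweR rho mF; have mGr := mnn_poweR rho mG.
have mFG := mnn_poweR rho (mnn_absc mfg).
have NF0 := fn_ge0 FN F; have NG0 := fn_ge0 FN G.
have ar0 k : (0 <= a k * rho)%R by rewrite mulr_ge0// ltW.
rewrite -poweR_EFin muleC; set B := (_ + _); have B0 : 0 <= B by exact: adde_ge0.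
rewrite muleC -(poweRK (lt0r_neq0 r0) B0) -poweRM ?poweR_ge0 ?lee_fin ?mulr_ge0 ?powR_ge0//.
have c0 : (0 <= 2 `^ rho * 2 :> R)%R by rewrite mulr_ge0// powR_ge0.
rewrite -poweR_le ?mule_ge0 ?poweR_ge0 ?lee_fin ?(fn_ge0 FN)//.
rewrite -iN_poweR//; last exact: mnn_absc.
apply: (@le_trans _ _ (iN (Om := Om) (fun k => a k * rho)%R (fun w =>
    (2 `^ rho)%:E * (F w `^ rho + G w `^ rho)))).
  apply: (fn_le (fnorm_iN Om ar0)) => //.
    by apply: mnnM; [apply: mnn_cst; rewrite lee_fin powR_ge0|exact: mnnD].
  apply: nearW => w; rewrite /F /G !poweR_EFin -EFinD -EFinM lee_fin.
  apply: (@le_trans _ _ ((2 * Num.max (absc (f w)) (absc (g w))) `^ rho)%R).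
    apply: ge0_ler_powR; [exact: ltW|by rewrite nnegrE absc_ge0|
      by rewrite nnegrE mulr_ge0// le_max absc_ge0|].
    apply: (le_trans (le_abscD _ _)); rewrite mulr_natl mulr2n.
    by apply: lerD; rewrite le_max lexx ?orbT.
  rewrite powRM ?le_max ?absc_ge0//; apply: ler_wpM2l; first exact: powR_ge0.
  by rewrite /Num.max; case: ifP => _; rewrite ?lerDl ?lerDr powR_ge0.
rewrite (fn_Z (fnorm_iN Om ar0)) ?powR_ge0//; last exact: mnnD.
rewrite EFinM -muleA; apply: lee_wpmul2l; first by rewrite lee_fin powR_ge0.
apply: le_trans (iN_triangle r0 ar mFr mGr) _.
rewrite !iN_poweR// mule_natl mule2n.
by apply: leeD; apply: le_poweR; rewrite ?(ltW r0) ?leeDl ?leeDr.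
Qed.

Lemma normed_by_qbfs rho : (0 < rho)%R -> (forall k, a k * rho <= 1)%R ->
  is_qbfs X.
Proof.
move=> r0 ar; split.
- by move=> f mf; rewrite XN// (fn_ge0 FN).
- move=> f mf; rewrite XN// (fn_eq0P FN (mnn_absc mf)); split.
    by apply: filterS => w [/absc_eq0].
  by apply: filterS => w ->; rewrite abscE/= expr0n addr0 sqrtr0.
- move=> c f [mf foo]; rewrite !XN//; last first.
    by apply: cmeasurableM => //; exact: cmeasurable_cst.
  rewrite -(fn_Z FN) ?absc_ge0//; last exact: mnn_absc.
  by congr iN; apply/funext => w; rewrite abscM EFinM.
- exact: normed_by_triangle ar.
- move=> f g mf [mg _] fg; rewrite !XN//; apply: (fn_le FN); try exact: mnn_absc.
  by apply: filterS fg => w; rewrite lee_fin.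
- have [k [mk k0 koo]] := fn_unit FN.
  have mf : measurable_fun setT (fun w => fine (k w)).
    by apply/measurable_EFinP; exact: (mnn_fine mk).1.
  have kfin := fn_fin FN mk koo.
  exists (fun w => fine (k w)); split.
    by apply: filterS kfin => w kw; rewrite fine_gt0// k0.
  split; first exact/cmeasurable_cfun.
  rewrite normed_by_cfun//; last by move=> w; rewrite fine_ge0// mk.2.
  rewrite (fn_eq FN (h := k))//; first exact: mnn_fine.
  by apply: filterS kfin => w kw; rewrite /= fineK// ge0_fin_numE// mk.2.
- move=> xin xi [mxin mxi ae] inX _.
  pose u n w := (`|xin n w|)%:E.
  have mu n : mnn (u n).
    split=> [|w]; last by rewrite lee_fin.
    by apply/measurable_EFinP; exact: measurableT_comp.
  (* The given sequence increases only almost everywhere; the running maxima of its absolute values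
     increase everywhere and agree with it almost everywhere. *)
  pose h := fix h n : S -> \bar R :=
    if n is k.+1 then fun w => maxe (h k w) (u k.+1 w) else u 0%N.
  have mh n : mnn (h n).
    elim: n => [|n ihn] /=; first exact: mu.
    split=> [|w]; last by rewrite le_max ihn.2.
    by apply: measurable_maxe; [exact: ihn.1|exact: (mu _).1].
  have hS n w : h n w <= h n.+1 w by rewrite /= le_max lexx.
  have hu w : (forall n, 0 <= xin n w)%R -> (forall n, xin n w <= xin n.+1 w)%R ->
      forall n, h n w = u n w.
    move=> x0 xS; elim=> [//|n /= ->]; apply/max_idPr.
    by rewrite lee_fin !ger0_norm.
  have XE (g : S -> R) : measurable_fun setT g -> X (cfun g) = iN (Om := Om) a (fun w => `|g w|%:E).
    move=> mg; rewrite XN; last exact/cmeasurable_cfun.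
    by congr iN; apply/funext => w; rewrite absc_real.
  rewrite XE//.
  transitivity (iN (Om := Om) a (fun w => esupn (h ^~ w))).
    apply: (fn_eq FN); last 2 first.
    + exact: mnn_esupn.
    + apply: filterS ae => w [x0 xS xc]; apply/esym.
      rewrite (_ : h ^~ w = EFin \o (fun n => xin n w)); last first.
        by apply/funext => n; rewrite hu// /u ger0_norm.
      have xi0 : (0 <= xi w)%R.
        rewrite -(cvg_lim _ xc)//; apply: limr_ge; last exact: nearW.
        by apply/cvg_ex; exists (xi w).
      rewrite ger0_norm//.
      have nd : nondecreasing_seq (EFin \o (fun n => xin n w)).
        by apply/nondecreasing_seqP => n; rewrite lee_fin.
      rewrite /esupn; have := ereal_nondecreasing_cvgn nd; move=> /cvg_lim <- //.
      by apply: cvg_lim => //; apply/cvg_EFin => //; exact: nearW.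
    + split=> [|w]; last by rewrite lee_fin.
      by apply/measurable_EFinP; exact: measurableT_comp.
  rewrite (fn_esupn FN)//; apply: eq_esupn => n.
  rewrite XE//; apply: (fn_eq FN (mh n) (mu n)).
  by apply: filterS ae => w [x0 xS _]; exact: hu.
Qed.

Lemma normed_by_bfs : (forall k, a k <= 1)%R -> is_bfs X.
Proof.
move=> a1; split; first by apply: (normed_by_qbfs ltr01) => k; rewrite mulr1.
move=> f g [mf _] [mg _]; have mfg := cmeasurableD mf mg; rewrite !XN//.
have a01 k : (0 <= a k <= 1)%R by rewrite a0 a1.
have [hi ni] := iN_dual Om a01.
apply: le_trans (minkowskiD FN hi ni (mnn_absc mf) (mnn_absc mg)).
apply: (fn_le FN); first exact: mnn_absc.
  by apply: mnnD; exact: mnn_absc.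
by apply: nearW => w; rewrite -EFinD lee_fin le_abscD.
Qed.

Lemma normed_by_order_continuous : (forall k, 0 < a k)%R -> order_continuous X.
Proof.
move=> a1 xin xi [mxin mxi ae] [_ xioo].
pose u n w := `|xin n w - xi w|%:E; pose H w := `|xi w|%:E.
have mu n : mnn (u n).
  split=> [|w]; last by rewrite lee_fin.
  apply/measurable_EFinP; apply: measurableT_comp => //.
  exact: measurable_funB.
have mH : mnn H.
  split=> [|w]; last by rewrite lee_fin.
  by apply/measurable_EFinP; exact: measurableT_comp.
(* The minimum makes the domination by |xi| hold everywhere; it changes nothing almost everywhere,
   since there 0 <= xi_n <= xi. *)
pose h n w := mine (u n w) (H w).
have mh n : mnn (h n).
  split=> [|w]; last by rewrite le_min (mu n).2 mH.2.
  by apply: measurable_mine; [exact: (mu n).1|exact: mH.1].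
have hu n : \forall w \ae sf_mu S, u n w = h n w.
  apply: filterS ae => w [x0 xS xc]; apply/esym/min_idPl; rewrite lee_fin.
  have xinle : (xin n w <= xi w)%R.
    have nd : nondecreasing_seq (fun n => xin n w) by apply/nondecreasing_seqP.
    by rewrite -(cvg_lim _ xc)//; apply: nondecreasing_cvgn_le => //; apply/cvg_ex; exists (xi w).
  have xi0 := le_trans (x0 n) xinle.
  rewrite (ger0_norm xi0) distrC ger0_norm ?subr_ge0//.
  by rewrite lerBlDr lerDl.
rewrite (_ : (fun n => _) = (fun n => iN (Om := Om) a (h n))); last first.
  apply/funext => n; rewrite XN; last first.
    by apply/cmeasurable_cfun; exact: measurable_funB.
  rewrite -(fn_eq FN (mu n) (mh n) (hu n)); congr iN.
  by apply/funext => w; rewrite absc_real.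
apply: (iN_dominated a1 mh mH).
- by move=> n w; rewrite ge_min lexx orbT.
- move: xioo; rewrite XN; last exact/cmeasurable_cfun.
  by congr (_ < _); congr iN; apply/funext => w; rewrite absc_real.
have /ae_foralln hu' := hu.
apply: filterS2 ae hu' => w [x0 xS xc] hw.
rewrite (_ : (fun n => h n w) = EFin \o (fun n => `|xin n w - xi w|%R)); last first.
  by apply/funext => n; rewrite -hw.
apply/cvg_EFin; first exact: nearW.
have : (xin n w - xi w)%R @[n --> \oo] --> (xi w - xi w)%R.
  by apply: cvgB => //; exact: cvg_cst.
by rewrite subrr => /cvg_norm; rewrite normr0.
Qed.

(** After raising to the power rho this is the triangle inequality, with constant 1, for the
    functions |xi_k|^rho and the exponents a_k rho <= 1. *)
Lemma normed_by_pconvex rho : (0 < rho)%R -> (forall k, a k * rho <= 1)%R ->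
  pconvex rho X.
Proof.
move=> r0 ar n xi inX; have rN0 := lt0r_neq0 r0.
have mxi k : cmeasurable (xi k) by case: (inX k).
have ar0 k : (0 <= a k * rho)%R by rewrite mulr_ge0// ltW.
have ar01 k : (0 <= a k * rho <= 1)%R by rewrite ar0 ar.
have [hi ni] := iN_dual Om ar01.
pose s w : \bar R := \sum_(k < n) ((absc (xi k w))%:E `^ rho).
have mxr k : mnn (fun w => (absc (xi k w))%:E `^ rho).
  by apply: mnn_poweR; exact: mnn_absc.
have ms : mnn s.
  split=> [|w]; last by apply: sume_ge0 => k _; exact: poweR_ge0.
  by apply: emeasurable_sum => k; exact: (mxr k).1.
have sE w : s w = (\sum_(k < n) absc (xi k w) `^ rho)%:E by rewrite /s sumEFin.
rewrite normed_by_cfun; last 2 first.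
- have mi := (mnn_poweR rho^-1 ms).1.
  by apply/measurable_EFinP; apply: eq_measurable_fun mi => w _; rewrite sE.
- by move=> w; exact: powR_ge0.
rewrite (_ : EFin \o _ = (fun w => s w `^ rho^-1)); last first.
  by apply/funext => w; rewrite sE.
rewrite (_ : a = (fun k => a k * rho * rho^-1)%R); last first.
  by apply/funext => k; rewrite mulfK.
rewrite iN_poweR ?invr_gt0//; apply: le_poweR; rewrite ?invr_ge0 ?(ltW r0)//.
  exact: (fn_ge0 (fnorm_iN Om ar0)).
apply: le_trans (minkowski_sum (fnorm_iN Om ar0) hi ni (index_enum _) mxr) _.
apply: lee_sum => k _; rewrite iN_poweR//; last exact: mnn_absc.
by rewrite XN.
Qed.

End normed_by.

(** * Products and duals *)

Section prod_powR.
Context {R : realType}.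

Lemma prod_powR_sum (I : Type) (s : seq I) (th : I -> R) (x : R) : 0 < x ->
  \prod_(i <- s) x `^ th i = x `^ (\sum_(i <- s) th i).
Proof.
move=> x0; elim: s => [|i s ihs]; first by rewrite !big_nil powRr0.
by rewrite !big_cons ihs powRD// (gt_eqF x0) implybT.
Qed.

Lemma prod_powR1 (I : finType) (th : I -> R) (x : R) : 0 <= x ->
  \sum_i th i = 1 -> \prod_i x `^ th i = x.
Proof.
rewrite le_eqVlt => /predU1P[<-|x0] th1; last by rewrite prod_powR_sum// th1 powRr1// ltW.
(* At x = 0 a nonzero exponent is needed to make the product vanish, because 0 to the power 0 is
   1. *)
have [i thi] : exists i, th i != 0.
  apply/existsP; rewrite -negb_forall; apply/negP => /forallP th0.
  move: th1; rewrite big1 => [/esym/eqP|i _]; first by rewrite oner_eq0.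
  exact/eqP.
by rewrite (bigD1 i)//= powR0// mul0r.
Qed.

Lemma prod_EFin (I : Type) (s : seq I) (f : I -> R) :
  (\prod_(i <- s) (f i)%:E)%E = (\prod_(i <- s) f i)%:E.
Proof. by elim/big_rec2: _ => // i x y _ ->. Qed.

Lemma lee_prod (I : Type) (s : seq I) (f g : I -> \bar R) :
  (forall i, 0 <= f i)%E -> (forall i, f i <= g i)%E ->
  (\prod_(i <- s) f i <= \prod_(i <- s) g i)%E.
Proof.
move=> f0 fg; suff : (0 <= \prod_(i <- s) f i <= \prod_(i <- s) g i)%E by case/andP.
elim/big_rec2: _ => [|i x y _ /andP[x0 xy]]; first by rewrite lee_fin ler01 lexx.
by rewrite mule_ge0//= lee_pmul.
Qed.

Lemma mnn_prod d (T : measurableType d) (I : Type) (s : seq I)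
    (f : I -> T -> \bar R) : (forall i, mnn (f i)) ->
  mnn (fun w => \prod_(i <- s) f i w)%E.
Proof.
move=> mf; elim: s => [|i s ihs].
  by under eq_fun do rewrite big_nil; apply: mnn_cst; rewrite lee_fin.
by under eq_fun do rewrite big_cons; exact: mnnM.
Qed.

End prod_powR.

Section factorisation.
Context {R : realType} (m : nat).
Local Open Scope ereal_scope.

(* [h] factors into functions realising equality in Hoelder's inequality;
   [th j] is the share of the norm that the factor [j] carries. *)
Definition factorable (S : sfspace R) (N : (S -> \bar R) -> \bar R)
    (Nj : 'I_m -> (S -> \bar R) -> \bar R) (th : 'I_m -> R) : Prop :=
  forall d (T : measurableType d) (h : T * S -> \bar R), mnn h ->
  exists eta : 'I_m -> T * S -> R,
    (forall j, mnn (EFin \o eta j)) /\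
    forall t, N (fun w => h (t, w)) < +oo ->
      (\forall w \ae sf_mu S, h (t, w) = (\prod_j eta j (t, w))%:E) /\
      forall j, Nj j (fun w => (eta j (t, w))%:E) <= N (fun w => h (t, w)) `^ th j.

Variables (th : 'I_m -> R).
Hypotheses (th0 : forall j, (0 <= th j)%R) (th1 : (\sum_j th j = 1)%R).

(** Only an inequality: for b = 0 the right-hand side is 1, while the left-hand side is 0 on a space
    of measure zero. *)
Lemma le_nm_powR (S : sfspace R) a b (h : S -> \bar R) : (0 <= a)%R ->
  (0 <= b)%R -> mnn h -> nm (a * b) (fun w => h w `^ b) <= nm a h `^ b.
Proof.
move=> a0; rewrite le_eqVlt => /predU1P[<-|b0] mh; last by rewrite nm_poweR.
rewrite mulr0 poweRe0; under [X in nm _ X]eq_fun do rewrite poweRe0.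
exact: nm_cst1_0.
Qed.

Lemma factorable_nm (S : sfspace R) a : (0 <= a)%R ->
  factorable (S := S) (nm a) (fun j => nm (a * th j)) th.
Proof.
move=> a0 d T h mh; exists (fun j z => fine (h z) `^ th j)%R.
have me j : mnn (EFin \o (fun z => fine (h z) `^ th j)%R).
  exact: (mnn_poweR (th j) (mnn_fine mh)).
split=> // t hoo; have mht := mnn_pair2 t mh.
have ae := nm_fin a0 mht hoo.
split=> [|j].
  apply: filterS ae => w hw; rewrite prod_powR1 ?fine_ge0 ?mh.2// fineK//.
  by rewrite ge0_fin_numE// mh.2.
apply: (@le_trans _ _ (nm (a * th j) (fun w => h (t, w) `^ th j))).
  apply: le_nm; first by rewrite mulr_ge0.
  - exact: (mnn_pair2 t (me j)).
  - exact: mnn_poweR.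
  apply: filterS ae => w hw; rewrite -poweR_EFin fineK//.
  by rewrite ge0_fin_numE// mh.2.
exact: le_nm_powR.
Qed.

(** The inner factors carry the shares [th'] of the inner norm [phi], while the outer level requires
    the shares [th]. The correction [c j], which is phi^(th_j - th'_j) where [phi] is positive,
    rebalances them. As both families of shares sum to 1, the corrections multiply to 1 and the
    product of the factors is unchanged. *)
Lemma factorable_mix (S1 S2 : sfspace R) a (N : (S2 -> \bar R) -> \bar R)
    (Nj : 'I_m -> (S2 -> \bar R) -> \bar R) th' :
  (0 <= a)%R -> (\sum_j th' j = 1)%R -> fnorm N -> (forall j, fnorm (Nj j)) ->
  factorable N Nj th' ->
  factorable (mixn (S1 := S1) a N)
    (fun j => mixn (S1 := S1) (a * th j) (Nj j)) th.
Proof.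
move=> a0 th'1 FN FNj fac d T h mh.
have mh' : mnn (fun z : T * S1 * S2 => h (z.1.1, (z.1.2, z.2))).
  by apply: (mnn_comp mh); exact: measurable_assoc.
have [eta [meta etaP]] := fac _ _ _ mh'.
pose phi (u : T * S1) := N (fun w => h (u.1, (u.2, w))).
have mphi : mnn phi := fn_meas FN mh'.
pose c j u := (fine (phi u) `^ th j * fine (phi u) `^ (- th' j))%R.
have mc j : mnn (EFin \o c j).
  apply: (@mnnM _ _ _ (fun u => (fine (phi u))%:E `^ th j)
    (fun u => (fine (phi u))%:E `^ (- th' j))); apply: mnn_poweR; exact: mnn_fine.
pose eta' j (z : T * (S1 * S2)) : R :=
  (c j (z.1, z.2.1) * eta j (z.1, z.2.1, z.2.2))%R.
have meta' j : mnn (EFin \o eta' j).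
  apply: (@mnnM _ _ _ (fun z : T * (S1 * S2) => (c j (z.1, z.2.1))%:E)
    (fun z => (eta j (z.1, z.2.1, z.2.2))%:E)).
    apply: (mnn_comp (mc j)); apply/measurable_fun_pair => //.
    exact: measurableT_comp.
  apply: (mnn_comp (meta j)); apply/measurable_fun_pair.
    by apply/measurable_fun_pair => //; exact: measurableT_comp.
  exact: measurableT_comp.
exists eta'; split => // t hoo.
have ae := nm_fin a0 (mnn_pair2 t mphi) hoo.
have phi0 u : (0 <= fine (phi u))%R by rewrite fine_ge0// mphi.2.
have phiK w1 : phi (t, w1) < +oo -> (fine (phi (t, w1)))%:E = phi (t, w1).
  by move=> ?; rewrite fineK// ge0_fin_numE// mphi.2.
split=> [|j].
  apply: ae_sections_prod.
    rewrite -[X in measurable X]setTI.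
    rewrite (_ : ~` _ = [set w | h (t, w) != (\prod_j eta' j (t, w))%:E]).
      apply: measurable_neqe => //; first exact: (mnn_pair2 t mh).1.
      have mp : mnn (fun z => \prod_(j < m) (EFin \o eta' j) z) by exact: mnn_prod.
      have := (mnn_pair2 t mp).1; apply: eq_measurable_fun => w _.
      by rewrite /= prod_EFin.
    by apply/seteqP; split => w /= /eqP.
  apply: filterS ae => w1 hw1.
  have [ae1 _] := etaP (t, w1) hw1.
  (* Where the inner norm vanishes the corrections need not multiply to 1, but there h vanishes
     almost everywhere and so does the product of the factors. *)
  have [phi00|phiN0] := eqVneq (phi (t, w1)) 0.
    have hw0 := fn_eq0 FN (mnn_pair2 (t, w1) mh') phi00.
    apply: filterS2 ae1 hw0 => w2 /= -> /= hp; rewrite hp.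
    by move: hp => [hp]; rewrite /eta' big_split/= hp mulr0.
  apply: filterS ae1 => w2 /= ->; congr EFin; rewrite /eta' big_split/=.
  have p0 : (0 < fine (phi (t, w1)))%R.
    by rewrite fine_gt0// hw1 lt0e phiN0 mphi.2.
  rewrite /c big_split/= !prod_powR_sum// th1 sumrN th'1 powRr1//.
  by rewrite powR_inv1// mulfV ?mul1r// gt_eqF.
apply: (@le_trans _ _ (nm (S := S1) (a * th j) (fun w1 => phi (t, w1) `^ th j)));
  last exact: (le_nm_powR a0 (th0 j) (mnn_pair2 t mphi)).
apply: le_nm; first by rewrite mulr_ge0.
- exact: (fn_meas (FNj j) (mnn_pair2 t (meta' j))).
- exact: mnn_poweR (mnn_pair2 t mphi).
apply: filterS ae => w1 hw1.
have [_ /(_ j) ej] := etaP (t, w1) hw1.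
rewrite /eta'/=; under [X in Nj j X]eq_fun do rewrite EFinM.
rewrite (fn_Z (FNj j)); last 2 first.
- by rewrite /c mulr_ge0// powR_ge0.
- exact: (mnn_pair2 (t, w1) (meta j)).
apply: (@le_trans _ _ ((c j (t, w1))%:E * (phi (t, w1) `^ th' j))).
  by apply: lee_wpmul2l => //; rewrite lee_fin /c mulr_ge0// powR_ge0.
rewrite -(phiK _ hw1) !poweR_EFin -EFinM lee_fin /c -mulrA ler_piMr ?powR_ge0//.
rewrite powRN; have [->|?] := eqVneq (fine (phi (t, w1)) `^ th' j)%R 0%R.
  by rewrite mulr0.
by rewrite mulVf.
Qed.

End factorisation.

Section iter_products.
Context {R : realType} (K : nat) (Om : 'I_K.+1 -> sfspace R) (m : nat).
Local Open Scope ereal_scope.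
Local Notation S := (iter_sf Om).

Lemma factorable_iN (a : 'I_K.+1 -> R) (aj : 'I_m -> 'I_K.+1 -> R) :
  (forall k, 0 < a k)%R -> (forall j k, 0 <= aj j k)%R ->
  (forall k, \sum_j aj j k = a k)%R ->
  factorable (iN (Om := Om) a) (fun j => iN (Om := Om) (aj j))
    (fun j => aj j ord0 / a ord0)%R.
Proof.
elim: K Om a aj => [|K' ihK] Om' a aj a0 aj0 aja /=.
  have th1 : (\sum_j aj j ord0 / a ord0 = 1)%R.
    by rewrite -mulr_suml aja mulfV// gt_eqF.
  rewrite (_ : (fun j => nm (aj j ord0)) =
    (fun j => nm (a ord0 * (aj j ord0 / a ord0))%R)); last first.
    by apply/funext => j; rewrite mulrC divfK// gt_eqF.
  by apply: factorable_nm => //; [move=> j; rewrite divr_ge0// ltW|exact: ltW].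
pose th j := (aj j ord0 / a ord0)%R.
have thE (k : 'I_K'.+2) : (\sum_j aj j k / a k = 1)%R.
  by rewrite -mulr_suml aja mulfV// gt_eqF.
rewrite (_ : (fun j => mixn _ _) = (fun j => mixn (S1 := Om' ord0) (a ord0 * th j)%R
    (iN (Om := fun k => Om' (lift ord0 k)) (fun k => aj j (lift ord0 k))))); last first.
  by apply/funext => j; rewrite /th mulrC divfK// gt_eqF.
have thg0 j : (0 <= th j)%R by rewrite divr_ge0// ltW.
apply: (@factorable_mix _ _ th thg0 (thE ord0) _ _ _ _ _
  (fun j => aj j (lift ord0 ord0) / a (lift ord0 ord0))%R) => //.
- exact: ltW.
- by apply: fnorm_iN => k; exact: ltW.
- by move=> j; apply: fnorm_iN.
- exact: (ihK (fun k => Om' (lift ord0 k)) (fun k => a (lift ord0 k))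
    (fun j k => aj j (lift ord0 k))).
Qed.

(** Hoelder's inequality bounds the norm of f by every competing product. The factorisation attains
    it, because the shares of the norm carried by the factors sum to 1. *)
Lemma normed_by_prod (X : 'I_m -> fspace S) (a : 'I_K.+1 -> R) aj :
  (forall k, 0 < a k)%R -> (forall j k, 0 <= aj j k)%R ->
  (forall k, \sum_j aj j k = a k)%R ->
  (forall j, normed_by (X j) (iN (Om := Om) (aj j))) ->
  normed_by (prod_fs X) (iN (Om := Om) a).
Proof.
move=> a0 aj0 aja XN f mf.
have FN : fnorm (iN (Om := Om) a) by apply: fnorm_iN => k; exact: ltW.
have mF := mnn_absc mf.
apply/eqP; rewrite eq_le; apply/andP; split; last first.
  apply: le_ereal_inf_tmp => _ [eta [eX eta0 fe ->]].
  have meta j : mnn (EFin \o eta j).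
    split=> [|w]; last by rewrite /= lee_fin.
    by apply/measurable_EFinP; apply/cmeasurable_cfun; case: (eX j).
  rewrite (eq_bigr (fun j => iN (Om := Om) (aj j) (EFin \o eta j))); last first.
    move=> j _; apply: normed_by_cfun => //; apply/cmeasurable_cfun.
    by case: (eX j).
  apply: (le_trans _ (iN_hoelder_prod _ aj0 meta)).
  rewrite (_ : (fun k => _) = a); last by apply/funext => k; rewrite aja.
  apply: (fn_le FN) => //; first exact: mnn_prod.
  by apply: filterS fe => w fw; rewrite prod_EFin lee_fin.
have [->|foo] := eqVneq (iN (Om := Om) a (fun w => (absc (f w))%:E)) +oo.
  by rewrite leey.
have Foo : iN (Om := Om) a (fun w => (absc (f w))%:E) < +oo by rewrite ltey.
have [eta [meta etaP]] := factorable_iN a0 aj0 aja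
  (mnn_comp mF (@measurable_snd _ _ nat S)).
have [fe ne] := etaP 0%N Foo.
pose th j := (aj j ord0 / a ord0)%R.
have th1 : (\sum_j th j = 1)%R.
  by rewrite /th -mulr_suml aja mulfV// gt_eqF.
have me j : measurable_fun setT (fun w => eta j (0%N, w)).
  by apply/measurable_EFinP; exact: (mnn_pair2 0%N (meta j)).1.
have e0 j w : (0 <= eta j (0%N, w))%R.
  by have := (meta j).2 (0%N, w); rewrite /= lee_fin.
have XE j : X j (cfun (fun w => eta j (0%N, w))) =
    iN (Om := Om) (aj j) (fun w => (eta j (0%N, w))%:E).
  exact: normed_by_cfun.
apply: (@le_trans _ _ (\prod_(j < m) X j (cfun (fun w => eta j (0%N, w))))).
  apply: ereal_inf_lbound; exists (fun j w => eta j (0%N, w)); split => //.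
  - move=> j; split; first exact/cmeasurable_cfun.
    rewrite XE; apply: (le_lt_trans (ne j)); exact: poweR_lty.
  - by apply: filterS fe => w [->].
under eq_bigr do rewrite XE.
apply: (le_trans (lee_prod _ _ ne)).
  by move=> j; apply: fn_ge0; exact: fnorm_iN.
rewrite /=; set n := iN _ _ in Foo *.
have nfin : n \is a fin_num by rewrite ge0_fin_numE// (fn_ge0 FN).
rewrite -(fineK nfin); under eq_bigr do rewrite poweR_EFin.
by rewrite prod_EFin prod_powR1// fine_ge0// (fn_ge0 FN).
Qed.

End iter_products.

Section dual.
Context {R : realType} (K : nat) (Om : 'I_K.+1 -> sfspace R).
Local Open Scope ereal_scope.
Local Notation S := (iter_sf Om).
Variables (X : fspace S) (a : 'I_K.+1 -> R).
Hypotheses (a01 : forall k, (0 <= a k <= 1)%R)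
  (XN : normed_by X (iN (Om := Om) a)).

(** With x + iy the integral of f and z its modulus, z^2 is the integral of x Re f + y Im f, whose
    integrand is at most z |f| by the Cauchy-Schwarz inequality in the plane. *)
Lemma absc_cintegral_le (f : S -> R[i]) : cmeasurable f -> cintegrable f ->
  (absc (cintegral f))%:E <= \int[sf_mu S]_w (absc (f w))%:E.
Proof.
move=> mf [ir ii]; set A := \int[_]_w _.
have [->|Aoo] := eqVneq A +oo; first by rewrite leey.
have A0 : 0 <= A by apply: integral_ge0 => w _; rewrite lee_fin absc_ge0.
have Afin : A \is a fin_num by rewrite ge0_fin_numE// ltey.
set x := Rintegral (sf_mu S) setT (fun w => complex.Re (f w)).
set y := Rintegral (sf_mu S) setT (fun w => complex.Im (f w)).
have cE : absc (cintegral f) = Num.sqrt (x ^+ 2 + y ^+ 2) by rewrite abscE.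
set z := Num.sqrt _ in cE; have z0 : (0 <= z)%R by exact: sqrtr_ge0.
rewrite cE -(fineK Afin) lee_fin.
have [->|zN0] := eqVneq z 0%R; first by rewrite fine_ge0.
have z_gt0 : (0 < z)%R by rewrite lt0r zN0.
have zz : (z * z = x * x + y * y)%R.
  by rewrite -expr2 sqr_sqrtr ?addr_ge0 ?sqr_ge0// !expr2.
rewrite -(ler_pM2l z_gt0) zz.
have iA : (sf_mu S).-integrable setT (fun w => (absc (f w))%:E).
  apply/integrableP; split; first exact: (mnn_absc mf).1.
  rewrite (eq_integral (fun w => (absc (f w))%:E)) -/A ?ltey// => w _.
  by rewrite gee0_abs// lee_fin absc_ge0.
have iZ (c : R) (g : S -> R) : (sf_mu S).-integrable setT (fun w => (g w)%:E) ->
    (sf_mu S).-integrable setT (fun w => (c * g w)%:E).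
  by move=> ig; exact: (integrableZl measurableT c ig).
rewrite /x /y -!RintegralZl// -RintegralD//; [|exact: iZ..].
apply: le_Rintegral => //.
- apply: (integrableD measurableT (f := fun w => (x * complex.Re (f w))%:E)
    (g := fun w => (y * complex.Im (f w))%:E)); exact: iZ.
- exact: iZ.
move=> w _; rewrite abscE; set p := complex.Re _; set q := complex.Im _.
have s0 : (0 <= p ^+ 2 + q ^+ 2)%R by rewrite addr_ge0 ?sqr_ge0.
apply: (le_trans (ler_norm _)).
rewrite -ler_sqr ?nnegrE ?mulr_ge0 ?sqrtr_ge0//.
rewrite real_normK ?num_real// exprMn !sqr_sqrtr ?addr_ge0 ?sqr_ge0// -/x -/y.
rewrite -subr_ge0.
rewrite (_ : _ - _ = (x * q - y * p) ^+ 2)%R ?sqr_ge0//.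
ring.
Qed.

(** If eta does not define a functional on X, then M = +oo, because a finite M makes all the
    pairings integrable. Otherwise Hoelder's inequality bounds the operator norm by M, and the
    norming functions for the dual exponents reach M, whether it is finite or not. *)
Lemma normed_by_dual : normed_by (dual_fs X) (iN (Om := Om) (fun k => 1 - a k)%R).
Proof.
move=> eta meta; set h := (fun w => (absc (eta w))%:E).
have mh : mnn h by exact: mnn_absc.
have a0 k : (0 <= a k)%R by case/andP: (a01 k).
have a01' k : (0 <= 1 - a k <= 1)%R.
  by have /andP[? ?] := a01 k; apply/andP; split; lra.
have [hi _] := iN_dual Om a01.
have [hi' ni'] := iN_dual Om a01'.
have FN := fnorm_iN Om a0.
have FN' : fnorm (iN (Om := Om) (fun k => 1 - a k)%R).
  by apply: fnorm_iN => k; case/andP: (a01' k).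
have aE : (fun k => 1 - (1 - a k))%R = a by apply/funext => k; ring.
rewrite aE in hi' ni'.
set M := iN _ h; have M0 : 0 <= M by exact: (fn_ge0 FN').
have mul_le xi : cmeasurable xi ->
    \int[sf_mu S]_w (absc (xi w * eta w))%:E <=
    iN (Om := Om) a (fun w => (absc (xi w))%:E) * M.
  move=> mxi; apply: le_trans (hi _ _ (mnn_absc mxi) mh).
  by rewrite le_eqVlt; apply/orP; left; apply/eqP; apply: eq_integral => w _;
    rewrite abscM EFinM.
have int_fin_M : M < +oo -> forall xi, in_fs X xi ->
    cintegrable (fun w => xi w * eta w)%R.
  move=> Moo xi [mxi]; rewrite XN// => xoo.
  have mxe := cmeasurableM mxi meta.
  have iA : (sf_mu S).-integrable setT (fun w => (absc (xi w * eta w))%:E).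
    apply/integrableP; split; first exact: (mnn_absc mxe).1.
    apply: (@le_lt_trans _ _ (iN (Om := Om) a (fun w => (absc (xi w))%:E) * M)).
      rewrite (eq_integral (fun w => (absc (xi w * eta w))%:E)); first exact: mul_le.
      by move=> w _; rewrite gee0_abs// lee_fin absc_ge0.
    have xfin : iN (Om := Om) a (fun w => (absc (xi w))%:E) \is a fin_num.
      by rewrite ge0_fin_numE// (fn_ge0 FN).
    have Mfin : M \is a fin_num by rewrite ge0_fin_numE.
    by rewrite -(fineK xfin) -(fineK Mfin) -EFinM ltry.
  split; apply: le_integrable iA => //.
  - by apply/measurable_EFinP; exact: mxe.1.
  - move=> w _; rewrite lee_fin (ger0_norm (absc_ge0 _)) abscE -sqrtr_sqr.
    by rewrite ler_wsqrtr// lerDl sqr_ge0.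
  - by apply/measurable_EFinP; exact: mxe.2.
  - move=> w _; rewrite lee_fin (ger0_norm (absc_ge0 _)) abscE -sqrtr_sqr.
    by rewrite ler_wsqrtr// lerDr sqr_ge0.
rewrite /dual_fs; case: asboolP => [int_xi|nint]; last first.
  by apply/esym/eqP; rewrite -leye_eq leNgt; apply/negP => /int_fin_M.
apply/eqP; rewrite eq_le; apply/andP; split.
  apply: ge_ereal_sup => _ [xi [inx x1 ->]]; have [mxi _] := inx.
  apply: (le_trans (absc_cintegral_le (cmeasurableM mxi meta) (int_xi _ inx))).
  apply: (le_trans (mul_le _ mxi)); rewrite -[leRHS]mul1e.
  by apply: lee_wpmul2r => //; move: x1; rewrite XN.
have [xi [mxi xi1 Mn]] := norming_at ni' mh; rewrite /M Mn.
apply: esupn_le => n; set x := xi n.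
have x0 w : (0 <= x w)%R by have := (mxi n).2 w; rewrite /= lee_fin.
(* the phase of [eta] turns the norming function into a complex one *)
pose v w : R := (absc (eta w) `^ (-1))%R.
pose y w : R[i] := Complex (x w * complex.Re (eta w) * v w)%R
  (- (x w * complex.Im (eta w) * v w))%R.
have mv : measurable_fun setT v.
  apply: (@measurableT_comp _ _ _ _ _ _ (fun x : R => x `^ (-1))%R).
    exact: measurable_powR.
  by apply/measurable_EFinP; exact: mh.1.
have mx : measurable_fun setT x by apply/measurable_EFinP; exact: (mxi n).1.
have my : cmeasurable y.
  split; first by apply: measurable_funM => //; apply: measurable_funM => //; exact: meta.1.
  apply: measurableT_comp => //; apply: measurable_funM => //.
  by apply: measurable_funM => //; exact: meta.2.
have vE w : v w = (absc (eta w))^-1%R by rewrite /v powR_inv1// absc_ge0.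
have sq w : (complex.Re (eta w) ^+ 2 + complex.Im (eta w) ^+ 2 = absc (eta w) ^+ 2)%R.
  by rewrite abscE sqr_sqrtr// addr_ge0 ?sqr_ge0.
have absy w : (absc (y w) <= x w)%R.
  rewrite abscE/= -[leRHS]ger0_norm// -sqrtr_sqr ler_wsqrtr//.
  rewrite sqrrN !exprMn -mulrDl -mulrDr sq vE -mulrA ler_piMr ?sqr_ge0//.
  have [->|?] := eqVneq (absc (eta w)) 0%R; first by rewrite expr0n mul0r.
  by rewrite -exprMn mulfV// expr1n.
have yeta w : (y w * eta w)%R = Complex (x w * absc (eta w))%R 0%R.
  rewrite /y vE; have := sq w; case: (eta w) => [p q].
  set N := absc _; rewrite /= => spq.
  have [->|eN0] := eqVneq N 0%R.
    rewrite invr0 !mulr0 oppr0.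
    by apply/eqP; rewrite eq_complex/= !mul0r subr0 addr0 eqxx.
  apply/eqP; rewrite eq_complex /=; apply/andP; split; apply/eqP; last by ring.
  rewrite mulNr opprK.
  transitivity (x w * (p ^+ 2 + q ^+ 2) * N^-1)%R; first by ring.
  by rewrite spq expr2 mulrA mulfK.
have X1 : X y <= 1.
  rewrite XN//; apply: le_trans (xi1 n); apply: (fn_le FN).
  - exact: mnn_absc.
  - exact: mxi.
  - by apply: nearW => w; rewrite lee_fin.
have inX : in_fs X y by split => //; exact: le_lt_trans (ltry 1).
apply: ereal_sup_ubound; exists y; split => //.
have [ir _] := int_xi _ inX.
rewrite abscE /=.
have -> : Rintegral (sf_mu S) setT (fun w => complex.Im (y w * eta w)%R) = 0%R.
  by rewrite /Rintegral; under eq_integral do rewrite yeta/=; rewrite integral0.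
rewrite expr0n addr0 sqrtr_sqr /Rintegral.
under [X in `|fine X|%R]eq_integral do rewrite yeta/=.
have iE : \int[sf_mu S]_w (x w * absc (eta w))%:E \is a fin_num.
  have := integrable_fin_num measurableT ir.
  by under eq_integral do rewrite yeta/=.
rewrite ger0_norm; last first.
  by rewrite fine_ge0// integral_ge0// => w _; rewrite lee_fin mulr_ge0// absc_ge0.
by rewrite fineK.
Qed.

End dual.

(** * Dyadic trees *)

Section dyadic.
Context {R : realType}.

(* A function on the leaves of the complete binary tree of depth [n] is a
   function on [nat], of which only the values at [i < 2 ^ n] matter. *)
Definition upper_half (A : Type) (n : nat) (u : nat -> A) (i : nat) : A := u (2 ^ n + i)%N.

Fixpoint avg (n : nat) (u : nat -> R) : R :=
  if n is k.+1 then (avg k u + avg k (upper_half k u)) / 2 else u 0%N.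

Fixpoint tsum (n : nat) (u : nat -> \bar R) : \bar R :=
  if n is k.+1 then (tsum k u + tsum k (upper_half k u))%E else u 0%N.

(** The dyadic maximal function: the largest average over the nested blocks around the leaf [i]. The
    final 0 is harmless for nonnegative [u]. *)
Fixpoint dmax (n : nat) (u : nat -> R) (i : nat) : R :=
  Num.max (avg n u)
    (if n is k.+1 then if (i < 2 ^ k)%N then dmax k u i
                       else dmax k (upper_half k u) (i - 2 ^ k)%N
     else 0).

Lemma ltn_upper_half n i : (2 ^ n + i < 2 ^ n)%N = false.
Proof. by rewrite ltnNge leq_addr. Qed.

Lemma eq_avg n (u v : nat -> R) : (forall i, (i < 2 ^ n)%N -> u i = v i) ->
  avg n u = avg n v.
Proof.
elim: n u v => [|n ihn] u v uv /=; first exact: uv.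
have lt1 i : (i < 2 ^ n -> i < 2 ^ n.+1)%N.
  by move=> /leq_trans; apply; rewrite leq_exp2l.
rewrite (ihn u v) ?(ihn (upper_half n u) (upper_half n v))// => i ilt; last exact/uv/lt1.
by apply: uv; rewrite expnS mul2n -addnn ltn_add2l.
Qed.

Lemma eq_tsum n (u v : nat -> \bar R) : (forall i, (i < 2 ^ n)%N -> u i = v i) ->
  tsum n u = tsum n v.
Proof.
elim: n u v => [|n ihn] u v uv /=; first exact: uv.
have lt1 i : (i < 2 ^ n -> i < 2 ^ n.+1)%N.
  by move=> /leq_trans; apply; rewrite leq_exp2l.
rewrite (ihn u v) ?(ihn (upper_half n u) (upper_half n v))// => i ilt; last exact/uv/lt1.
by apply: uv; rewrite expnS mul2n -addnn ltn_add2l.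
Qed.

Lemma avg_cst n (c : R) : avg n (fun=> c) = c.
Proof. by elim: n => [//|n ihn] /=; rewrite /upper_half ihn; lra. Qed.

Lemma avg_ge0 n (u : nat -> R) : (forall i, 0 <= u i) -> 0 <= avg n u.
Proof.
elim: n u => [|n ihn] u u0 //=; rewrite divr_ge0// addr_ge0 ?ihn// => i.
exact: u0.
Qed.

Lemma le_avg n (u v : nat -> R) : (forall i, u i <= v i) -> avg n u <= avg n v.
Proof.
elim: n u v => [|n ihn] u v uv //=.
have h1 := ihn u v uv; have h2 := ihn (upper_half n u) (upper_half n v) (fun i => uv _); lra.
Qed.

Lemma avgD n (u v : nat -> R) : avg n (fun i => u i + v i) = avg n u + avg n v.
Proof.
elim: n u v => [//|n ihn] u v /=.
rewrite (_ : upper_half n _ = fun i => upper_half n u i + upper_half n v i)// !ihn; lra.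
Qed.

Lemma avgZ n (c : R) (u : nat -> R) : avg n (fun i => c * u i) = c * avg n u.
Proof.
elim: n u => [//|n ihn] u /=.
rewrite (_ : upper_half n _ = fun i => c * upper_half n u i)// !ihn; lra.
Qed.

Lemma tsum_ge0 n (u : nat -> \bar R) : (forall i, 0 <= u i)%E -> (0 <= tsum n u)%E.
Proof.
elim: n u => [|n ihn] u u0 //=; rewrite adde_ge0 ?ihn// => i.
exact: u0.
Qed.

Lemma le_tsum n (u v : nat -> \bar R) : (forall i, (i < 2 ^ n)%N -> (u i <= v i)%E) ->
  (tsum n u <= tsum n v)%E.
Proof.
elim: n u v => [|n ihn] u v uv /=; first exact: uv.
have lt1 i : (i < 2 ^ n -> i < 2 ^ n.+1)%N.
  by move=> /leq_trans; apply; rewrite leq_exp2l.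
apply: leeD; apply: ihn => i ilt; first exact/uv/lt1.
by apply: uv; rewrite expnS mul2n -addnn ltn_add2l.
Qed.

Lemma tsumD n (u v : nat -> \bar R) :
  tsum n (fun i => u i + v i)%E = (tsum n u + tsum n v)%E.
Proof.
elim: n u v => [//|n ihn] u v /=.
by rewrite (_ : upper_half n _ = fun i => upper_half n u i + upper_half n v i)%E// !ihn addeACA.
Qed.

Lemma tsum_EFin n (u : nat -> R) : tsum n (EFin \o u) = ((2 ^ n)%:R * avg n u)%:E.
Proof.
elim: n u => [|n ihn] u /=; first by rewrite mul1r.
rewrite -[upper_half n (EFin \o u)]/(EFin \o upper_half n u) !ihn -EFinD; congr EFin.
rewrite expnS natrM -mulrDr -mulrA mulrCA; congr (_ * _).
by rewrite mulrCA mulfV ?mulr1.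
Qed.

Lemma tsum_big n (u : nat -> \bar R) : tsum n u = (\sum_(i < 2 ^ n) u i)%E.
Proof.
elim: n u => [|n ihn] u /=; first by rewrite big_ord_recl big_ord0 adde0.
rewrite !ihn -!(big_mkord xpredT) /upper_half expnS mul2n -addnn.
rewrite [RHS](@big_cat_nat _ _ _ (2 ^ n)%N) ?leq_addr//=; congr (_ + _)%E.
rewrite -[X in _ = (\sum_(X <= _ < _) _)%E]add0n big_addn addnK.
by apply: eq_bigr => i _; rewrite addnC.
Qed.

Lemma avg_le_dmax n u i : avg n u <= dmax n u i.
Proof. by case: n => [|n] /=; rewrite le_max lexx. Qed.

Lemma dmax_ge0 n u i : (forall i, 0 <= u i) -> 0 <= dmax n u i.
Proof. by move=> u0; apply: le_trans (avg_ge0 n u0) (avg_le_dmax _ _ _). Qed.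

Lemma dmax_l n u i : (i < 2 ^ n)%N -> dmax n u i <= dmax n.+1 u i.
Proof. by move=> /= ->; rewrite le_max lexx orbT. Qed.

Lemma dmax_r n u i : dmax n (upper_half n u) i <= dmax n.+1 u (2 ^ n + i)%N.
Proof. by rewrite /= ltn_upper_half addKn le_max lexx orbT. Qed.

Lemma dmax_le_cst n u c i : (forall i, (i < 2 ^ n)%N -> u i <= c) -> 0 <= c ->
  (i < 2 ^ n)%N -> dmax n u i <= c.
Proof.
have avg_le k v : (forall i, (i < 2 ^ k)%N -> v i <= c) -> avg k v <= c.
  move=> vc; rewrite -(avg_cst k c) (@eq_avg k v (fun i => Num.min (v i) c)).
    by apply: le_avg => j; rewrite ge_min lexx orbT.
  by move=> j /vc vj; apply/esym/min_idPl.
elim: n u i => [|n ihn] u i uc c0 ilt; have := avg_le _ _ uc;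
  rewrite /= ge_max => ->//=.
have lt1 j : (j < 2 ^ n -> j < 2 ^ n.+1)%N.
  by move=> /leq_trans; apply; rewrite leq_exp2l.
case: ltnP => lt; first by apply: ihn => // j /lt1; exact: uc.
apply: ihn => //.
  by move=> j jlt; apply: uc; rewrite expnS mul2n -addnn ltn_add2l.
by rewrite ltn_subLR// addnn -mul2n -expnS.
Qed.

(** * Doob's maximal inequality with a Bellman function *)

Section doob.
Variable q : R.
Hypothesis q1 : 1 < q.
(** [beta] is the value for which V(M, f) - V(f, f) is a multiple of the defect x^q + (q - 1) y^q -
    q x y^(q-1) in Young's inequality, at x = f and y = M. Half of the term 2 M^q in V is left over
    for the conclusion, and [c] comes from Young's inequality at x = 2 f. *)
Let beta := 2 * q / (q - 1).
Let c := beta * 2 `^ (q - 1) / q.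
Let q0 : 0 < q. Proof. exact: lt_trans q1. Qed.
Let q10 : 0 < q - 1. Proof. by rewrite subr_gt0. Qed.

Lemma young_powRB1 (x y : R) : 0 <= x -> 0 <= y ->
  q * (x * y `^ (q - 1)) <= x `^ q + (q - 1) * y `^ q.
Proof.
move=> x0 y0; have qq : q / (q - 1) > 0 by rewrite divr_gt0.
have := @conjugate_powR _ x (y `^ (q - 1)) q (q / (q - 1)) x0 (powR_ge0 _ _) q0 qq.
have e : (q - 1) * (q / (q - 1)) = q by rewrite mulrCA mulfV ?mulr1// gt_eqF.
rewrite invf_div -powRrM e => H.
have /H {}H : q^-1 + (q - 1) / q = 1 by field; rewrite gt_eqF.
have := ler_wpM2l (ltW q0) H; move/le_trans; apply.
rewrite le_eqVlt; apply/orP; left; apply/eqP; field.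
by rewrite !gt_eqF.
Qed.

(* Bellman function: [2 M ^ q - beta f M ^ (q - 1)], with [M] the running
   maximum and [f] the current average. *)
Let V (M f : R) := 2 * M `^ q - beta * (f * M `^ (q - 1)).

Let V_jump M f : 0 <= M -> 0 <= f ->
  V (Num.max M f) f <= V M f.
Proof.
move=> M0 f0; rewrite /Num.max; case: ltP => // Mf; rewrite /V.
have -> : f * f `^ (q - 1) = f `^ q by rewrite mulr_powRB1.
have := young_powRB1 f0 M0; rewrite /beta.
set X := f `^ q; set Y := M `^ q; set Z := f * _ => H.
rewrite -subr_ge0; have -> : 2 * Y - 2 * q / (q - 1) * Z - (2 * X - 2 * q / (q - 1) * X)
  = 2 / (q - 1) * (X + (q - 1) * Y - q * Z) by field; rewrite gt_eqF.
by rewrite mulr_ge0 ?divr_ge0 ?(ltW q10)// subr_ge0.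
Qed.

Let V_final M f : 0 <= M -> 0 <= f -> M `^ q <= V M f + c * f `^ q.
Proof.
move=> M0 f0; have := @young_powRB1 (2 * f) M _ M0; rewrite mulr_ge0// => /(_ isT).
rewrite powRM//; have -> : 2 `^ q = 2 * 2 `^ (q - 1) :> R by rewrite mulr_powRB1.
rewrite /V /c /beta; set X := f `^ q; set Y := M `^ q; set Z := M `^ (q - 1).
set t := 2 `^ (q - 1) => H; rewrite -subr_ge0.
have -> : 2 * Y - 2 * q / (q - 1) * (f * Z) + 2 * q / (q - 1) * t / q * X - Y =
  (q - 1)^-1 * (2 * t * X + (q - 1) * Y - q * (2 * f * Z)).
  by field; rewrite !gt_eqF.
by rewrite mulr_ge0 ?invr_ge0 ?(ltW q10)// subr_ge0.
Qed.

(** For fixed M, V is affine in f, so splitting a block into its halves preserves the mean of V.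
    Updating the running maximum does not increase V by [V_jump], and [V_final] closes the argument
    at the leaves. *)
Let doob_aux n (u : nat -> R) M : (forall i, 0 <= u i) -> 0 <= M ->
  avg n (fun i => Num.max M (dmax n u i) `^ q) <=
  V (Num.max M (avg n u)) (avg n u) + c * avg n (fun i => u i `^ q).
Proof.
elim: n u M => [|n ihn] u M u0 M0 /=.
  by rewrite (max_idPl (u0 _)); apply: V_final => //; rewrite le_max M0.
set f1 := avg n u; set f2 := avg n (upper_half n u); set f := (f1 + f2) / 2.
have u0' i : 0 <= upper_half n u i by exact: u0.
have f10 : 0 <= f1 by exact: avg_ge0.
have f20 : 0 <= f2 by exact: avg_ge0.
set M' := Num.max M f; have M'0 : 0 <= M' by rewrite le_max M0.
have -> : avg n (fun i => Num.max M (Num.max f (if (i < 2 ^ n)%N then dmax n u i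
    else dmax n (upper_half n u) (i - 2 ^ n)%N)) `^ q) =
    avg n (fun i => Num.max M' (dmax n u i) `^ q).
  by apply: eq_avg => i ilt; rewrite ilt maxA.
have -> : avg n (upper_half n (fun i => Num.max M (Num.max f (if (i < 2 ^ n)%N then dmax n u i
    else dmax n (upper_half n u) (i - 2 ^ n)%N)) `^ q)) =
    avg n (fun i => Num.max M' (dmax n (upper_half n u) i) `^ q).
  by apply: eq_avg => i ilt; rewrite /upper_half ltn_upper_half maxA addKn.
have h1 := ihn u M' u0 M'0; have h2 := ihn _ M' u0' M'0.
have v1 := V_jump M'0 f10; have v2 := V_jump M'0 f20.
have Vf : V M' f = (V M' f1 + V M' f2) / 2 by rewrite /V /f; field.
rewrite -/(upper_half n (fun i => u i `^ q)).
rewrite -[avg n (upper_half n (fun i => u i `^ q))]/(avg n (fun i => upper_half n u i `^ q)).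
rewrite Vf; move: h1 h2 v1 v2; rewrite -/f1 -/f2.
set a1 := avg n _; set a2 := avg n _; set a3 := avg n _; set a4 := avg n _.
set b1 := V _ _; set b2 := V _ _; set b3 := V _ _; set b4 := V _ _.
have -> : c * ((a2 + a4) / 2) = (c * a2 + c * a4) / 2 by ring.
lra.
Qed.

Lemma doob_powR : exists2 C : R, 0 <= C & forall n (u : nat -> R),
  (forall i, 0 <= u i) ->
  avg n (fun i => dmax n u i `^ q) <= C * avg n (fun i => u i `^ q).
Proof.
exists c.
  by rewrite /c /beta !mulr_ge0 ?invr_ge0 ?powR_ge0 ?(ltW q10)// ltW.
move=> n u u0; have := doob_aux n u0 (lexx 0).
rewrite (@eq_avg n _ (fun i => dmax n u i `^ q)); last first.
  by move=> i _; rewrite (max_idPr (dmax_ge0 _ _ u0)).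
have f0 := avg_ge0 n u0; rewrite (max_idPr f0) => /le_trans; apply.
rewrite gerDr /V mulr_powRB1// -mulrBl mulr_le0_ge0 ?powR_ge0//.
have -> : 2 - beta = - (2 / (q - 1)) by rewrite /beta; field; rewrite gt_eqF.
by rewrite oppr_le0 divr_ge0// ltW.
Qed.

End doob.

Section multilinear.
Variables (m : nat) (al : 'I_m -> R).
Hypothesis al0 : forall j, 0 < al j.

(* [ms] stands for the multisublinear dyadic maximal function. *)
Fixpoint ms (n : nat) (H : 'I_m -> nat -> R) (i : nat) : R :=
  Num.max (\prod_j avg n (H j) `^ al j)
    (if n is k.+1 then if (i < 2 ^ k)%N then ms k H i
                       else ms k (fun j => upper_half k (H j)) (i - 2 ^ k)%N
     else 0).

Lemma eq_ms n (H H' : 'I_m -> nat -> R) i : (i < 2 ^ n)%N ->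
  (forall j i, (i < 2 ^ n)%N -> H j i = H' j i) -> ms n H i = ms n H' i.
Proof.
elim: n H H' i => [|n ihn] H H' i ilt HH'.
  by congr Num.max; apply: eq_bigr => j _; congr (_ `^ _); apply: eq_avg => k; exact: HH'.
have lt1 k : (k < 2 ^ n -> k < 2 ^ n.+1)%N.
  by move=> /leq_trans; apply; rewrite leq_exp2l.
congr Num.max.
  by apply: eq_bigr => j _; congr (_ `^ _); apply: eq_avg => k; exact: HH'.
case: ltnP => lt; first by apply: ihn => // j k /lt1; exact: HH'.
apply: ihn => [|j k klt].
  by rewrite ltn_subLR// addnn -mul2n -expnS.
by apply: HH'; rewrite expnS mul2n -addnn ltn_add2l.
Qed.

Lemma ms_ge0 n H i : 0 <= ms n H i.
Proof.
by case: n => [|n] /=; rewrite le_max prodr_ge0// => j _; exact: powR_ge0.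
Qed.

Lemma avg_le_ms n H i : \prod_j avg n (H j) `^ al j <= ms n H i.
Proof. by case: n => [|n] /=; rewrite le_max lexx. Qed.

Lemma le_prod_powR (u v : 'I_m -> R) : (forall j, 0 <= u j) ->
  (forall j, u j <= v j) -> \prod_j u j `^ al j <= \prod_j v j `^ al j.
Proof.
move=> u0 uv; apply: ler_prod => j _; rewrite powR_ge0/=.
by apply: ge0_ler_powR; [exact: ltW|rewrite nnegrE|rewrite nnegrE (le_trans (u0 j))|].
Qed.

Lemma ms_le_dmax n (H : 'I_m -> nat -> R) i : (forall j i, 0 <= H j i) ->
  ms n H i <= \prod_j dmax n (H j) i `^ al j.
Proof.
elim: n H i => [|n ihn] H i H0.
  rewrite [leLHS]/= ge_max; apply/andP; split; last first.
    by apply: prodr_ge0 => j _; exact: powR_ge0.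
  by apply: le_prod_powR => j //=; rewrite le_max lexx.
rewrite [leLHS]/= ge_max; apply/andP; split.
  apply: le_prod_powR => j; first exact: (avg_ge0 n.+1).
  exact: (avg_le_dmax n.+1).
case: ltnP => lt.
  apply: (le_trans (ihn _ _ H0)); apply: le_prod_powR => j; first exact: dmax_ge0.
  exact: dmax_l.
have H0' j k : 0 <= upper_half n (H j) k by exact: H0.
apply: (le_trans (ihn _ _ H0')); apply: le_prod_powR => j; first exact: dmax_ge0.
by rewrite -{2}(subnKC lt); exact: dmax_r.
Qed.

(* [i %/ 2 ^ k] is the index of the dyadic block of length [2 ^ k] around [i] *)
Lemma block_le_ms n k (H : 'I_m -> nat -> R) i : (k <= n)%N -> (i < 2 ^ n)%N ->
  \prod_j avg k (fun l => H j (i %/ 2 ^ k * 2 ^ k + l)%N) `^ al j <= ms n H i.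
Proof.
elim: n H i => [|n ihn] H i kn ilt.
  move: kn; rewrite leqn0 => /eqP ->; apply: le_trans (avg_le_ms _ _ i).
  by move: ilt; rewrite expn0 ltnS leqn0 => /eqP ->.
move: kn; rewrite leq_eqVlt => /predU1P[->|]; last rewrite ltnS => kn.
  apply: le_trans (avg_le_ms _ _ i); rewrite le_eqVlt; apply/orP; left; apply/eqP.
  by apply: eq_bigr => j _; congr (_ `^ _); apply: eq_avg => l _; rewrite divn_small.
rewrite [leRHS]/= le_max; apply/orP; right; case: ltnP => lt; first exact: ihn.
have lt' : (i - 2 ^ n < 2 ^ n)%N by rewrite ltn_subLR// addnn -mul2n -expnS.
apply: le_trans (ihn _ _ kn lt'); rewrite le_eqVlt; apply/orP; left; apply/eqP.
apply: eq_bigr => j _; congr (_ `^ _); apply: eq_avg => l _; rewrite /upper_half; congr (H j _).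
rewrite addnA; congr (_ + l)%N.
have dn : (2 ^ k %| 2 ^ n)%N by exact: dvdn_exp2l.
rewrite -{1}(subnKC lt) divnDl// mulnDl; congr (_ + _)%N.
exact: divnK.
Qed.

End multilinear.

End dyadic.

Section leaf.
Context {R : realType}.

(* The leaves of a dyadic tree carry the counting measure of [0, n). *)
Definition leaf_mu (n : nat) : set nat -> \bar R := msum (fun i : nat => \d_ i) n.

HB.instance Definition _ n := Measure.copy (leaf_mu n)
  (msum (fun i : nat => \d_ i) n : {measure set nat -> \bar R}).

Let leaf_mu_sigma_finite n : sigma_finite setT (leaf_mu n).
Proof.
exists (fun=> setT) => [|k]; first by rewrite bigcup_const.
split => //; rewrite /leaf_mu /msum.
under eq_bigr do rewrite /= diracT.
by rewrite sumEFin ltry.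
Qed.

HB.instance Definition _ n := Measure_isSigmaFinite.Build _ _ _ (leaf_mu n)
  (leaf_mu_sigma_finite n).

Definition leaf (n : nat) : sfspace R :=
  @SFSpace R _ nat (leaf_mu n : {sigma_finite_measure set nat -> \bar R}).

Lemma mnn_leaf (f : nat -> \bar R) : (forall i, (0 <= f i)%E) -> mnn f.
Proof. by move=> f0; split. Qed.

Lemma leaf_int n (f : nat -> \bar R) : (forall i, (0 <= f i)%E) ->
  (\int[sf_mu (leaf n)]_i f i = \sum_(i < n) f i)%E.
Proof.
move=> f0.
rewrite [LHS](@ge0_integral_measure_sum _ nat R (fun i : nat => \d_ i) setT) //.
apply: eq_bigr => i _; by rewrite integral_dirac// diracT mul1e.
Qed.

Lemma leaf_ae n (P : nat -> Prop) :
  (\forall i \ae sf_mu (leaf n), P i) <-> (forall i, (i < n)%N -> P i).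
Proof.
split=> [[A [mA A0 PA]] i ilt|Pn].
  apply: contrapT => nPi; have Ai : A i by exact: PA.
  suff : (1 <= leaf_mu n A)%E by rewrite [leaf_mu _ _]A0 lee_fin ler10.
  have dA : (1 <= \d_i (A : set nat) :> \bar R)%E by rewrite (@diracE _ nat R i A) mem_set.
  rewrite /leaf_mu /msum (bigD1 (Ordinal ilt))//= -[leLHS]adde0; apply: leeD => //.
  by apply: sume_ge0 => j _.
exists (~` [set i | P i]); split => //.
rewrite /= /leaf_mu /msum big1// => i _ /=; rewrite (@diracE _ nat R i) memNset//=.
by move=> nP; apply: nP; exact: Pn.
Qed.

Lemma mnn_nat d (T : measurableType d) (h : nat * T -> \bar R) :
  (forall i, mnn (fun w => h (i, w))) -> mnn h.
Proof.
move=> mh; split=> [|[i w]]; last exact: (mh i).2.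
move=> _ B mB; rewrite setTI.
rewrite (_ : h @^-1` B = \bigcup_i ([set i] `*` ((fun w => h (i, w)) @^-1` B))).
  apply: bigcupT_measurable => i; apply: measurableX => //.
  by rewrite -[X in measurable X]setTI; exact: (mh i).1.
apply/seteqP; split=> [[i w] /= Bh|[i w] [j _ [/= -> //]]].
by exists i.
Qed.

Lemma nm_leaf_cst n a : 0 <= a ->
  (nm (S := leaf n) a (fun=> 1) <= (n%:R `^ a)%:E)%E.
Proof.
rewrite le_eqVlt => /predU1P[<-|a0].
  by rewrite powRr0; exact: nm_cst1_0.
rewrite /nm gt_eqF//; under eq_integral do rewrite poweR1r.
rewrite leaf_int// sumEFin poweR_EFin lee_fin big_const_ord iter_addr addr0.
by rewrite -mulr_natr mul1r.
Qed.

End leaf.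

(** * Bounds on the leaves that are uniform in the depth *)

Section leaf_bounds.
Context {R : realType}.
Local Open Scope ereal_scope.
Local Notation lf n := (leaf (R := R) (2 ^ n)).

Lemma hoelder_int (S : sfspace R) m (al b : 'I_m -> R) (F : 'I_m -> S -> \bar R) :
  (forall j, 0 < al j)%R -> (forall j, 0 <= b j)%R -> (\sum_j al j * b j = 1)%R ->
  (forall j, mnn (F j)) ->
  \int[sf_mu S]_w \prod_j (F j w `^ al j) <= \prod_j nm (b j) (F j) `^ al j.
Proof.
move=> al0 b0 alb mF; rewrite -nm1; last first.
  by apply: mnn_prod => j; exact: mnn_poweR.
have mFa j := mnn_poweR (al j) (mF j).
have bal0 j (k : 'I_1) : (0 <= b j * al j)%R by rewrite mulr_ge0// ltW.
have := @iN_hoelder_prod R 0 (fun=> S) 'I_m (index_enum _)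
  (fun j _ => b j * al j)%R (fun j w => F j w `^ al j) bal0 mFa.
rewrite /= (_ : (\sum_(i < m) b i * al i = 1)%R); last first.
  by rewrite -alb; apply: eq_bigr => j _; rewrite mulrC.
move=> /le_trans; apply; rewrite le_eqVlt; apply/orP; left; apply/eqP.
by apply: eq_bigr => j _; rewrite nm_poweR.
Qed.

Lemma tsum_leaf n (f : nat -> \bar R) : (forall i, 0 <= f i) ->
  tsum n f = \int[sf_mu (lf n)]_i f i.
Proof. by move=> f0; rewrite leaf_int// tsum_big. Qed.

(** Doob's inequality with q = 1 / b. Passing from averages to the counting measure multiplies both
    sides by the same 2^n, so C does not depend on the depth. For b = 0 averages stay below the
    supremum. *)
Lemma nm_leaf_dmax b : (0 <= b < 1)%R -> exists2 C : R, (0 <= C)%R &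
  forall n (u : nat -> R), (forall i, 0 <= u i)%R ->
  nm (S := lf n) b (EFin \o dmax n u) <= C%:E * nm (S := lf n) b (EFin \o u).
Proof.
move=> /andP[]; rewrite le_eqVlt => /predU1P[<-|b0] b1.
  exists 1%R => // n u u0; rewrite mul1e; set M := (X in _ <= X).
  have M0 : 0 <= M by exact: nm_ge0.
  have [->|Moo] := eqVneq M +oo; first by rewrite leey.
  have Mfin : M \is a fin_num by rewrite ge0_fin_numE// ltey.
  apply/nm0_leP => //; apply/leaf_ae => i ilt /=; rewrite -(fineK Mfin) lee_fin.
  apply: dmax_le_cst => //; last by rewrite fine_ge0.
  move=> k klt; rewrite -lee_fin fineK//.
  by have /leaf_ae := nm0_ub (S := lf n) (EFin \o u); exact.
have q1 : (1 < b^-1)%R by rewrite invf_gt1.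
have [C C0 CP] := doob_powR q1.
exists (C `^ b)%R; first exact: powR_ge0.
move=> n u u0; rewrite /nm gt_eqF// -poweR_EFin -poweRM ?lee_fin//; last first.
  by apply: integral_ge0 => i _; exact: poweR_ge0.
apply: le_poweR; first exact: ltW.
  by apply: integral_ge0 => i _; exact: poweR_ge0.
rewrite -!tsum_leaf; [|by move=> i; exact: poweR_ge0..].
rewrite -[fun i => _]/(EFin \o (fun i => dmax n u i `^ b^-1)%R).
rewrite -[X in _ <= _ * tsum _ X]/(EFin \o (fun i => u i `^ b^-1)%R).
rewrite !tsum_EFin -EFinM lee_fin mulrCA ler_wpM2l//; exact: CP.
Qed.

Section multilinear.
Variables (m : nat) (al b : 'I_m -> R).
Hypotheses (al0 : forall j, (0 < al j)%R) (b01 : forall j, (0 <= b j < 1)%R)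
  (alb : (\sum_j al j * b j = 1)%R).

Let b0 j : (0 <= b j)%R. Proof. by case/andP: (b01 j). Qed.

(** Here [u j i] will be the norm of the j-th function at the leaf [i]. No exponents b_j occur,
    which is why this quantity can mediate between two choices of them. *)
Definition qmax n (u : 'I_m -> nat -> R) : \bar R :=
  tsum n (fun i => (\prod_j dmax n (u j) i `^ al j)%:E).

Lemma qmax_bound : exists2 C : R, (0 <= C)%R & forall n (u : 'I_m -> nat -> R),
  (forall j i, 0 <= u j i)%R ->
  qmax n u <= C%:E * \prod_j nm (S := lf n) (b j) (EFin \o u j) `^ al j.
Proof.
have /(_ _)/cid2 -/all_sig2[C C0 CP] := fun j => nm_leaf_dmax (b01 j).
exists (\prod_j C j `^ al j)%R; first by apply: prodr_ge0 => j _; exact: powR_ge0.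
move=> n u u0; rewrite /qmax.
have du0 j i : (0 <= dmax n (u j) i)%R by exact: dmax_ge0.
rewrite tsum_leaf; last first.
  by move=> i; rewrite lee_fin; apply: prodr_ge0 => j _; exact: powR_ge0.
rewrite (_ : (fun i => _) = fun i => \prod_j ((EFin \o dmax n (u j)) i `^ al j)); last first.
  by apply/funext => i; rewrite -prod_EFin.
apply: (le_trans (hoelder_int al0 b0 alb _)).
  by move=> j; apply: mnn_leaf => i; rewrite lee_fin.
rewrite -prod_EFin -big_split/=; apply: lee_prod => j; first exact: poweR_ge0.
rewrite -poweR_EFin -poweRM ?lee_fin ?nm_ge0//; apply: le_poweR; [exact: ltW|exact: nm_ge0|exact: CP].
Qed.

(** Integrate the pointwise bound, apply Hoelder's inequality in w, and interchange the norms over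
    the leaves and over [S1]. The interchange is the reason for having the same [b j] on both. *)
Lemma bd_lift (S1 : sfspace R) n (C : R) (J : nat -> S1 -> \bar R)
    (psi : 'I_m -> nat -> S1 -> \bar R) : (0 <= C)%R ->
  (forall i, mnn (J i)) -> (forall j i, mnn (psi j i)) ->
  (\forall w \ae sf_mu S1, tsum n (J ^~ w) <=
     C%:E * \prod_j nm (S := lf n) (b j) (fun i => psi j i w) `^ al j) ->
  tsum n (fun i => \int[sf_mu S1]_w J i w) <=
  C%:E * \prod_j nm (S := lf n) (b j) (fun i => nm (S := S1) (b j) (psi j i)) `^ al j.
Proof.
move=> C0 mJ mpsi ae.
have mpsi' j : mnn (fun z : nat * S1 => psi j z.1 z.2) by apply: mnn_nat => i; exact: mpsi.
have mF j : mnn (fun w => nm (S := lf n) (b j) (fun i => psi j i w)).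
  apply: (nm_meas (S := lf n) (b j) (h := fun z : S1 * nat => psi j z.2 z.1)).
  exact: (mnn_comp (mpsi' j) (@measurable_swap _ _ S1 nat)).
rewrite tsum_big -ge0_integral_sum//; last 2 first.
- by move=> i; exact: (mJ i).1.
- by move=> i w _; exact: (mJ i).2.
apply: (@le_trans _ _ (\int[sf_mu S1]_w (C%:E * \prod_j
    nm (S := lf n) (b j) (fun i => psi j i w) `^ al j))).
  apply: le_int.
  - split=> [|w]; last by apply: sume_ge0 => i _; exact: (mJ i).2.
    by apply: emeasurable_sum => i; exact: (mJ i).1.
  - apply: mnnM; first exact: mnn_cst.
    by apply: mnn_prod => j; exact: mnn_poweR.
  - by apply: filterS ae => w; rewrite tsum_big.
have mP : mnn (fun w => \prod_j nm (S := lf n) (b j) (fun i => psi j i w) `^ al j).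
  by apply: mnn_prod => j; exact: mnn_poweR.
rewrite ge0_integralZl_EFin//; [|by move=> w _; exact: mP.2|exact: mP.1].
apply: lee_wpmul2l; first by rewrite lee_fin.
apply: (le_trans (hoelder_int al0 b0 alb mF)).
rewrite le_eqVlt; apply/orP; left; apply/eqP; apply: eq_bigr => j _; congr (_ `^ _).
by rewrite (nm_swap (S1 := lf n) (S2 := S1) (h := fun z => psi j z.1 z.2)).
Qed.

End multilinear.

End leaf_bounds.

(** * Extrapolation by stopping times *)

Section stopping.
Context {R : realType} (m : nat) (al : 'I_m -> R).
Hypothesis al0 : forall j, (0 < al j)%R.
Variables (A : R) (lam : 'I_m -> R).
Hypotheses (A1 : 1 <= A) (lam0 : forall j, 0 <= lam j).

(** The values [phi j] will be norms at the leaves, and [lam j] their averages over the whole tree.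
    The recursions below descend from the root and halt at the first stopped block, that is, at the
    maximal stopped blocks. *)
Definition stopped (n : nat) (phi : 'I_m -> nat -> R) : bool :=
  [exists j, A * lam j < avg n (phi j)].

(** The conditional expectation of [u] at the stopping time: its average on each maximal stopped
    block, and [u] itself elsewhere. *)
Fixpoint stopped_avg n (phi : 'I_m -> nat -> R) (u : nat -> R) (i : nat) : R :=
  if stopped n phi then avg n u
  else if n is k.+1 then
    if (i < 2 ^ k)%N then stopped_avg k phi u i
    else stopped_avg k (fun j => upper_half k (phi j)) (upper_half k u) (i - 2 ^ k)%N
  else u 0%N.

Fixpoint in_stopped n (phi : 'I_m -> nat -> R) (i : nat) : bool :=
  stopped n phi || (if n is k.+1 then
    if (i < 2 ^ k)%N then in_stopped k phi i
    else in_stopped k (fun j => upper_half k (phi j)) (i - 2 ^ k)%N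
  else false).

(** The maximal function over the blocks that lie inside a maximal stopped block, and 0 on the
    leaves that are not stopped. *)
Fixpoint stopped_ms n (phi : 'I_m -> nat -> R) (H : 'I_m -> nat -> R) (i : nat) : R :=
  if stopped n phi then ms al n H i
  else if n is k.+1 then
    if (i < 2 ^ k)%N then stopped_ms k phi H i
    else stopped_ms k (fun j => upper_half k (phi j)) (fun j => upper_half k (H j)) (i - 2 ^ k)%N
  else 0.

Lemma avg_stopped_avg n phi u : avg n (stopped_avg n phi u) = avg n u.
Proof.
elim: n phi u => [|n ihn] phi u; first by rewrite /=; case: ifP.
have [st|/negbTE st] := boolP (stopped n.+1 phi).
  rewrite -[RHS](avg_cst n.+1); apply: eq_avg => i _.
  by rewrite [LHS]/= st.
rewrite [LHS]/= st.
rewrite (@eq_avg _ n _ (stopped_avg n phi u)); last by move=> i ->.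
rewrite (@eq_avg _ n (upper_half n _) (stopped_avg n (fun j => upper_half n (phi j)) (upper_half n u))); last first.
  by move=> i ilt; rewrite [LHS]/upper_half ltn_upper_half addKn.
by rewrite !ihn.
Qed.

Lemma stopped_ms_ge0 n phi H i : 0 <= stopped_ms n phi H i.
Proof.
elim: n phi H i => [|n ihn] phi H i /=; case: ifP => // _; first exact: (ms_ge0 al 0).
  exact: (ms_ge0 al n.+1).
by case: ifP.
Qed.

(** A block around the leaf either lies in a maximal stopped block, and is counted in [stopped_ms],
    or is a union of such blocks and of unstopped leaves, in which case stopping does not change its
    averages. *)
Lemma ms_le_stopped n phi (H : 'I_m -> nat -> R) i : (i < 2 ^ n)%N ->
  ms al n H i <= ms al n (fun j => stopped_avg n phi (H j)) i + stopped_ms n phi H i.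
Proof.
elim: n phi H i => [|n ihn] phi H i ilt.
  rewrite [stopped_ms _ _ _ _]/=; case: ifP => st; first by rewrite lerDr ms_ge0.
  rewrite addr0 le_eqVlt; apply/orP; left; apply/eqP; apply: eq_ms => // j k.
  by rewrite /= st ltnS leqn0 => /eqP ->.
have [st|/negbTE st] := boolP (stopped n.+1 phi).
  by rewrite [stopped_ms _ _ _ _]/= st lerDr ms_ge0.
rewrite [leLHS]/= ge_max; apply/andP; split.
  apply: (@le_trans _ _ (\prod_j avg n.+1 (stopped_avg n.+1 phi (H j)) `^ al j)).
    rewrite le_eqVlt; apply/orP; left; apply/eqP; apply: eq_bigr => j _.
    by rewrite avg_stopped_avg.
  by apply: (le_trans (avg_le_ms al n.+1 _ i)); rewrite lerDl stopped_ms_ge0.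
rewrite [stopped_ms _ _ _ _]/= st; case: ltnP => lt.
  apply: (le_trans (ihn phi H i lt)); rewrite lerD2r.
  rewrite [leRHS]/= lt le_max; apply/orP; right.
  rewrite le_eqVlt; apply/orP; left; apply/eqP; apply: eq_ms => // j k klt.
  by rewrite st klt.
have lt' : (i - 2 ^ n < 2 ^ n)%N by rewrite ltn_subLR// addnn -mul2n -expnS.
apply: (le_trans (ihn (fun j => upper_half n (phi j)) (fun j => upper_half n (H j)) _ lt')).
rewrite lerD2r [leRHS]/= ltnNge lt/= le_max; apply/orP; right.
rewrite le_eqVlt; apply/orP; left; apply/eqP; apply: eq_ms => // j k klt.
by rewrite [RHS]/upper_half st ltn_upper_half addKn.
Qed.

(** The weak-type estimate: Markov's inequality for each j and a union bound. Where [lam j = 0] the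
    j-th term is 0, because the inverse of 0 is 0; the second hypothesis ensures that such a j never
    causes a stop. *)
Lemma avg_in_stopped n phi : (forall j i, 0 <= phi j i) ->
  (forall j, lam j = 0 -> avg n (phi j) = 0) ->
  avg n (fun i => (in_stopped n phi i)%:R) <= \sum_j avg n (phi j) * (A * lam j)^-1.
Proof.
have A0 : 0 < A by exact: lt_le_trans A1.
have term0 n' (p : 'I_m -> nat -> R) j : (forall j i, 0 <= p j i) ->
    0 <= avg n' (p j) * (A * lam j)^-1.
  by move=> p0; rewrite mulr_ge0 ?avg_ge0// invr_ge0 mulr_ge0// ltW.
elim: n phi => [|n ihn] phi phi0 z.
  have [st|/negbTE st] := boolP (stopped 0 phi); last first.
    by rewrite /= st sumr_ge0// => j _; exact: (term0 0%N).
  rewrite /= st; move/existsP: st => [j ltj].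
  have lamj : lam j != 0.
    by apply: contraTneq ltj => l0; rewrite l0 mulr0 z// ltxx.
  rewrite (bigD1 j)//= -[leLHS]addr0 lerD//; last first.
    by rewrite sumr_ge0// => k _; exact: (term0 0%N).
  by rewrite ler_pdivlMr ?mul1r ?(ltW ltj)// mulr_gt0// lt0r lamj lam0.
have [st|/negbTE st] := boolP (stopped n.+1 phi).
  rewrite (@eq_avg _ n.+1 _ (fun=> 1)); last by move=> i _; rewrite /= st.
  rewrite avg_cst; move/existsP: st => [j ltj].
  have lamj : lam j != 0.
    by apply: contraTneq ltj => l0; rewrite l0 mulr0 z// ltxx.
  rewrite (bigD1 j)// -[leLHS]addr0 lerD//; last first.
    by rewrite sumr_ge0// => k _; exact: term0.
  by rewrite ler_pdivlMr ?mul1r ?(ltW ltj)// mulr_gt0// lt0r lamj lam0.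
have phi0' j i : 0 <= upper_half n (phi j) i by exact: phi0.
have zc j : lam j = 0 -> avg n (phi j) = 0 /\ avg n (upper_half n (phi j)) = 0.
  move=> /z /= h; have := avg_ge0 n (phi0 j); have := avg_ge0 n (phi0' j).
  by move=> ? ?; split; lra.
have h1 := ihn phi phi0 (fun j l0 => (zc j l0).1).
have h2 := ihn _ phi0' (fun j l0 => (zc j l0).2).
rewrite [leLHS]/= st /=.
rewrite (@eq_avg _ n _ (fun i => (in_stopped n phi i)%:R)); last by move=> i ->.
rewrite (@eq_avg _ n (upper_half n _) (fun i => (in_stopped n (fun j => upper_half n (phi j)) i)%:R)); last first.
  by move=> i ilt; rewrite [LHS]/upper_half ltn_upper_half addKn.
rewrite (eq_bigr (fun j => (avg n (phi j) * (A * lam j)^-1 +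
    avg n (upper_half n (phi j)) * (A * lam j)^-1) / 2)); last first.
  by move=> j _; rewrite -mulrDl mulrAC.
by rewrite -mulr_suml big_split/= ler_wpM2r// lerD.
Qed.

Section norms.
Context (S : sfspace R).
Local Open Scope ereal_scope.

Lemma mnn_EFin (f : S -> R) : measurable_fun setT f -> (forall w, 0 <= f w)%R ->
  mnn (EFin \o f).
Proof. by move=> mf f0; split=> [|w]; [exact/measurable_EFinP|rewrite lee_fin]. Qed.

Lemma mnn_EFin_meas (f : S -> R) : mnn (EFin \o f) -> measurable_fun setT f.
Proof. by move=> [mf _]; exact/measurable_EFinP. Qed.

Lemma mnn_EFin_ge0 (f : S -> R) w : mnn (EFin \o f) -> (0 <= f w)%R.
Proof. by move=> [_ /(_ w)]; rewrite lee_fin. Qed.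

Lemma mnn_avg n (h : nat -> S -> R) : (forall i, mnn (EFin \o h i)) ->
  mnn (EFin \o (fun w => avg n (h ^~ w))).
Proof.
move=> mh; apply: mnn_EFin => [|w]; last first.
  by apply: avg_ge0 => i; exact: mnn_EFin_ge0 (mh i).
elim: n h mh => [|n ihn] h mh /=; first exact: mnn_EFin_meas.
apply: measurable_funM => //; apply: measurable_funD; first exact: ihn.
exact: (ihn (upper_half n h) (fun i => mh _)).
Qed.

Lemma mnn_ms n (H : 'I_m -> nat -> S -> R) i : (forall j i, mnn (EFin \o H j i)) ->
  mnn (EFin \o (fun w => ms al n (fun j k => H j k w) i)).
Proof.
move=> mH; apply: mnn_EFin => [|w]; last exact: ms_ge0.
have mP k (H' : 'I_m -> nat -> S -> R) : (forall j i, mnn (EFin \o H' j i)) ->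
    measurable_fun setT (fun w => \prod_j avg k (fun i => H' j i w) `^ al j)%R.
  move=> mH'; apply: measurable_prod => j _.
  apply: (@measurableT_comp _ _ _ _ _ _ (fun x : R => x `^ al j)%R).
    exact: measurable_powR.
  exact/mnn_EFin_meas/mnn_avg.
elim: n H i mH => [|n ihn] H i mH; apply: measurable_maxr; try exact: (mP _ H mH).
  exact: measurable_cst.
case: ltnP => lt; first exact: ihn.
exact: (ihn (fun j => upper_half n (H j)) _ (fun j k => mH _ _)).
Qed.

Lemma mnn_stopped_ms n phi (H : 'I_m -> nat -> S -> R) i :
  (forall j i, mnn (EFin \o H j i)) ->
  mnn (EFin \o (fun w => stopped_ms n phi (fun j k => H j k w) i)).
Proof.
elim: n phi H i => [|n ihn] phi H i mH.
  have [st|/negbTE st] := boolP (stopped 0 phi); rewrite /= st.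
    exact: (mnn_ms 0).
  exact: mnn_cst.
have [st|/negbTE st] := boolP (stopped n.+1 phi).
  rewrite (_ : EFin \o _ = EFin \o (fun w => ms al n.+1 (fun j k => H j k w) i)).
    exact: mnn_ms.
  by apply/funext => w; rewrite /= st.
have [lt|lt] := ltnP i (2 ^ n)%N.
  rewrite (_ : EFin \o _ = EFin \o (fun w => stopped_ms n phi (fun j k => H j k w) i)); last first.
    by apply/funext => w; rewrite /= st lt.
  exact: ihn.
rewrite (_ : EFin \o _ = EFin \o (fun w => stopped_ms n (fun j => upper_half n (phi j))
    (fun j k => upper_half n (H j) k w) (i - 2 ^ n)%N)); last first.
  by apply/funext => w; rewrite /= st ltnNge lt.
exact: (ihn _ (fun j => upper_half n (H j)) _ (fun j k => mH _ _)).
Qed.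

Lemma mnn_stopped_avg n phi (h : nat -> S -> R) i : (forall i, mnn (EFin \o h i)) ->
  mnn (EFin \o (fun w => stopped_avg n phi (h ^~ w) i)).
Proof.
elim: n phi h i => [|n ihn] phi h i mh.
  rewrite (_ : EFin \o _ = EFin \o h 0%N); first exact: mh.
  by apply/funext => w /=; case: ifP.
have [st|/negbTE st] := boolP (stopped n.+1 phi).
  rewrite (_ : EFin \o _ = EFin \o (fun w => avg n.+1 (h ^~ w))); first exact: mnn_avg.
  by apply/funext => w; rewrite /= st.
have [lt|lt] := ltnP i (2 ^ n)%N.
  rewrite (_ : EFin \o _ = EFin \o (fun w => stopped_avg n phi (h ^~ w) i)); first exact: ihn.
  by apply/funext => w; rewrite /= st lt.
rewrite (_ : EFin \o _ = EFin \o (fun w => stopped_avg n (fun j => upper_half n (phi j))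
    (upper_half n h ^~ w) (i - 2 ^ n)%N)); last first.
  by apply/funext => w; rewrite /= st ltnNge lt.
exact: (ihn _ (upper_half n h) _ (fun k => mh _)).
Qed.

Variable N : (S -> \bar R) -> \bar R.
Hypotheses (FN : fnorm N)
  (ND : forall f g, mnn f -> mnn g -> N (fun w => f w + g w) <= N f + N g).

Lemma norm_avg_le n (h : nat -> S -> R) (phi : nat -> R) :
  (forall i, mnn (EFin \o h i)) -> (forall i, N (EFin \o h i) = (phi i)%:E) ->
  N (EFin \o (fun w => avg n (h ^~ w))) <= (avg n phi)%:E.
Proof.
elim: n h phi => [|n ihn] h phi mh hphi.
  by rewrite [leRHS]/= -hphi.
have m1 := mnn_avg n mh; have m2 := mnn_avg n (h := upper_half n h) (fun i => mh _).
have -> : EFin \o (fun w => avg n.+1 (h ^~ w)) = (fun w => (2^-1)%:E *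
    ((EFin \o (fun w => avg n (h ^~ w))) w +
     (EFin \o (fun w => avg n (fun i => upper_half n h i w))) w)).
  by apply/funext => w /=; rewrite -EFinD -EFinM mulrC.
rewrite (fn_Z FN)//; last exact: mnnD.
rewrite /= mulrC EFinM; apply: lee_wpmul2l; first by rewrite lee_fin.
apply: (le_trans (ND m1 m2)); rewrite EFinD; apply: leeD; first exact: ihn.
exact: (ihn (upper_half n h) (upper_half n phi) (fun i => mh _) (fun i => hphi _)).
Qed.

(** The parent of a maximal stopped block is not stopped, so its averages are at most [A * lam j],
    and those of its halves at most twice that. The last hypothesis starts this at the root. *)
Lemma norm_stopped_avg_le n (phi : 'I_m -> nat -> R) (h : nat -> S -> R) i0 j :
  (forall i, mnn (EFin \o h i)) -> (forall i, N (EFin \o h i) = (phi j i)%:E) ->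
  (forall j i, 0 <= phi j i)%R -> (forall j, avg n (phi j) <= 2 * (A * lam j))%R ->
  N (EFin \o (fun w => stopped_avg n phi (h ^~ w) i0)) <= (2 * (A * lam j))%:E.
Proof.
have Al0 k : (0 <= A * lam k)%R by rewrite mulr_ge0// (le_trans _ A1).
elim: n phi h i0 => [|n ihn] phi h i0 mh hphi phi0 avgle.
  rewrite (_ : EFin \o _ = EFin \o h 0%N); last first.
    by apply/funext => w /=; case: ifP.
  by rewrite hphi lee_fin; exact: (avgle j).
have [st|/negbTE st] := boolP (stopped n.+1 phi).
  rewrite (_ : EFin \o _ = EFin \o (fun w => avg n.+1 (h ^~ w))); last first.
    by apply/funext => w; rewrite [LHS]/= st.
  by apply: (le_trans (norm_avg_le n.+1 mh hphi)); rewrite lee_fin.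
have phi0' k i : (0 <= upper_half n (phi k) i)%R by exact: phi0.
have avgn k : (avg n.+1 (phi k) <= A * lam k)%R.
  by rewrite leNgt; move/negbT/existsPn: st; apply.
have avg1 k : (avg n (phi k) <= 2 * (A * lam k))%R.
  have /= := avgn k; have := avg_ge0 n (phi0' k); lra.
have avg2 k : (avg n (upper_half n (phi k)) <= 2 * (A * lam k))%R.
  have /= := avgn k; have := avg_ge0 n (phi0 k); lra.
rewrite /= st; case: ltnP => lt; first exact: ihn.
exact: (ihn (fun j => upper_half n (phi j)) (upper_half n h) _ (fun k => mh _) (fun k => hphi _)).
Qed.

End norms.

End stopping.

Section extrapolation.
Context {R : realType} (S : sfspace R) (m : nat) (al : 'I_m -> R)
  (N : 'I_m -> (S -> \bar R) -> \bar R).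
Hypotheses (m0 : (0 < m)%N) (al0 : forall j, (0 < al j)%R)
  (FN : forall j, fnorm (N j))
  (ND : forall j f g, mnn f -> mnn g ->
    (N j (fun w => f w + g w) <= N j f + N j g)%E).
Local Open Scope ereal_scope.
Local Notation lf n := (leaf (R := R) (2 ^ n)).

Definition int_ms n (H : 'I_m -> nat -> S -> R) : \bar R :=
  tsum n (fun i => \int[sf_mu S]_w (ms al n (fun j k => H j k w) i)%:E).

(* Boundedness of the dyadic multisublinear maximal function from the spaces
   L^(1/b_j)(leaves; N_j) to L^1, uniformly in the depth of the tree. *)
Definition dyadic_bounded (b : 'I_m -> R) : Prop :=
  exists2 C : R, (0 <= C)%R & forall n (H : 'I_m -> nat -> S -> R),
    (forall j i, mnn (EFin \o H j i)) -> (forall j i, N j (EFin \o H j i) < +oo) ->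
    int_ms n H <= C%:E * \prod_j
      nm (S := lf n) (b j) (fun i => N j (EFin \o H j i)) `^ al j.

(** The estimate with the exponents eliminated, stated for one depth at a time because it is proved
    by strong induction on the depth. *)
Let claim (C : R) n := forall (H : 'I_m -> nat -> S -> R) (phi : 'I_m -> nat -> R),
  (forall j i, mnn (EFin \o H j i)) ->
  (forall j i, N j (EFin \o H j i) = (phi j i)%:E) ->
  int_ms n H <= C%:E * qmax al n phi.

(** Apply the claim on each maximal stopped block, viewed as a tree of its own; the maximal
    functions of a block are at most those of the whole tree. The hypothesis at depth n only serves
    a stopped root. *)
Let stopped_ms_sum (A C : R) lam n (H : 'I_m -> nat -> S -> R) phi : (0 <= C)%R ->
  (forall k, (k < n)%N -> claim C k) -> (stopped A lam n phi -> claim C n) ->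
  (forall j i, mnn (EFin \o H j i)) ->
  (forall j i, N j (EFin \o H j i) = (phi j i)%:E) ->
  tsum n (fun i => \int[sf_mu S]_w (stopped_ms al A lam n phi (fun j k => H j k w) i)%:E) <=
  C%:E * tsum n (fun i => if in_stopped A lam n phi i then
    (\prod_j dmax n (phi j) i `^ al j)%:E else 0).
Proof.
move=> C0; elim: n H phi => [|n ihn] H phi cl cln mH hphi.
  have [st|/negbTE st] := boolP (stopped A lam 0 phi); rewrite /= st /=.
    exact: (cln st H phi mH hphi).
  by rewrite (@integral0 _ _ _ (sf_mu S)) mule0.
have [st|/negbTE st] := boolP (stopped A lam n.+1 phi).
  rewrite (@eq_tsum _ n.+1 _ (fun i => \int[sf_mu S]_w
    (ms al n.+1 (fun j k => H j k w) i)%:E)); last first.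
    by move=> i _; apply: eq_integral => w _; rewrite [in LHS]/= st.
  rewrite (@eq_tsum _ n.+1 (fun i => if _ then _ else _) (fun i =>
    (\prod_j dmax n.+1 (phi j) i `^ al j)%:E)); last by move=> i _; rewrite /= st.
  exact: (cln st H phi mH hphi).
have phi0 j i : (0 <= phi j i)%R by rewrite -lee_fin -hphi (fn_ge0 (FN j)).
have cl' k : (k < n)%N -> claim C k by move=> kn; apply: cl; exact: leqW.
have g0 (c : bool) (u : R) : (0 <= u)%R -> 0 <= (if c then u%:E else 0).
  by move=> u0; case: c => //; rewrite lee_fin.
have d0 i : (0 <= \prod_j dmax n.+1 (phi j) i `^ al j)%R.
  by apply: prodr_ge0 => j _; exact: powR_ge0.
have h1 := ihn H phi cl' (fun=> cl n (leqnn _)) mH hphi.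
have h2 := ihn (fun j => upper_half n (H j)) (fun j => upper_half n (phi j)) cl' (fun=> cl n (leqnn _))
  (fun j i => mH _ _) (fun j i => hphi _ _).
have lt1 i : (i < 2 ^ n -> i < 2 ^ n.+1)%N.
  by move=> /leq_trans; apply; rewrite leq_exp2l.
rewrite [tsum n.+1 _]/= [X in _ * X]/=.
rewrite ge0_muleDr; last 2 first.
- by apply: tsum_ge0 => i; exact/g0/d0.
- by apply: tsum_ge0 => i; exact/g0/d0.
apply: leeD.
  rewrite (@eq_tsum _ n _ (fun i => \int[sf_mu S]_w
    (stopped_ms al A lam n phi (fun j k => H j k w) i)%:E)); last first.
    by move=> i ilt; apply: eq_integral => w _; rewrite st ilt.
  apply: (le_trans h1); apply: lee_wpmul2l; first by rewrite lee_fin.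
  apply: le_tsum => i ilt; rewrite st ilt/=; case: ifP => // _; rewrite lee_fin.
  apply: le_prod_powR => // j; first exact: dmax_ge0.
  by rewrite le_max lexx orbT.
rewrite (@eq_tsum _ n (upper_half n _) (fun i => \int[sf_mu S]_w
    (stopped_ms al A lam n (fun j => upper_half n (phi j)) (fun j k => upper_half n (H j) k w) i)%:E)); last first.
  by move=> i ilt; rewrite /upper_half; apply: eq_integral => w _; rewrite st ltn_upper_half addKn.
apply: (le_trans h2); apply: lee_wpmul2l; first by rewrite lee_fin.
apply: le_tsum => i ilt; rewrite [leRHS]/upper_half st ltn_upper_half addKn/=; case: ifP => // _.
rewrite lee_fin; apply: le_prod_powR => // j; first by apply: dmax_ge0 => k; exact: phi0.
by rewrite le_max lexx orbT.
Qed.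

(** Stopping splits the maximal function in two. The stopped averages [G] have norms bounded by
    multiples of the global averages [lam j], so the hypothesis bounds their part by a multiple of
    2^n times the product of the lam_j^al_j. The rest lives on stopped blocks, which are trees of
    smaller depth. *)
Lemma extrapolation b : (forall j, 0 <= b j < 1)%R -> (\sum_j al j * b j = 1)%R ->
  dyadic_bounded b -> exists2 C : R, (0 <= C)%R & forall n, claim C n.
Proof.
move=> b01 alb [C C0 CP].
have b0 j : (0 <= b j)%R by case/andP: (b01 j).
(* Each of the m terms of the weak-type estimate is then at most 1 / (2 m), so at most half of the
   leaves are stopped. *)
pose A : R := (2 * m%:R)%R; have m1 : (1 <= m%:R :> R)%R by rewrite ler1n.
have A1 : (1 <= A)%R by rewrite /A; lra.
have A0 : (0 < A)%R by exact: lt_le_trans A1.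
pose cA := (\prod_j (2 * A) `^ al j)%R.
have cA0 : (0 <= cA)%R by apply: prodr_ge0 => j _; exact: powR_ge0.
(* [cA] collects the factors 2 A in the norms of the stopped averages; the 2 compensates for the
   stopped half of the leaves. *)
exists (2 * C * cA)%R; first by rewrite !mulr_ge0.
set C2 := (2 * C * cA)%R; have C20 : (0 <= C2)%R by rewrite !mulr_ge0.
move=> n; elim/ltn_ind: n => n ihn H phi mH hphi.
have phi0 j i : (0 <= phi j i)%R by rewrite -lee_fin -hphi (fn_ge0 (FN j)).
pose lam j := avg n (phi j).
have lam0 j : (0 <= lam j)%R by exact: avg_ge0.
(* As A >= 1 the root is not stopped, so the induction hypothesis is used for proper blocks only. *)
have rst : stopped A lam n phi = false.
  apply/negbTE/existsPn => j; rewrite -leNgt -/(lam j).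
  by rewrite ler_peMl.
pose G j i w := stopped_avg A lam n phi (fun k => H j k w) i.
have mG j i : mnn (EFin \o G j i) by exact: mnn_stopped_avg.
have GN j i : N j (EFin \o G j i) <= (2 * (A * lam j))%:E.
  apply: (norm_stopped_avg_le A1 lam0 (FN j) (@ND j) _ (mH j) (hphi j) phi0) => k.
  rewrite -/(lam k); have h1 : (lam k <= A * lam k)%R by rewrite ler_peMl.
  by have := lam0 k; lra.
have Goo j i : N j (EFin \o G j i) < +oo by apply: le_lt_trans (GN j i) _; rewrite ltry.
pose mx i := (\prod_j dmax n (phi j) i `^ al j)%R.
have mx0 i : (0 <= mx i)%R by apply: prodr_ge0 => j _; exact: powR_ge0.
pose good i := (if in_stopped A lam n phi i then 0 else (mx i)%:E) : \bar R.
pose bad i := (if in_stopped A lam n phi i then (mx i)%:E else 0) : \bar R.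
have good0 i : 0 <= good i by rewrite /good; case: ifP => _; rewrite ?lee_fin.
have bad0 i : 0 <= bad i by rewrite /bad; case: ifP => _; rewrite ?lee_fin.
have qE : qmax al n phi = tsum n good + tsum n bad.
  rewrite -tsumD; apply: eq_tsum => i _; rewrite /good /bad.
  by case: ifP => _; rewrite ?adde0 ?add0e.
pose sRw i w := stopped_ms al A lam n phi (fun j k => H j k w) i.
have msR i : mnn (EFin \o sRw i) by exact: mnn_stopped_ms.
have step1 : int_ms n H <= int_ms n G + tsum n (fun i => \int[sf_mu S]_w (sRw i w)%:E).
  rewrite -tsumD; apply: le_tsum => i ilt.
  have mM := mnn_ms al n i mG.
  rewrite -ge0_integralD//; last 4 first.
  - by move=> w _; exact: mM.2.
  - exact: mM.1.
  - by move=> w _; exact: (msR i).2.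
  - exact: (msR i).1.
  apply: le_int; first exact: (mnn_ms al n i mH).
    exact: mnnD mM (msR i).
  by apply: nearW => w; rewrite -EFinD lee_fin; exact: ms_le_stopped.
have bad_le : tsum n (fun i => \int[sf_mu S]_w (sRw i w)%:E) <= C2%:E * tsum n bad.
  by apply: (stopped_ms_sum C20 ihn _ mH hphi); rewrite rst.
have lamz j : lam j = 0%R -> avg n (phi j) = 0%R by [].
have mark_le : (avg n (fun i => (in_stopped A lam n phi i)%:R) <= 2^-1 :> R)%R.
  apply: (le_trans (avg_in_stopped A1 lam0 phi0 lamz)).
  apply: (@le_trans _ _ (\sum_(j < m) A^-1)%R); last first.
    rewrite sumr_const card_ord -[leLHS]mulr_natr /A.
    rewrite le_eqVlt; apply/orP; left; apply/eqP; field.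
    by rewrite gt_eqF// (lt_le_trans _ m1).
  apply: ler_sum => j _; rewrite -/(lam j); have [->|l0] := eqVneq (lam j) 0%R.
    by rewrite mul0r invr_ge0 ltW.
  by rewrite invfM mulrCA mulfV// mulr1.
pose L := (\prod_j lam j `^ al j)%R.
have L0 : (0 <= L)%R by apply: prodr_ge0 => j _; exact: powR_ge0.
(* At least half of the leaves are unstopped, and at each of them the maximal functions are at least
   the global averages. *)
have good_le : ((2 ^ n)%:R * L)%:E <= 2%:E * tsum n good.
  apply: (@le_trans _ _ (2%:E * tsum n (EFin \o (fun i => L * (1 - (in_stopped A lam n phi i)%:R))%R))).
    rewrite tsum_EFin avgZ avgD avg_cst -EFinM lee_fin.
    rewrite (_ : avg n _ = - avg n (fun i => (in_stopped A lam n phi i)%:R : R))%R; last first.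
      by rewrite -mulN1r -avgZ; apply: eq_avg => i _; rewrite mulN1r.
    have n20 : (0 <= (2 ^ n)%:R * L)%R by rewrite mulr_ge0.
    nra.
  apply: lee_wpmul2l => //; apply: le_tsum => i ilt; rewrite /good /=.
  case: ifP => st; first by rewrite subrr mulr0.
  rewrite subr0 mulr1 lee_fin; apply: le_prod_powR => // j; exact: avg_le_dmax.
have n2 : (0 < (2 ^ n)%:R :> R)%R by rewrite ltr0n expn_gt0.
have mint_le : int_ms n G <= C2%:E * tsum n good.
  apply: (le_trans (CP n G mG Goo)).
  apply: (@le_trans _ _ (C%:E * \prod_j (2 * (A * lam j) * (2 ^ n)%:R `^ b j)%:E `^ al j)).
    apply: lee_wpmul2l; first by rewrite lee_fin.
    apply: lee_prod => j; first exact: poweR_ge0.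
    have Alam0 : (0 <= 2 * (A * lam j))%R by rewrite !mulr_ge0// ltW.
    apply: le_poweR; [exact: ltW|exact: nm_ge0|].
    apply: (@le_trans _ _ (nm (S := lf n) (b j) (fun=> (2 * (A * lam j))%:E * 1))).
      apply: le_nm => //; first by apply: mnn_leaf => i; exact: (fn_ge0 (FN j)).
        by apply: mnn_leaf => i; rewrite mule1 lee_fin.
      by apply: nearW => i; rewrite mule1.
    rewrite nmZ// [leRHS]EFinM.
    by apply: lee_wpmul2l; [rewrite lee_fin|exact: nm_leaf_cst].
  (* The constant 1 on the leaves has norm at most 2^(n b_j); raised to the powers al_j, these
     factors multiply to 2^n because the sum of the al_j b_j is 1. *)
  rewrite (eq_bigr (fun j => ((2 * A) `^ al j * lam j `^ al j * (2 ^ n)%:R `^ (al j * b j))%:E)); last first.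
    move=> j _; rewrite poweR_EFin !powRM// ?mulr_ge0 ?powR_ge0// ?(ltW A0)//.
    by rewrite -!powRrM [(b j * _)%R]mulrC !mulrA.
  rewrite prod_EFin -EFinM !big_split/= -/cA -/L.
  rewrite -[X in (_ * (_ * X))%R](_ : (2 ^ n)%:R `^ (\sum_j al j * b j) = _)%R; last first.
    by rewrite prod_powR_sum.
  rewrite alb powRr1; last exact: ltW.
  rewrite [leLHS](_ : _ = (C * cA)%:E * ((2 ^ n)%:R * L)%:E); last first.
    by rewrite -EFinM; congr EFin; ring.
  rewrite [C2](_ : _ = (C * cA) * 2)%R; last by rewrite /C2; ring.
  rewrite [(_ * 2)%:E]EFinM -muleA; apply: lee_wpmul2l => //.
  by rewrite lee_fin mulr_ge0.
apply: (le_trans step1); rewrite qE ge0_muleDr; last 2 first.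
- exact: tsum_ge0.
- exact: tsum_ge0.
exact: leeD.
Qed.

End extrapolation.

Section dyadic_bounded.
Context {R : realType} (m : nat) (al : 'I_m -> R).
Hypotheses (m0 : (0 < m)%N) (al0 : forall j, (0 < al j)%R).
Local Open Scope ereal_scope.

(** The strict bound puts the exponents 1 / b_j in the range of Doob's inequality; the sum makes L^1
    the target of Hoelder's inequality. *)
Definition admissible (b : 'I_m -> R) :=
  (forall j, 0 <= b j < 1)%R /\ (\sum_j al j * b j = 1)%R.

(** [qmax] is reached with the exponents [b], by extrapolation, and left with the exponents [b'], by
    [qmax_bound]. *)
Lemma dyadic_bounded_change (S : sfspace R) (N : 'I_m -> (S -> \bar R) -> \bar R)
    b b' : (forall j, fnorm (N j)) ->
  (forall j f g, mnn f -> mnn g -> N j (fun w => f w + g w) <= N j f + N j g) ->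
  admissible b -> admissible b' ->
  dyadic_bounded al N b -> dyadic_bounded al N b'.
Proof.
move=> FN ND [b01 alb] [b01' alb'] /(extrapolation m0 al0 FN ND b01 alb)[C C0 CP].
have [C' C'0 CP'] := qmax_bound al0 b01' alb'.
exists (C * C')%R; first by rewrite mulr_ge0.
move=> n H mH Hoo; pose phi j i := fine (N j (EFin \o H j i)).
have hphi j i : N j (EFin \o H j i) = (phi j i)%:E.
  by rewrite fineK// ge0_fin_numE// (fn_ge0 (FN j)).
apply: (le_trans (CP n H phi mH hphi)); rewrite EFinM -muleA.
apply: lee_wpmul2l; first by rewrite lee_fin.
have phi0 j i : (0 <= phi j i)%R by rewrite fine_ge0// (fn_ge0 (FN j)).
apply: (le_trans (CP' n phi phi0)); rewrite le_eqVlt; apply/orP; left; apply/eqP.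
congr (_ * _); apply: eq_bigr => j _; congr (nm _ _ `^ _).
by apply/funext => i /=; rewrite hphi.
Qed.

(** For fixed w the values are scalars, and the maximal function is at most a product of powers of
    dyadic maximal functions; the bound is then integrated over w. *)
Lemma dyadic_bounded_nm (S : sfspace R) b : admissible b ->
  dyadic_bounded al (fun j => nm (S := S) (b j)) b.
Proof.
move=> [b01 alb]; have [C C0 CP] := qmax_bound al0 b01 alb.
exists C => // n H mH _.
apply: (bd_lift (psi := fun j i w => (H j i w)%:E) al0 b01 alb C0) => //.
  by move=> i; exact: mnn_ms.
apply: nearW => w.
have H0 j i : (0 <= H j i w)%R by exact: mnn_EFin_ge0 (mH j i).
apply: le_trans (CP n (fun j i => H j i w) H0).
by apply: le_tsum => i _; rewrite lee_fin; exact: ms_le_dmax.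
Qed.

Lemma dyadic_bounded_mix (S1 S2 : sfspace R)
    (N : 'I_m -> (S2 -> \bar R) -> \bar R) b : (forall j, fnorm (N j)) ->
  admissible b -> dyadic_bounded al N b ->
  dyadic_bounded al (fun j => mixn (S1 := S1) (b j) (N j)) b.
Proof.
move=> FN [b01 alb] [C C0 CP]; exists C => // n H mH Hoo.
have b0 j : (0 <= b j)%R by case/andP: (b01 j).
have mms i := mnn_ms al n i mH.
have mpsi j i : mnn (fun w1 => N j (fun w2 => (H j i (w1, w2))%:E)).
  exact: (fn_meas (FN j) (mH j i)).
rewrite /int_ms (@eq_tsum _ n _ (fun i => \int[sf_mu S1]_w1 \int[sf_mu S2]_w2
   (ms al n (fun j k => H j k (w1, w2)) i)%:E)); last first.
  by move=> i _; exact: (int_prod (mms i)).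
apply: (bd_lift (psi := fun j i w1 => N j (fun w2 => (H j i (w1, w2))%:E)) al0 b01 alb C0) => //.
  by move=> i; exact: (mnn_int (mms i)).
have fin : \forall w1 \ae sf_mu S1, forall i j, N j (fun w2 => (H j i (w1, w2))%:E) < +oo.
  apply/ae_foralln => i; apply: filter_forall => j.
  exact: (nm_fin (b0 j) (mpsi j i) (Hoo j i)).
apply: filterS fin => w1 fin; apply: CP => j i; last exact: fin.
exact: (mnn_pair2 (T := S1) (T' := S2) w1 (mH j i)).
Qed.

(** The induction hypothesis is used with the exponents of the outermost space on the tree, so that
    this space can be attached; only then are they changed to [b]. *)
Lemma dyadic_bounded_iN K (Om : 'I_K.+1 -> sfspace R) (u : 'I_m -> 'I_K.+1 -> R) b :
  (forall k, admissible (u ^~ k)) -> admissible b ->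
  dyadic_bounded al (fun j => iN (Om := Om) (u j)) b.
Proof.
elim: K Om u b => [|K ihK] Om u b adu adb.
  have u01 j : (0 <= u j ord0 <= 1)%R.
    by have [/(_ j)/andP[-> /ltW ->]] := adu ord0.
  apply: dyadic_bounded_change (adu ord0) adb (dyadic_bounded_nm _ (adu ord0)).
    by move=> j; apply: fnorm_nm; case/andP: (u01 j).
  move=> j f g mf mg; have u01' (k : 'I_1) : (0 <= u j k <= 1)%R by rewrite ord1.
  have [hi ni] := iN_dual Om u01'.
  apply: (minkowskiD _ hi ni mf mg); apply: fnorm_iN => k.
  by case/andP: (u01' k).
have u01 j k : (0 <= u j k <= 1)%R.
  by have [/(_ j)/andP[-> /ltW ->]] := adu k.
have u0 j k : (0 <= u j k)%R by case/andP: (u01 j k).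
apply: (@dyadic_bounded_change _ _ (u ^~ ord0)) => //.
- by move=> j; exact: fnorm_iN.
- move=> j f g mf mg; have [hi ni] := iN_dual Om (u01 j).
  by apply: (minkowskiD _ hi ni mf mg); exact: fnorm_iN.
- apply: dyadic_bounded_mix => //; first by move=> j; exact: fnorm_iN.
  by apply: ihK => // k; exact: (adu (lift ord0 k)).
Qed.

End dyadic_bounded.

(** * From the line to dyadic trees *)

Section cells.
Context {R : realType} (c h : R).
Hypothesis h0 : 0 < h.
Local Notation mu := (sf_mu (line R)).
Local Notation lf n := (leaf (R := R) (2 ^ n)).

Definition cell (i : nat) : set R := [set` `[c + h * i%:R, c + h * i.+1%:R[].

Lemma cellP i x : cell i x <-> c + h * i%:R <= x < c + h * i.+1%:R.
Proof. by rewrite /cell/= in_itv. Qed.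

Lemma cell_measurable i : measurable (cell i : set (line R)).
Proof. exact: measurable_itv. Qed.

Lemma cell_measure i : mu (cell i) = h%:E.
Proof.
rewrite [LHS](@lebesgue_measure_itv R) /= lte_fin ltrD2l ltr_pM2l// ltr_nat ltnSn.
by rewrite -EFinB; congr EFin; rewrite -natr1; ring.
Qed.

Lemma cell_index x : c <= x -> cell (Num.truncn ((x - c) / h)) x.
Proof.
move=> cx; apply/cellP.
have x0 : 0 <= (x - c) / h by rewrite divr_ge0 ?subr_ge0// ltW.
have /andP[] := truncn_itv x0; rewrite ler_pdivlMr// ltr_pdivrMr// => le lt.
by rewrite -lerBrDl -ltrBlDl ![h * _]mulrC le lt.
Qed.

Lemma cell_uniq i j x : cell i x -> cell j x -> i = j.
Proof.
have H a b : c + h * a%:R <= x -> x < c + h * b.+1%:R -> (a <= b)%N.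
  move=> h1 h2; have := le_lt_trans h1 h2.
  by rewrite ltrD2l ltr_pM2l// ltr_nat ltnS.
move=> /cellP/andP[i1 i2] /cellP/andP[j1 j2].
by apply/eqP; rewrite eqn_leq (H i j)// (H j i).
Qed.

Local Open Scope ereal_scope.

Definition cavg (F : line R -> \bar R) (i : nat) : \bar R :=
  (h^-1)%:E * \int[mu]_x (F x * (\1_(cell i) x)%:E).

Lemma mnn_cell F i : mnn F ->
  mnn (fun x : line R => F x * (\1_(cell i) x)%:E : \bar R).
Proof. by move=> mF; apply: mnnM => //; exact: mnn_indic (cell_measurable i). Qed.

Lemma cavg_ge0 F i : mnn F -> 0 <= cavg F i.
Proof.
move=> mF; apply: mule_ge0; first by rewrite lee_fin invr_ge0 ltW.
by apply: integral_ge0 => x _; exact: (mnn_cell i mF).2.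
Qed.

Lemma nm_cell a i : (0 < a)%R ->
  nm (S := line R) a (fun x => (\1_(cell i) x)%:E) = (h `^ a)%:E.
Proof.
move=> a0; rewrite /nm gt_eqF//.
rewrite (eq_integral (fun x : line R => (\1_(cell i) x)%:E)); last first.
  move=> x _; rewrite indicE; case: (_ \in _); rewrite ?poweR1r// poweR0r//.
  by rewrite gt_eqF// invr_gt0.
rewrite (int_indic (S := line R)); last exact: cell_measurable.
by rewrite cell_measure.
Qed.

Lemma sum_cell n (x : R) : \sum_(i < n) (\1_(cell i) x)%:E <= 1 :> \bar R.
Proof.
have [[i ix]|nx] := pselect (exists i : 'I_n, cell i x).
  rewrite (bigD1 i)//= big1 ?adde0; first by rewrite indicE; case: (_ \in _).
  move=> j ji; rewrite indicE memNset// => jx; move/eqP: ji; apply.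
  exact/val_inj/(cell_uniq jx ix).
rewrite big1// => i _; rewrite indicE memNset// => ix.
by apply: nx; exists i.
Qed.

(** Hoelder's inequality on each cell, and disjointness of the cells: averaging over cells is a
    contraction on L^(1/b). The factor h^(-b) appears because each leaf has mass 1, whereas a cell
    has length h. *)
Lemma cavg_nm n b F : (0 <= b < 1)%R -> mnn F ->
  nm (S := lf n) b (cavg F) <= (h `^ (- b))%:E * nm (S := line R) b F.
Proof.
move=> /andP[b0 b1] mF; have b1' : (0 < 1 - b)%R by rewrite subr_gt0.
have step i : cavg F i <= (h `^ (- b))%:E *
    nm (S := line R) b (fun x => F x * (\1_(cell i) x)%:E).
  have mI : mnn (fun x : line R => (\1_(cell i) x)%:E : \bar R).
    exact: mnn_indic (cell_measurable i).
  have := nm_hoelder (S := line R) b0 (ltW b1') (mnn_cell i mF) mI.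
  rewrite subrKC nm1; last exact: mnnM (mnn_cell i mF) mI.
  rewrite nm_cell// (eq_integral (fun x : line R => F x * (\1_(cell i) x)%:E)); last first.
    move=> x _; rewrite indicE; case: (_ \in _) => /=; first by rewrite !mule1.
    by rewrite !mule0.
  move=> H; rewrite /cavg; apply: (@le_trans _ _ ((h^-1)%:E * _)).
    by apply: lee_wpmul2l H; rewrite lee_fin invr_ge0 ltW.
  rewrite muleCA muleC le_eqVlt; apply/orP; left; apply/eqP; congr (_ * _).
  rewrite -EFinM; congr EFin; rewrite -powR_inv1; last exact: ltW.
  rewrite -powRD; last by rewrite (gt_eqF h0) implybT.
  by congr (_ `^ _)%R; ring.
have hb0 : (0 <= h `^ (- b))%R by exact: powR_ge0.
have c0 i : 0 <= cavg F i by exact: cavg_ge0.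
have nF0 : 0 <= nm (S := line R) b F by exact: nm_ge0.
move: b0; rewrite le_eqVlt => /predU1P[bE|b0].
  rewrite -bE in step hb0 nF0 *; apply/nm0_leP; first by rewrite mule_ge0.
  apply: nearW => i; apply: (le_trans (step i)); apply: lee_wpmul2l => //.
  apply: le_nm => //; first exact: mnn_cell.
  apply: nearW => x; rewrite indicE; case: (_ \in _); rewrite ?mule1// mule0.
  exact: mF.2.
have bi : (0 <= b^-1)%R by rewrite invr_ge0 ltW.
rewrite /nm gt_eqF//; set J := \int[mu]_x _; have J0 : 0 <= J.
  by apply: integral_ge0 => x _; exact: poweR_ge0.
rewrite leaf_int; last by move=> i; exact: poweR_ge0.
apply: (@le_trans _ _ (((h^-1)%:E * J) `^ b)); last first.
  rewrite poweRM//; last by rewrite lee_fin invr_ge0 ltW.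
  by rewrite poweR_EFin -powR_inv1 ?(ltW h0)// -powRrM mulN1r.
apply: le_poweR; [exact: ltW|by apply: sume_ge0 => i _; exact: poweR_ge0|].
apply: (@le_trans _ _ (\sum_(i < 2 ^ n) ((h^-1)%:E *
    \int[mu]_x ((F x `^ b^-1) * (\1_(cell i) x)%:E)))).
  apply: lee_sum => i _; apply: (le_trans (le_poweR bi (c0 i) (step i))).
  rewrite poweRM ?nm_ge0 ?lee_fin// /nm gt_eqF// poweRK ?gt_eqF//; last first.
    by apply: integral_ge0 => x _; exact: poweR_ge0.
  rewrite poweR_EFin -powRrM mulNr mulfV ?gt_eqF// powR_inv1 ?(ltW h0)//.
  apply: lee_wpmul2l; first by rewrite lee_fin invr_ge0 ltW.
  rewrite le_eqVlt; apply/orP; left; apply/eqP; apply: eq_integral => x _.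
  rewrite indicE; case: (_ \in _); rewrite ?mule1// !mule0 poweR0r//.
  by rewrite gt_eqF// invr_gt0.
rewrite -ge0_sume_distrr; last first.
  move=> i _; apply: integral_ge0 => x _.
  by rewrite mule_ge0 ?poweR_ge0// lee_fin.
apply: lee_wpmul2l; first by rewrite lee_fin invr_ge0 ltW.
have mFb := mnn_poweR b^-1 mF.
rewrite -ge0_integral_sum//; last 2 first.
- by move=> i; exact: (mnn_cell i mFb).1.
- by move=> i x _; exact: (mnn_cell i mFb).2.
apply: (le_int (S := line R)) => //.
  split=> [|x]; last by apply: sume_ge0 => i _; exact: (mnn_cell i mFb).2.
  by apply: emeasurable_sum => i; exact: (mnn_cell i mFb).1.
apply: nearW => x; rewrite -ge0_sume_distrr; last by move=> i _; rewrite lee_fin.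
by rewrite -[leRHS]mule1; apply: lee_wpmul2l; [exact: mFb.2|exact: sum_cell].
Qed.

End cells.

Section grids.
Context {R : realType}.

Lemma natmul3_neq_exp2 (a b e : nat) : (3 * a != 3 * b + 2 ^ e)%N.
Proof.
apply/eqP => E; have : (3 %| 3 * b + 2 ^ e)%N by rewrite -E dvdn_mulr.
by rewrite dvdn_addr ?dvdn_mulr// Euclid_dvdX//.
Qed.

(* The one-third trick: endpoints of blocks of the same length [w] of two grids
   shifted by a third of [2 ^ e * w] are at distance at least [w / 3]. *)
Lemma grid_pick (w c p q : R) (e : nat) : 0 < w -> p < q -> 3 * (q - p) <= w ->
  c + w * 2 ^+ e / 3 <= p ->
  exists i : nat, (c + w * i%:R <= p /\ q <= c + w * i.+1%:R) \/
    (c + w * 2 ^+ e / 3 + w * i%:R <= p /\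
     q <= c + w * 2 ^+ e / 3 + w * i.+1%:R).
Proof.
move=> w0 pq lw; set c1 := c + _ => c1p.
have s0 : 0 <= w * 2 ^+ e / 3 by rewrite divr_ge0// mulr_ge0 ?exprn_ge0// ltW.
have c0p : c <= p by apply: le_trans c1p; rewrite lerDl.
have idx d : d <= p -> exists i : nat, d + w * i%:R <= p < d + w * i.+1%:R.
  move=> dp; exists (Num.truncn ((p - d) / w)); exact/cellP/cell_index.
have [i /andP[i1 i2]] := idx _ c0p; have [j /andP[j1 j2]] := idx _ c1p.
have [qi|qi] := leP q (c + w * i.+1%:R); first by exists i; left.
have [qj|qj] := leP q (c1 + w * j.+1%:R); first by exists j; right.
(* Both right endpoints now lie strictly between p and q, so they differ by less than w / 3.
   Multiplied by 3 / w, this says that the integers 3 i and 3 j + 2^e differ by less than 1, yet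
   they are distinct modulo 3. *)
exfalso; have /eqP := natmul3_neq_exp2 i j e; apply.
have e2 : (2 ^+ e : R) = (2 ^ e)%N%:R by rewrite natrX.
have E (a b : nat) : (a%:R < b%:R + 1 :> R) -> (a <= b)%N.
  by rewrite natr1 ltr_nat ltnS.
rewrite -!natr1 in i2 j2 qi qj; rewrite /c1 e2 in j1 j2 qj.
apply/eqP; rewrite eqn_leq; apply/andP; split; apply: E;
  rewrite natrD !natrM -(ltr_pM2l w0); lra.
Qed.

(** The interval is covered by the 2^k cells of one block, whose length is at most 6 times its
    own. *)
Lemma cover_avg (c h p q : R) (i k : nat) (F : line R -> \bar R) : 0 < h -> p < q ->
  mnn F -> c + h * (i * 2 ^ k)%:R <= p -> q <= c + h * (i.+1 * 2 ^ k)%:R ->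
  h * (2 ^ k)%:R <= 6 * (q - p) ->
  (forall l, (l < 2 ^ k)%N -> (cavg c h F (i * 2 ^ k + l) < +oo)%E) ->
  ((q - p)^-1%:E * \int[sf_mu (line R)]_(x in cube (p, q)) F x <=
   (6 * avg k (fun l => fine (cavg c h F (i * 2 ^ k + l))))%:E)%E.
Proof.
move=> h0 pq mF ip qi hk fin; have qp0 : 0 < q - p by rewrite subr_gt0.
set A := avg k _; have c0 l := cavg_ge0 c h0 (i * 2 ^ k + l) mF.
have A0 : 0 <= A by apply: avg_ge0 => l; rewrite fine_ge0.
have mC l := mnn_cell c h (i * 2 ^ k + l) mF.
have mQ : measurable (cube (p, q) : set (line R)) by exact: measurable_itv.
suff H : (\int[sf_mu (line R)]_(x in cube (p, q)) F x <= (h * (2 ^ k)%:R * A)%:E)%E.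
  apply: (@le_trans _ _ ((q - p)^-1%:E * (h * (2 ^ k)%:R * A)%:E)%E).
    by apply: lee_wpmul2l H; rewrite lee_fin invr_ge0 ltW.
  rewrite -EFinM lee_fin mulrA ler_wpM2r//.
  by rewrite mulrC ler_pdivrMr.
rewrite [leLHS](_ : _ = \int[sf_mu (line R)]_x (F x * (\1_(cube (p, q)) x)%:E))%E; last first.
  rewrite integral_mkcond; apply: eq_integral => x _.
  by rewrite patchE indicE; case: (_ \in _); rewrite ?mule1// mule0.
apply: (@le_trans _ _ (\int[sf_mu (line R)]_x
    \sum_(l < 2 ^ k) (F x * (\1_(cell c h (i * 2 ^ k + l)) x)%:E))%E).
  apply: (le_int (S := line R)).
  - by apply: mnnM => //; exact: mnn_indic.
  - split=> [|x]; last by apply: sume_ge0 => l _; exact: (mC l).2.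
    by apply: emeasurable_sum => l; exact: (mC l).1.
  apply: nearW => x; rewrite indicE.
  have S0 (P : pred 'I_(2 ^ k)) :
      (0 <= \sum_(l < 2 ^ k | P l) (F x * (\1_(cell c h (i * 2 ^ k + l)) x)%:E))%E.
    by apply: sume_ge0 => l _; exact: (mC l).2.
  have [|] := boolP (x \in _); last by rewrite mule0 => _; exact: (S0 xpredT).
  rewrite inE /cube/= in_itv/= mule1 => /andP[px xq].
  have cx : c <= x.
    by apply: le_trans px; apply: le_trans ip; rewrite lerDl mulr_ge0// ltW.
  have := cell_index h0 cx; set n := Num.truncn _ => nx.
  move/cellP: (nx) => /andP[n1 n2].
  have lo : (i * 2 ^ k <= n)%N.
    have := le_lt_trans (le_trans ip px) n2.
    by rewrite ltrD2l ltr_pM2l// ltr_nat ltnS.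
  have hi : (n < i.+1 * 2 ^ k)%N.
    have := le_lt_trans n1 (lt_le_trans xq qi).
    by rewrite ltrD2l ltr_pM2l// ltr_nat.
  have lt : (n - i * 2 ^ k < 2 ^ k)%N by rewrite ltn_subLR// -mulSnr.
  rewrite (bigD1 (Ordinal lt))//= subnKC// indicE mem_set// mule1.
  by rewrite leeDl.
rewrite ge0_integral_sum//; last 2 first.
- by move=> l; exact: (mC l).1.
- by move=> l x _; exact: (mC l).2.
rewrite -mulrA EFinM -tsum_EFin tsum_big ge0_sume_distrr; last first.
  by move=> l _; rewrite lee_fin fine_ge0.
apply: lee_sum => l _; rewrite /= fineK; last first.
  by rewrite ge0_fin_numE//; exact: fin.
by rewrite /cavg muleA -EFinM mulfV ?gt_eqF// mul1e.
Qed.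

End grids.

Section line_bound.
Context {R : realType} (S : sfspace R) (m : nat) (al b : 'I_m -> R)
  (N : 'I_m -> (S -> \bar R) -> \bar R).
Hypotheses (al0 : forall j, (0 < al j)%R) (FN : forall j, fnorm (N j))
  (NI : forall j (h : line R * S -> \bar R), mnn h ->
    (N j (fun w => \int[sf_mu (line R)]_x h (x, w)) <=
     \int[sf_mu (line R)]_x N j (fun w => h (x, w)))%E)
  (adb : admissible al b).
Local Open Scope ereal_scope.
Local Notation mu := (sf_mu (line R)).
Local Notation lf n := (leaf (R := R) (2 ^ n)).

Let b0 j : (0 <= b j)%R. Proof. by case: adb => /(_ j)/andP[]. Qed.

Definition line_norm (H : 'I_m -> line R * S -> \bar R) j : \bar R :=
  nm (S := line R) (b j) (fun x => N j (fun w => H j (x, w))).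

(** With H_j = |f_j|^(r_j) and al_j = 1 / r_j this unfolds to [lattice_max]. *)
Definition line_max (D : seq (R * R)) (H : 'I_m -> line R * S -> \bar R)
    (z : line R * S) : \bar R :=
  \big[maxe/0]_(Q <- D) ((\prod_j (((Q.2 - Q.1)^-1)%:E *
      \int[mu]_(x in cube Q) H j (x, z.2)) `^ al j) * (\1_(cube Q) z.1)%:E).

Lemma mnn_line_max D H : (forall j, mnn (H j)) -> all (fun Q => Q.1 < Q.2)%R D ->
  mnn (line_max D H).
Proof.
move=> mH; elim: D => [|Q D ihD] /=.
  move=> _; rewrite /line_max; under eq_fun do rewrite big_nil.
  exact: mnn_cst.
move=> /andP[Q12 /ihD mD]; rewrite /line_max; under eq_fun do rewrite big_cons.
have mQ : measurable (cube Q : set (line R)) by exact: measurable_itv.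
have mT : mnn (fun z : line R * S => (\prod_j (((Q.2 - Q.1)^-1)%:E *
      \int[mu]_(x in cube Q) H j (x, z.2)) `^ al j) * (\1_(cube Q) z.1)%:E : \bar R).
  apply: mnnM; last first.
    exact: (mnn_comp (mnn_indic mQ) measurable_fst).
  apply: mnn_prod => j; apply: mnn_poweR; apply: mnnM.
    by apply: mnn_cst; rewrite lee_fin invr_ge0 subr_ge0 ltW.
  have mHQ : mnn (fun z : S * line R => H j (z.2, z.1) * (\1_(cube Q) z.2)%:E).
    apply: mnnM; first exact: (mnn_comp (mH j) (@measurable_swap _ _ S (line R))).
    exact: (mnn_comp (mnn_indic mQ) (@measurable_snd _ _ S (line R))).
  have := mnn_comp (mnn_int (S := line R) mHQ) (@measurable_snd _ _ (line R) S).
  congr mnn; apply/funext => z; rewrite [RHS]integral_mkcond.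
  apply: eq_integral => x _.
  by rewrite patchE indicE; case: (_ \in _); rewrite ?mule1// mule0.
split=> [|z]; last by rewrite le_max mT.2.
by apply: measurable_maxe; [exact: mT.1|exact: mD.1].
Qed.

Section grid.
Variables (H : 'I_m -> line R * S -> \bar R) (c h : R) (n : nat).
Hypotheses (mH : forall j, mnn (H j)) (Hoo : forall j, line_norm H j < +oo)
  (h0 : (0 < h)%R).

Definition cell_mean j i w : R := fine (cavg c h (fun x => H j (x, w)) i).

Let mA j i : mnn (fun w => cavg c h (fun x => H j (x, w)) i).
Proof.
apply: mnnM; first by apply: mnn_cst; rewrite lee_fin invr_ge0 ltW.
have mHc : mnn (fun z : S * line R => H j (z.2, z.1) * (\1_(cell c h i) z.2)%:E).
  apply: mnnM; first exact: (mnn_comp (mH j) (@measurable_swap _ _ S (line R))).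
  exact: (mnn_comp (mnn_indic (cell_measurable c h i)) (@measurable_snd _ _ S (line R))).
exact: (mnn_int (S := line R) mHc).
Qed.

Let mN j : mnn (fun x => N j (fun w => H j (x, w))).
Proof. exact: (fn_meas (FN j) (mH j)). Qed.

Lemma norm_cavg_le j i : N j (fun w => cavg c h (fun x => H j (x, w)) i) <=
  cavg c h (fun x => N j (fun w => H j (x, w))) i.
Proof.
have hi0 : (0 <= h^-1)%R by rewrite invr_ge0 ltW.
have mHc : mnn (fun z : line R * S => H j z * (\1_(cell c h i) z.1)%:E).
  apply: mnnM => //.
  exact: (mnn_comp (mnn_indic (cell_measurable c h i)) (@measurable_fst _ _ (line R) S)).
rewrite /cavg (fn_Z (FN j))//; last first.
  by apply: (mnn_int (S := line R)
    (mnn_comp mHc (@measurable_swap _ _ S (line R)))).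
apply: lee_wpmul2l; first by rewrite lee_fin.
apply: (le_trans (NI j mHc)); rewrite le_eqVlt; apply/orP; left; apply/eqP.
apply: eq_integral => x _; rewrite indicE/=; case: (_ \in _) => /=.
  by rewrite mule1; congr (N j _); apply/funext => w; rewrite mule1.
by rewrite mule0 -(fn_0 (FN j)); congr (N j _); apply/funext => w; rewrite mule0.
Qed.

Lemma cavg_norm_fin j i : cavg c h (fun x => N j (fun w => H j (x, w))) i < +oo.
Proof.
(* A tree of depth i suffices, since the cell i is one of its 2^i leaves and a finite norm over the
   leaves makes every leaf value finite. *)
have := cavg_nm c h0 i (adb.1 j) (mN j) => le.
have := @nm_fin R (lf i) (b j) (cavg c h (fun x => N j (fun w => H j (x, w)))) (b0 j).
move=> fin; have /leaf_ae : \forall k \ae sf_mu (lf i),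
    cavg c h (fun x => N j (fun w => H j (x, w))) k < +oo.
  apply: fin; first by apply: mnn_leaf => k; exact: cavg_ge0.
  apply: (le_lt_trans le); apply: lte_mul_pinfty.
  - by rewrite lee_fin powR_ge0.
  - by [].
  - exact: Hoo.
by apply; rewrite ltn_expl.
Qed.

Lemma ae_cavg_fin : \forall w \ae sf_mu S, forall i j,
  cavg c h (fun x => H j (x, w)) i < +oo.
Proof.
apply/ae_foralln => i; apply: filter_forall => j; apply: (fn_fin (FN j)) => //.
exact: le_lt_trans (norm_cavg_le j i) (cavg_norm_fin j i).
Qed.

Lemma mnn_cell_mean j i : mnn (EFin \o cell_mean j i).
Proof. exact: mnn_fine (mA j i). Qed.

Lemma norm_cell_mean_le j i : N j (EFin \o cell_mean j i) <=
  cavg c h (fun x => N j (fun w => H j (x, w))) i.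
Proof.
apply: le_trans (norm_cavg_le j i); apply: (fn_le (FN j)) => //.
  exact: mnn_cell_mean.
apply: nearW => w; rewrite /= /cell_mean; have := (mA j i).2 w.
by case: cavg => [x| |]//= _; rewrite leey.
Qed.

(** The factors h^(-b_j), raised to the powers al_j, multiply to 1 / h and cancel the length of a
    cell. So the bound depends neither on the mesh nor on the depth. *)
Lemma grid_bound C : (0 <= C)%R ->
  (forall n (G : 'I_m -> nat -> S -> R), (forall j i, mnn (EFin \o G j i)) ->
    (forall j i, N j (EFin \o G j i) < +oo) -> int_ms al n G <= C%:E * \prod_j
      nm (S := lf n) (b j) (fun i => N j (EFin \o G j i)) `^ al j) ->
  h%:E * int_ms al n cell_mean <= C%:E * \prod_j line_norm H j `^ al j.
Proof.
move=> C0 CP; have cm_fin j i : N j (EFin \o cell_mean j i) < +oo.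
  exact: le_lt_trans (norm_cell_mean_le j i) (cavg_norm_fin j i).
apply: (@le_trans _ _ (h%:E * (C%:E * ((\prod_j (h `^ (- b j)) `^ al j)%:E *
    \prod_j line_norm H j `^ al j)))).
  apply: lee_wpmul2l; first by rewrite lee_fin ltW.
  apply: (le_trans (CP n cell_mean mnn_cell_mean cm_fin)).
  apply: lee_wpmul2l; first by rewrite lee_fin.
  rewrite -prod_EFin -big_split/=; apply: lee_prod => j; first exact: poweR_ge0.
  rewrite -poweR_EFin -poweRM ?lee_fin ?nm_ge0 ?powR_ge0//.
  apply: le_poweR; [exact: ltW|exact: nm_ge0|].
  apply: le_trans (cavg_nm c h0 n (adb.1 j) (mN j)); apply: le_nm => //.
  - by apply: mnn_leaf => i; exact: (fn_ge0 (FN j)).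
  - by apply: mnn_leaf => i; exact: cavg_ge0.
  by apply: nearW => i; exact: norm_cell_mean_le.
rewrite (eq_bigr (fun j => h `^ (- (al j * b j)))%R); last first.
  by move=> j _; rewrite -powRrM; congr (_ `^ _)%R; rewrite mulNr mulrC.
rewrite prod_powR_sum// sumrN adb.2 powR_inv1 ?(ltW h0)// muleCA.
by rewrite [h%:E * _]muleA -EFinM mulfV ?gt_eqF// mul1e.
Qed.

Definition grid_max (z : line R * S) : \bar R :=
  \sum_(i < 2 ^ n) ((\1_(cell c h i) z.1)%:E *
    (ms al n (fun j k => cell_mean j k z.2) i)%:E).

Let mms i := mnn_ms al n i mnn_cell_mean.

Lemma mnn_grid_max : mnn grid_max.
Proof.
have mT i : mnn (fun z : line R * S => (\1_(cell c h i) z.1)%:E *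
    (ms al n (fun j k => cell_mean j k z.2) i)%:E : \bar R).
  apply: mnnM.
    exact: (mnn_comp (mnn_indic (cell_measurable c h i)) (@measurable_fst _ _ (line R) S)).
  exact: (mnn_comp (mms i) (@measurable_snd _ _ (line R) S)).
split=> [|z]; last by apply: sume_ge0 => i _; exact: (mT i).2.
by apply: emeasurable_sum => i; exact: (mT i).1.
Qed.

Lemma int_grid_max : \int[sf_mu (prod_sf (line R) S)]_z grid_max z =
  h%:E * int_ms al n cell_mean.
Proof.
rewrite (int_prod mnn_grid_max) /grid_max.
have I0 i : 0 <= \int[sf_mu S]_w (ms al n (fun j k => cell_mean j k w) i)%:E.
  by apply: integral_ge0 => w _; exact: (mms i).2.
transitivity (\int[mu]_x \sum_(i < 2 ^ n) ((\1_(cell c h i) x)%:E *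
    \int[sf_mu S]_w (ms al n (fun j k => cell_mean j k w) i)%:E)).
  apply: eq_integral => x _; rewrite ge0_integral_sum//=; last 2 first.
  - by move=> i; apply: emeasurable_funM; [exact: measurable_cst|exact: (mms i).1].
  - by move=> i w _; rewrite mule_ge0 ?lee_fin ?ms_ge0.
  apply: eq_bigr => i _; rewrite ge0_integralZl_EFin//.
  - by move=> w _; exact: (mms i).2.
  - exact: (mms i).1.
rewrite ge0_integral_sum//; last 2 first.
- move=> i; apply: emeasurable_funM => //.
  exact: (mnn_indic (cell_measurable c h i)).1.
- by move=> i w _; rewrite mule_ge0// lee_fin.
rewrite /int_ms tsum_big ge0_sume_distrr//; apply: eq_bigr => i _.
rewrite ge0_integralZr//; last exact: (mnn_indic (cell_measurable c h i)).1.
by rewrite (int_indic (S := line R) (cell_measurable c h i)) cell_measure.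
Qed.

(** If Q lies in a dyadic block of comparable length, its averages are at most 6 times those of the
    block, and the block is one of those around the leaf containing [z.1]. *)
Lemma term_le_grid_max (Q : R * R) (i k : nat) z : (Q.1 < Q.2)%R ->
  (forall i j, cavg c h (fun x => H j (x, z.2)) i < +oo) ->
  (Q.2 <= c + h * (2 ^ n)%:R)%R -> (k <= n)%N ->
  (c + h * (i * 2 ^ k)%:R <= Q.1)%R -> (Q.2 <= c + h * (i.+1 * 2 ^ k)%:R)%R ->
  (h * (2 ^ k)%:R <= 6 * (Q.2 - Q.1))%R ->
  (\prod_j (((Q.2 - Q.1)^-1)%:E *
      \int[mu]_(x in cube Q) H j (x, z.2)) `^ al j) * (\1_(cube Q) z.1)%:E <=
  (\prod_j 6 `^ al j)%:E * grid_max z.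
Proof.
case: Q z => [p q] [x w] /= pq fin qn kn ip qi hk.
have M0 : 0 <= (\prod_j 6 `^ al j)%:E * grid_max (x, w).
  apply: mule_ge0; last exact: mnn_grid_max.2.
  by rewrite lee_fin; apply: prodr_ge0 => j _; exact: powR_ge0.
rewrite indicE; have [|] := boolP (x \in _); last by rewrite mule0.
rewrite inE /cube/= in_itv/= mule1 => /andP[px xq].
have cx : (c <= x)%R.
  by apply: le_trans px; apply: le_trans ip; rewrite lerDl mulr_ge0// ltW.
have := cell_index h0 cx; set l := Num.truncn _ => lx.
move/cellP: (lx) => /andP[l1 l2].
have lo : (i * 2 ^ k <= l)%N.
  have := le_lt_trans (le_trans ip px) l2.
  by rewrite ltrD2l ltr_pM2l// ltr_nat ltnS.
have hi : (l < i.+1 * 2 ^ k)%N.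
  have := le_lt_trans l1 (lt_le_trans xq qi).
  by rewrite ltrD2l ltr_pM2l// ltr_nat.
have ln : (l < 2 ^ n)%N.
  have := le_lt_trans l1 (lt_le_trans xq qn).
  by rewrite ltrD2l ltr_pM2l// ltr_nat.
have li : (l %/ 2 ^ k = i)%N.
  apply/eqP; rewrite eqn_leq leq_divRL ?expn_gt0// lo andbT.
  by rewrite -ltnS ltn_divLR ?expn_gt0.
apply: (@le_trans _ _ ((\prod_j 6 `^ al j)%:E *
    (ms al n (fun j k => cell_mean j k w) l)%:E)); last first.
  apply: lee_wpmul2l; first by rewrite lee_fin; apply: prodr_ge0 => j _; exact: powR_ge0.
  rewrite /grid_max (bigD1 (Ordinal ln))//= indicE mem_set// mul1e leeDl//.
  by apply: sume_ge0 => u _; rewrite mule_ge0 ?lee_fin// ms_ge0.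
have mF j : mnn (fun x : line R => H j (x, w)) by exact: (mnn_pair1 (T := line R) w (mH j)).
have cm0 j u : (0 <= cell_mean j u w)%R by rewrite fine_ge0// (mA j u).2.
apply: (@le_trans _ _ (\prod_j (6 * avg k (fun u => cell_mean j (i * 2 ^ k + u) w))%:E `^ al j)).
  apply: lee_prod => j; first exact: poweR_ge0.
  apply: le_poweR; first exact: ltW.
    apply: mule_ge0; first by rewrite lee_fin invr_ge0 subr_ge0 ltW.
    by apply: integral_ge0 => u _; exact: (mF j).2.
  by apply: cover_avg => // u _; exact: fin.
rewrite prod_EFin -EFinM lee_fin (eq_bigr (fun j => 6 `^ al j *
    avg k (fun u => cell_mean j (i * 2 ^ k + u) w) `^ al j)%R); last first.
  by move=> j _; rewrite powRM// avg_ge0.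
rewrite big_split/= ler_wpM2l//; first by apply: prodr_ge0 => j _; exact: powR_ge0.
by have := block_le_ms al (fun j u => cell_mean j u w) kn ln; rewrite li.
Qed.

End grid.

End line_bound.

Section line_bounded.
Context {R : realType}.

Lemma cubes_bounded (D : seq (R * R)) : all (fun Q => Q.1 < Q.2) D ->
  exists B d : R, [/\ 0 < B, 0 < d & forall Q, Q \in D ->
    [/\ - B <= Q.1, Q.2 <= B & d <= Q.2 - Q.1]].
Proof.
elim: D => [_|[p q] D ihD /= /andP[pq /ihD[B [d [B0 d0 BP]]]]]; first by exists 1, 1.
exists (`|p| + `|q| + B), (Num.min (q - p) d); split.
- by rewrite ltr_wpDl// addr_ge0.
- by rewrite lt_min subr_gt0 pq.
have p0 := normr_ge0 p; have q0 := normr_ge0 q.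
move=> Q; rewrite inE => /predU1P[->|/BP[Bp Bq dQ]] /=.
  have := ler_norm q; have := ler_norm (- p); rewrite normrN.
  by split; [lra|lra|rewrite ge_min lexx].
by split; [lra|lra|rewrite ge_min dQ orbT].
Qed.

(* A scale at which a block is comparable to, but three times longer than, an
   interval of length [l]. *)
Lemma pick_scale (h l : R) n : 0 < h -> h <= 3 * l -> 3 * l <= h * (2 ^ n)%:R ->
  exists k, [/\ (k <= n)%N, 3 * l <= h * (2 ^ k)%:R & h * (2 ^ k)%:R <= 6 * l].
Proof.
move=> h0 hl ln; have ex : exists k, 3 * l <= h * (2 ^ k)%:R by exists n.
have [k kP kmin] := ex_minnP ex; exists k; split => //; first exact: kmin.
case: k kmin kP => [|k] kmin kP; first by rewrite expn0 mulr1; lra.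
have : ~~ (3 * l <= h * (2 ^ k)%:R) by apply/negP => /kmin; rewrite ltnn.
by rewrite -ltNge expnS natrM => lt; lra.
Qed.

Context (S : sfspace R) (m : nat) (al b : 'I_m -> R)
  (N : 'I_m -> (S -> \bar R) -> \bar R).
Hypotheses (al0 : forall j, (0 < al j)%R) (FN : forall j, fnorm (N j))
  (NI : forall j (h : line R * S -> \bar R), mnn h ->
    (N j (fun w => \int[sf_mu (line R)]_x h (x, w)) <=
     \int[sf_mu (line R)]_x N j (fun w => h (x, w)))%E)
  (adb : admissible al b).
Local Open Scope ereal_scope.

Lemma line_bounded : dyadic_bounded al N b -> exists2 C : R, (0 <= C)%R &
  forall (D : seq (R * R)) (H : 'I_m -> line R * S -> \bar R),
  all (fun Q => Q.1 < Q.2)%R D -> (forall j, mnn (H j)) ->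
  (forall j, line_norm b N H j < +oo) ->
  \int[sf_mu (prod_sf (line R) S)]_z line_max al D H z <=
  C%:E * \prod_j line_norm b N H j `^ al j.
Proof.
move=> [C C0 CP]; pose e6 := (\prod_j 6 `^ al j : R)%R.
have e60 : (0 <= e6)%R by apply: prodr_ge0 => j _; exact: powR_ge0.
exists (e6 * (2 * C))%R; first by rewrite !mulr_ge0.
move=> D H Dlt mH Hoo; have [B [d [B0 d0 DP]]] := cubes_bounded Dlt.
(* The depth depends on D, but the constant does not. As 2^n > 2 B / d, the mesh h is less than 3 d,
   so every interval of D has a suitable scale. *)
pose n := (Num.truncn (2 * B / d)).+1.
pose h : R := (6 * B / (2 ^ n)%:R)%R.
have n20 : (0 < (2 ^ n)%:R :> R)%R by rewrite ltr0n expn_gt0.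
have h0 : (0 < h)%R by rewrite divr_gt0// mulr_gt0.
have hn : (h * (2 ^ n)%:R = 6 * B)%R by rewrite /h divfK// gt_eqF.
have hd : (h <= 3 * d)%R.
  have lt1 : (2 * B / d < n%:R)%R.
    have /andP[_] : ((Num.truncn (2 * B / d))%:R <= 2 * B / d < n%:R)%R; last by [].
    by apply: truncn_itv; rewrite divr_ge0 ?mulr_ge0// ltW.
  have lt2 : (n%:R <= (2 ^ n)%:R :> R)%R by rewrite ler_nat ltnW// ltn_expl.
  move: (lt_le_trans lt1 lt2); rewrite /h ltr_pdivrMr// ler_pdivrMr// => lt3.
  lra.
(* Two grids of total length 6 B, both covering [-B, B). Their shift 2 B is a third of the total
   length, hence a third of a power of 2 times the block length at every scale, as the one-third
   trick requires. *)
pose c0 : R := (- (3 * B))%R; pose c1 : R := (- B)%R.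
pose M c := grid_max al H c h n.
have mM c : mnn (M c) by exact: mnn_grid_max.
have M0 c z : 0 <= M c z by exact: (mM c).2.
have termP z : (forall i j, cavg c0 h (fun x => H j (x, z.2)) i < +oo) ->
    (forall i j, cavg c1 h (fun x => H j (x, z.2)) i < +oo) ->
    line_max al D H z <= e6%:E * (M c0 z + M c1 z).
  move=> fin0 fin1; rewrite /line_max big_seq.
  have E0 : 0 <= e6%:E * (M c0 z + M c1 z) by rewrite mule_ge0 ?lee_fin// adde_ge0.
  elim/big_ind: _ => // [x y xE yE|Q QD]; first by rewrite ge_max xE.
  have [Bp qB dQ] := DP Q QD; have Q12 : (Q.1 < Q.2)%R by move/allP: Dlt => /(_ Q QD).
  have hl : (h <= 3 * (Q.2 - Q.1))%R by lra.
  have ln : (3 * (Q.2 - Q.1) <= h * (2 ^ n)%:R)%R by rewrite hn; lra.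
  have [k [kn lk kl]] := pick_scale h0 hl ln.
  have w0 : (0 < h * (2 ^ k)%:R)%R by rewrite mulr_gt0// ltr0n expn_gt0.
  have wE : (h * (2 ^ k)%:R * 2 ^+ (n - k) / 3 = 2 * B)%R.
    have e2 : ((2 ^ k)%:R * 2 ^+ (n - k) = (2 ^ n)%:R :> R)%R.
      by rewrite -natrX -natrM -expnD subnKC.
    by rewrite -(mulrA h) e2 hn; lra.
  have c1E : (c0 + h * (2 ^ k)%:R * 2 ^+ (n - k) / 3 = c1)%R.
    by rewrite wE /c0 /c1; ring.
  have c1p : (c0 + h * (2 ^ k)%:R * 2 ^+ (n - k) / 3 <= Q.1)%R by rewrite c1E.
  case: (grid_pick w0 Q12 lk c1p) => i; rewrite c1E.
  have shape (j : nat) : (h * (j * 2 ^ k)%:R = h * (2 ^ k)%:R * j%:R)%R.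
    by rewrite natrM -mulrA; congr (_ * _)%R; rewrite mulrC.
  case=> [[i1 i2]|[i1 i2]].
    apply: (@le_trans _ _ (e6%:E * M c0 z)).
      have qn : (Q.2 <= c0 + h * (2 ^ n)%:R)%R by rewrite hn /c0; lra.
      rewrite -shape in i1; rewrite -shape in i2.
      exact: (term_le_grid_max al0 mH h0 Q12 fin0 qn kn i1 i2 kl).
    by apply: lee_wpmul2l; rewrite ?lee_fin// leeDl.
  apply: (@le_trans _ _ (e6%:E * M c1 z)).
    have qn : (Q.2 <= c1 + h * (2 ^ n)%:R)%R by rewrite hn /c1; lra.
    rewrite -shape in i1; rewrite -shape in i2.
    exact: (term_le_grid_max al0 mH h0 Q12 fin1 qn kn i1 i2 kl).
  by apply: lee_wpmul2l; rewrite ?lee_fin// leeDr.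
have mL := mnn_line_max al mH Dlt.
apply: (@le_trans _ _ (\int[sf_mu (prod_sf (line R) S)]_z (e6%:E * (M c0 z + M c1 z)))).
  have mE : mnn (fun z : line R * S => e6%:E * (M c0 z + M c1 z)).
    by apply: mnnM; [exact: mnn_cst|exact: mnnD].
  rewrite (int_prod mL) (int_prod mE); apply: (le_int (S := line R)).
  - exact: mnn_int.
  - exact: (mnn_int (S := S) mE).
  apply: nearW => x; apply: le_int.
  - exact: (mnn_pair2 (T := line R) x mL).
  - exact: (mnn_pair2 (T := line R) x mE).
  have f0 := ae_cavg_fin FN NI adb c0 mH Hoo h0.
  have f1 := ae_cavg_fin FN NI adb c1 mH Hoo h0.
  by apply: filterS2 f0 f1 => w fin0 fin1; apply: termP.
rewrite ge0_integralZl_EFin//; last 2 first.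
- by move=> z _; rewrite adde_ge0.
- exact: (mnnD (mM c0) (mM c1)).1.
rewrite EFinM -muleA; apply: lee_wpmul2l; first by rewrite lee_fin.
rewrite ge0_integralD//; last 2 first.
- exact: (mM c0).1.
- exact: (mM c1).1.
have J c : \int[sf_mu (prod_sf (line R) S)]_z M c z <=
    C%:E * \prod_j line_norm b N H j `^ al j.
  rewrite /M (int_grid_max al c n mH h0).
  exact: (grid_bound al0 FN NI adb _ _ mH Hoo h0 C0 CP).
apply: (le_trans (leeD (J c0) (J c1))); rewrite EFinM -muleA.
by rewrite -[leLHS]mule2n -mule_natl.
Qed.

End line_bounded.

(** * The theorem *)

Section exponents.
Context {R : realType}.
Local Open Scope ereal_scope.

Lemma einvE (t : \bar R) : 0 < t -> t^-1 = (einv t)%:E.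
Proof.
move=> t0; rewrite /einv; case: t t0 => [t|_|//]; last by rewrite invey.
by rewrite lte_fin => t0; rewrite inver gt_eqF.
Qed.

Lemma einvM_lt1 (r : R) (t : \bar R) : (0 < r)%R -> r%:E < t -> (einv t * r < 1)%R.
Proof.
move=> r0 rt; rewrite /einv; case: t rt => [t|_|]; last by rewrite ltNge leNye.
  2: by rewrite invey/= mul0r.
rewrite lte_fin => rt; have t0 := lt_trans r0 rt.
by rewrite inver gt_eqF//= mulrC ltr_pdivrMr// mul1r.
Qed.

Lemma harmE n (p : 'I_n -> \bar R) : (forall j, 0 < p j) ->
  harm p = ((\sum_j einv (p j))%R%:E)^-1.
Proof.
by move=> p0; rewrite /harm -sumEFin; congr (_^-1); apply: eq_bigr => j _; exact: einvE.
Qed.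

End exponents.

Section HL_iN.
Context {R : realType} (K : nat) (Om : 'I_K.+1 -> sfspace R) (M : nat).
Local Open Scope ereal_scope.
Local Notation S := (iter_sf Om).
Variables (r : 'I_M -> R) (X : 'I_M -> fspace S) (a : 'I_M -> 'I_K.+1 -> R)
  (p : 'I_M -> \bar R).
Hypotheses (M0 : (0 < M)%N) (r0 : forall j, (0 < r j)%R)
  (a0 : forall j k, (0 <= a j k)%R) (ar : forall j k, (a j k * r j < 1)%R)
  (a1 : forall k, (\sum_j a j k = 1)%R)
  (XN : forall j, normed_by (X j) (iN (Om := Om) (a j)))
  (rp : forall j, (r j)%:E < p j) (pa : forall j, einv (p j) = a j ord0).

Let p0 j : 0 < p j. Proof. by apply: lt_trans (rp j); rewrite lte_fin. Qed.

Let prodN : normed_by (prod_fs X) (iN (Om := Om) (fun=> 1%R)).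
Proof. exact: (normed_by_prod _ a0 a1 XN). Qed.

Let harm1 : harm p = 1.
Proof. by rewrite harmE// (eq_bigr (a ^~ ord0))// a1 inver oner_eq0 invr1. Qed.

Let al j : R := (r j)^-1%R.
(** The exponents that suit |f_j|^(r_j). Multiplication by al_j returns a_(j,k), which is why they
    are admissible at each level. *)
Let u j k : R := (a j k * r j)%R.
Let N j := iN (Om := Om) (u j).

Let u0 j k : (0 <= u j k)%R. Proof. by apply: mulr_ge0 => //; exact: ltW. Qed.
Let u01 j k : (0 <= u j k <= 1)%R. Proof. by rewrite u0 ltW ?ar. Qed.
Let FN j : fnorm (N j). Proof. exact: fnorm_iN. Qed.

Let adm k : admissible al (u ^~ k).
Proof.
split=> [j|]; first by rewrite u0 ar.
by rewrite -(a1 k); apply: eq_bigr => j _; rewrite /al /u mulrCA mulVf ?mulr1// gt_eqF.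
Qed.

Let NI j (h : line R * S -> \bar R) : mnn h ->
  N j (fun w => \int[sf_mu (line R)]_x h (x, w)) <=
  \int[sf_mu (line R)]_x N j (fun w => h (x, w)).
Proof.
by move=> mh; have [hi ni] := iN_dual Om (u01 j); exact: (minkowski_int (FN j) hi ni).
Qed.

Let absH (f : 'I_M -> prod_sf (line R) S -> R[i]) j (z : line R * S) : \bar R :=
  (absc (f j z) `^ r j)%R%:E.

Let mixed_line (f : 'I_M -> prod_sf (line R) S -> R[i]) j : cmeasurable (f j) ->
  line_norm (u ^~ ord0) N (absH f) j `^ al j =
  mixed (@Lebesgue _ (line R) (p j)) (X j) (f j).
Proof.
move=> mf; have Fa := fnorm_iN Om (a0 j).
rewrite (mixedE (p0 j) Fa (@XN j) mf) pa /mixn /line_norm.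
have mA := mnn_absc mf.
rewrite (_ : (fun x => N j _) = fun x => iN (Om := Om) (a j) (fun w => (absc (f j (x, w)))%:E) `^ r j).
  by rewrite nm_poweR//; [rewrite poweRK ?nm_ge0// gt_eqF|exact: (fn_meas Fa mA)].
apply/funext => x; rewrite -iN_poweR//.
exact: (mnn_pair2 (T := line R) x mA).
Qed.

(** The dual space has no special role here: it will be one more member of a tuple whose exponents
    sum to 1 at each level. The product norm is then iterated L^1, so together with the line the
    target norm is an integral over the product space. *)
Lemma HL_iN : HL r X.
Proof.
have arW j k : (a j k * r j <= 1)%R by exact: ltW.
split.
- by move=> j; exact: (normed_by_qbfs (a0 j) (@XN j) (r0 j) (arW j)).
- have e0 (k : 'I_K.+1) : (0 <= 1 :> R)%R by [].
  by apply: (normed_by_qbfs e0 prodN ltr01) => k; rewrite mulr1.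
- by move=> j; split => //; exact: (normed_by_pconvex (a0 j) (@XN j) (r0 j) (arW j)).
exists p; split => //.
have al0 j : (0 < al j)%R by rewrite invr_gt0.
have db : dyadic_bounded al N (u ^~ ord0).
  by apply: (dyadic_bounded_iN M0 al0 _ adm (adm ord0)).
have [C C0 CP] := line_bounded al0 FN NI (adm ord0) db.
exists C => D Dlt f fin; have mf j : cmeasurable (f j) by case: (fin j).
have mH j : mnn (absH f j).
  rewrite (_ : absH f j = fun z => (absc (f j z))%:E `^ r j)//.
  exact: mnn_poweR (mnn_absc (mf j)).
have HP : lattice_max D r f = line_max al D (absH f) by [].
have F1 : fnorm (iN (Om := Om) (fun=> 1%R)) by exact: fnorm_iN.
have e1 : einv 1 = 1%R :> R by rewrite /einv inver oner_eq0 /= invr1.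
have mL := mnn_line_max al mH Dlt.
rewrite harm1 HP (@fs_extE _ _ _ (mixn (S1 := line R) 1%R (iN (Om := Om) (fun=> 1%R))) _) //; last 2 first.
- exact: fnorm_mix.
- move=> g mg; rewrite (mixedE lte01 F1 prodN); last exact/cmeasurable_cfun.
  by rewrite e1; congr mixn; apply/funext => w; rewrite absc_real.
rewrite /mixn nm1; last exact: (fn_meas F1 mL).
rewrite (eq_integral (fun x => \int[sf_mu S]_w line_max al D (absH f) (x, w))); last first.
  by move=> x _; apply: iN1 => //; exact: (mnn_pair2 (T := line R) x mL).
rewrite -(int_prod mL).
have Hoo j : line_norm (u ^~ ord0) N (absH f) j < +oo.
  have := (fin j).2; rewrite -mixed_line// !ltey; apply: contra_neq => ->.
  by rewrite poweRyr// gt_eqF.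
apply: (le_trans (CP D (absH f) Dlt mH Hoo)).
by rewrite (eq_bigr _ (fun j _ => mixed_line (mf j))).
Qed.

End HL_iN.

Section fam_rcons.
Context {A : Type} (m : nat) (a : 'I_m -> A) (x : A).

Lemma fam_rcons_lift j : fam_rcons a x (lift ord_max j) = a j.
Proof. by rewrite /fam_rcons liftK. Qed.

Lemma fam_rcons_max : fam_rcons a x ord_max = x.
Proof. by rewrite /fam_rcons unlift_none. Qed.

End fam_rcons.

Theorem proposition4p8 (R : realType) (m : nat) (r : 'I_m -> R) (s : \bar R)
    (K : nat) (t : 'I_K.+1 -> 'I_m -> \bar R) (Omega : 'I_K.+1 -> sfspace R)
    (r_gt0 : forall j, 0 < r j)
    (s_gt1 : (1 < s)%E)
    (r_lt_t : forall k j, ((r j)%:E < t k j)%E)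
    (t_ge1_lt_s : forall k, (1 <= harm (t k))%E /\ (harm (t k) < s)%E) :
  UMD r s (fun j => iter_Lebesgue (Om := Omega) (fun k => t k j)).
Proof.
have t0 k j : (0 < t k j)%E by apply: lt_trans (r_lt_t k j); rewrite lte_fin.
pose a j k := einv (t k j); pose A k := \sum_j a j k.
pose X j := iter_Lebesgue (Om := Omega) (fun k => t k j).
have a0 j k : 0 <= a j k by exact: einv_ge0.
have XN j : normed_by (X j) (iN (Om := Omega) (a j)).
  by move=> f mf; apply: iter_LebesgueE.
have harm_t k : harm (t k) = ((A k)%:E^-1)%E by exact: harmE.
have A0 k : 0 < A k.
  rewrite lt0r sumr_ge0 ?andbT => [|j _]; last exact: a0.
  (* A vanishing sum would give [harm (t k) = +oo], which is not below s. *)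
  apply/eqP => A0; have [_] := t_ge1_lt_s k.
  by rewrite harm_t A0 inver eqxx ltNge leey.
have harm_tE k : harm (t k) = ((A k)^-1)%:E by rewrite harm_t inver gt_eqF.
have A1 k : A k <= 1.
  by have [] := t_ge1_lt_s k; rewrite harm_tE lee_fin invf_ge1.
have s0 : (0 < s)%E by exact: lt_trans s_gt1.
have sA k : einv s < A k.
  have [_] := t_ge1_lt_s k; rewrite harm_tE => As.
  by have := @einvM_lt1 R _ s _ As; rewrite invr_gt0 => /(_ (A0 k)); rewrite ltr_pdivrMr// mul1r.
have s1 : einv s < 1 by exact: lt_le_trans (sA ord0) (A1 ord0).
have m0 : (0 < m)%N.
  rewrite lt0n; apply/eqP => m0; have := A0 ord0.
  rewrite /A big1 ?ltxx// => i; exfalso; case: i => i ilt.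
  by rewrite m0 in ilt.
have A01 k : 0 <= A k <= 1 by rewrite ltW// A1.
have PN : normed_by (prod_fs X) (iN (Om := Omega) A).
  exact: normed_by_prod.
pose s' := (1 - einv s)^-1; have s'0 : 0 < s' by rewrite invr_gt0 subr_gt0.
(* The exponent on the line that belongs to the dual space, matching its outermost exponent; it is
   +oo when [A ord0 = 1]. It exceeds s' because 1 / s < [A ord0]. *)
pose q : \bar R := ((1 - A ord0)%:E^-1)%E.
have qE : einv q = 1 - A ord0 by rewrite /einv inveK.
have s'q : (s'%:E < q)%E.
  rewrite /q inver; case: ifPn => [_|h]; first exact: ltry.
  have h0 : 0 < 1 - A ord0 by rewrite lt0r h subr_ge0 A1.
  have h1 : 0 < 1 - einv s by rewrite subr_gt0.
  by rewrite lte_fin /s' ltf_pV2 ?posrE// ltrD2l ltrN2 sA.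
split.
- split=> //; apply: lt_trans (t_ge1_lt_s ord0).2.
  rewrite harm_tE harmE => [|j]; last by rewrite lte_fin.
  rewrite (eq_bigr (fun j => (r j)^-1)); last first.
    by move=> j _; rewrite /einv inver gt_eqF.
  have lt : A ord0 < \sum_j (r j)^-1.
    apply: ltr_sum => [|j _].
      by apply/hasP; exists (Ordinal m0); rewrite ?mem_index_enum.
    by rewrite -[ltRHS]mul1r ltr_pdivlMr// einvM_lt1.
  have lt0 := lt_trans (A0 ord0) lt.
  by rewrite inver gt_eqF// lte_fin ltf_pV2 ?posrE.
- exact: (normed_by_bfs (fun k => ltW (A0 k)) PN A1).
- exact: (normed_by_order_continuous (fun k => ltW (A0 k)) PN A0).
exists s'; split => //.
  by rewrite einvE// -EFinD /s' invrK subrKC.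
have DN := normed_by_dual A01 PN.
(* The dual has exponents 1 - A_k, so the extended tuple sums to 1 at each level; the strict bound
   for its last member is 1 - A_k < 1 - 1 / s, which is t^k < s. *)
apply: (@HL_iN R K Omega m.+1 _ _ (fam_rcons a (fun k => 1 - A k)) (fam_rcons (t ord0) q)) => //.
- by move=> i; case: (unliftP ord_max i) => [j ->|->]; rewrite ?fam_rcons_lift ?fam_rcons_max.
- move=> i k; case: (unliftP ord_max i) => [j ->|->]; rewrite ?fam_rcons_lift ?fam_rcons_max//.
  by rewrite subr_ge0 A1.
- move=> i k; case: (unliftP ord_max i) => [j ->|->]; rewrite ?fam_rcons_lift ?fam_rcons_max.
    exact: einvM_lt1.
  by rewrite ltr_pdivrMr ?subr_gt0// mul1r ltrD2l ltrN2 sA.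
- move=> k; rewrite big_ord_recr/= fam_rcons_max (eq_bigr (a ^~ k)) ?subrKC// => j _.
  rewrite (_ : widen_ord _ j = lift ord_max j) ?fam_rcons_lift//.
  exact/val_inj/esym/lift_max.
- move=> i; case: (unliftP ord_max i) => [j ->|->].
    by rewrite !fam_rcons_lift; exact: XN.
  by rewrite !fam_rcons_max; exact: DN.
- by move=> i; case: (unliftP ord_max i) => [j ->|->]; rewrite ?fam_rcons_lift ?fam_rcons_max.
- by move=> i; case: (unliftP ord_max i) => [j ->|->]; rewrite ?fam_rcons_lift ?fam_rcons_max.
Qed.
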